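(* Let $n\ge 2$. If $\mathring{\mathcal B}_p\subset X\subset\mathcal K_s$, then $X$ is homotopy dense in $\mathcal K_s$.
   Context: The support function of a nonempty compact convex set $D\subset\mathbb R^n$ is $h_D(v)=\sup\{\langle x,v\rangle: x\in D\}$, and its Steiner point is $s(D)=\frac{1}{\mathrm{vol}(\mathbb B^n)}\int_{\mathbb S^{n-1}}u\,h_D(u)\,du$, where $\mathbb B^n$ is the closed unit ball about the origin $o$ and $\mathbb S^{n-1}=\partial\mathbb B^n$. $\mathcal K_s$ is the set of all nonempty compact convex subsets of $\mathbb R^n$ with Steiner point $o$, with the Hausdorff metric; $O(n)$ acts on it by $(g,D)\mapsto g(D)$. A convex body is a compact convex set with nonempty interior; it is $C^\infty$ if its boundary is a $C^\infty$ submanifold of $\mathbb R^n$. $\mathcal B_p\subset\mathcal K_s$ is the subspace of $C^\infty$ convex bodies in $\mathcal K_s$ whose boundary has positive Gaussian curvature, and $\mathring{\mathcal B}_p$ is the set of points of $\mathcal B_p$ whose isotropy subgroup in $O(n)$ is trivial. A subspace $A$ of a space $Y$ is homotopy dense if there is a homotopy $h\colon Y\times[0,1]\to Y$ with $h(\cdot,0)=\mathrm{id}$ and $h(Y\times(0,1])\subset A$. *)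

(* Defs.v *)
From HB Require Import structures.
From mathcomp Require Import all_boot all_order all_algebra.
From mathcomp Require Import all_classical all_reals all_analysis.
From mathcomp Require Import measurable_realfun.
From mathcomp Require Import ring lra.

Set Implicit Arguments.
Unset Strict Implicit.
Unset Printing Implicit Defensive.
Import Order.TTheory GRing.Theory Num.Theory.
Import numFieldNormedType.Exports.
Local Open Scope classical_set_scope.
Local Open Scope ring_scope.

(** R^n is ['rV[R]_n].  The library's norm [`|x|] on it is the sup norm, which
    has the right topology but is not Euclidean, hence [enorm]. *)

Section Euclidean.
Context {R : realType} {n : nat}.
Implicit Types x y z : 'rV[R]_n.

Definition dot x y : R := \sum_(i < n) x 0 i * y 0 i.
Definition enorm x : R := Num.sqrt (dot x x).
Definition eball : set 'rV[R]_n := [set x | enorm x <= 1].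
Definition esphere : set 'rV[R]_n := [set x | enorm x = 1].

Lemma dotC x y : dot x y = dot y x.
Proof. by apply: eq_bigr => i _; rewrite mulrC. Qed.

Lemma dotxx_ge0 x : 0 <= dot x x.
Proof. by apply: sumr_ge0 => i _; rewrite -expr2 sqr_ge0. Qed.

Lemma enorm_ge0 x : 0 <= enorm x.
Proof. exact: sqrtr_ge0. Qed.

Lemma enorm_sqr x : enorm x ^+ 2 = dot x x.
Proof. by rewrite sqr_sqrtr// dotxx_ge0. Qed.

Lemma enorm0 : enorm 0 = 0.
Proof.
by rewrite /enorm /dot big1 ?sqrtr0// => i _; rewrite mxE mul0r.
Qed.

Lemma enormN x : enorm (- x) = enorm x.
Proof. by congr Num.sqrt; apply: eq_bigr => i _; rewrite !mxE mulrNN. Qed.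

Lemma enormB x y : enorm (x - y) = enorm (y - x).
Proof. by rewrite -enormN opprB. Qed.

Lemma coord_le_enorm x i : `|x 0 i| <= enorm x.
Proof.
rewrite -(@ler_pXn2r _ 2) ?nnegrE ?enorm_ge0// enorm_sqr real_normK ?num_real//.
rewrite /dot (bigD1 i)//= -expr2 lerDl.
by apply: sumr_ge0 => j _; rewrite -expr2 sqr_ge0.
Qed.

Lemma norm_le_enorm x : `|x| <= enorm x.
Proof.
rewrite [leLHS]/Num.norm/= mx_normrE; apply/bigmax_leP; split; first exact: enorm_ge0.
by move=> [i j] _ /=; rewrite ord1; exact: coord_le_enorm.
Qed.

Lemma coord_le_norm x i : `|x 0 i| <= `|x|.
Proof.
rewrite [leRHS]/Num.norm/= mx_normrE.
exact: (le_bigmax _ (fun ij : 'I_1 * 'I_n => `|x ij.1 ij.2|) (0, i)).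
Qed.

Lemma dotxx_le x : dot x x <= n%:R * `|x| ^+ 2.
Proof.
rewrite mulr_natl -[n in _ *+ n](card_ord n) -sumr_const; apply: ler_sum => i _.
by rewrite -expr2 -real_normK ?num_real// ler_pXn2r ?nnegrE// coord_le_norm.
Qed.

Lemma dot_CauchySchwarz x y : dot x y <= enorm x * enorm y.
Proof.
have key (a b : R) : 0 <= a ^+ 2 * dot y y - 2 * a * b * dot x y + b ^+ 2 * dot x x.
  rewrite /dot !mulr_sumr -sumrB -big_split/=; apply: sumr_ge0 => i _.
  rewrite (_ : _ + _ = (a * y 0 i - b * x 0 i) ^+ 2) ?sqr_ge0//.
  by ring.
have := key (enorm x) (enorm y); rewrite -!enorm_sqr.
have [/eqP x0|xn0] := boolP (enorm x == 0).
  have z i : x 0 i = 0.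
    apply/eqP; rewrite -normr_le0 -x0; exact: coord_le_enorm.
  move=> _; rewrite x0 mul0r /dot big1// => i _; rewrite z mul0r//.
have [/eqP y0|yn0] := boolP (enorm y == 0).
  have z i : y 0 i = 0.
    apply/eqP; rewrite -normr_le0 -y0; exact: coord_le_enorm.
  move=> _; rewrite y0 mulr0 /dot big1// => i _; rewrite z mulr0//.
have xy0 : 0 < enorm x * enorm y.
  by rewrite mulr_gt0// lt_neqAle eq_sym ?xn0 ?yn0 enorm_ge0.
move=> h; rewrite -(ler_pM2l xy0); move: h; nra.
Qed.

Lemma enormD x y : enorm (x + y) <= enorm x + enorm y.
Proof.
rewrite -(@ler_pXn2r _ 2) ?nnegrE ?addr_ge0 ?enorm_ge0// sqrrD !enorm_sqr.
rewrite (_ : dot (x + y) (x + y) = dot x x + 2 * dot x y + dot y y).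
  have := dot_CauchySchwarz x y; lra.
rewrite /dot mulr_sumr -!big_split/=; apply: eq_bigr => i _; rewrite !mxE.
by ring.
Qed.

Lemma enorm_triangle y x z : enorm (x - z) <= enorm (x - y) + enorm (y - z).
Proof. by apply: le_trans (enormD _ _); rewrite addrA subrK. Qed.

End Euclidean.
Arguments eball {R} n.
Arguments esphere {R} n.

(** Lebesgue measure on R^n, as an iterated product, on the Borel sigma-algebra
    (the one generated by the coordinates). *)

Section RowBorel.
Context {R : realType} {n : nat}.

Let coords : 'I_n -> 'rV[R]_n -> measurableTypeR R := fun i x => x 0 i.

Let rV0 : g_sigma_preimage coords set0.
Proof. exact: sigma_algebra0. Qed.
Let rVC A : g_sigma_preimage coords A -> g_sigma_preimage coords (~` A).
Proof. exact: sigma_algebraC. Qed.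
Let rVU (F : _^nat) : (forall i, g_sigma_preimage coords (F i)) ->
  g_sigma_preimage coords (\bigcup_i (F i)).
Proof. exact: sigma_algebra_bigcup. Qed.

HB.instance Definition _ := @isMeasurable.Build default_measure_display
  'rV[R]_n (g_sigma_preimage coords) rV0 rVC rVU.

Lemma measurable_coord (i : 'I_n) :
  measurable_fun [set: 'rV[R]_n] (fun x => x 0 i : measurableTypeR R).
Proof.
move=> _ Y mY; rewrite setTI; apply: sub_sigma_algebra => /=.
rewrite -bigcup_seq/=; exists i => /=; first by rewrite mem_index_enum.
by exists Y => //; rewrite setTI.
Qed.

Lemma measurable_fun_rVP d (T : measurableType d) (f : T -> 'rV[R]_n) :
  (forall i, measurable_fun [set: T] (fun t => f t 0 i : measurableTypeR R)) ->
  measurable_fun [set: T] f.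
Proof.
move=> mf _ A; rewrite setTI => mA.
have : image_set_system setT f (@measurable _ T) A.
  move: A mA; apply: smallest_sub.
    exact/sigma_algebra_image/sigma_algebra_measurable.
  move=> B; rewrite -bigcup_seq/= => -[i _ [C mC <-]].
  rewrite /image_set_system/= !setTI.
  by have := mf i measurableT C mC; rewrite setTI.
by rewrite /image_set_system/= setTI.
Qed.

End RowBorel.

Section RowLebesgue.
Context {R : realType}.

Definition rV_cons n (p : measurableTypeR R * 'rV[R]_n) : 'rV[R]_n.+1 :=
  row_mx (p.1 : R)%:M p.2.

Definition rV_uncons n (x : 'rV[R]_n.+1) : measurableTypeR R * 'rV[R]_n :=
  (x 0 0, \row_i x 0 (lift 0 i)).

Lemma rV_cons0 n (p : measurableTypeR R * 'rV[R]_n) : rV_cons p 0 0 = p.1.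
Proof.
have := row_mxEl (p.1 : R)%:M p.2 0 0.
rewrite [X in _ = X -> _]mxE eqxx mulr1n => <-.
by rewrite (_ : lshift n 0 = 0)//; exact/val_inj.
Qed.

Lemma rV_cons_lift n (p : measurableTypeR R * 'rV[R]_n) (i : 'I_n) :
  rV_cons p 0 (lift 0 i) = p.2 0 i.
Proof.
rewrite -(row_mxEr (p.1 : R)%:M p.2 0 i).
by rewrite (_ : rshift 1 i = lift 0 i)//; exact/val_inj.
Qed.

Lemma rV_consK n : cancel (@rV_cons n) (@rV_uncons n).
Proof.
move=> [a v]; rewrite /rV_uncons rV_cons0; congr (_, _).
by apply/rowP => i; rewrite mxE rV_cons_lift.
Qed.

Lemma measurable_rV_cons n : measurable_fun setT (@rV_cons n).
Proof.
apply: measurable_fun_rVP => i; case: (unliftP 0 i) => [j|] ->.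
  rewrite (_ : (fun _ => _) = (fun x : 'rV[R]_n => x 0 j : measurableTypeR R) \o snd).
    by apply: measurableT_comp => //; exact: measurable_coord.
  by apply/funext => p /=; rewrite rV_cons_lift.
rewrite (_ : (fun _ => _) = fst); first exact: measurable_fst.
by apply/funext => p /=; rewrite rV_cons0.
Qed.

Lemma measurable_rV_uncons n : measurable_fun setT (@rV_uncons n).
Proof.
apply: measurable_fun_pair; first exact: measurable_coord.
apply: measurable_fun_rVP => i.
rewrite (_ : (fun _ => _) = (fun x : 'rV[R]_n.+1 => x 0 (lift 0 i) : measurableTypeR R)).
  exact: measurable_coord.
by apply/funext => x; rewrite mxE.
Qed.

Section Cons.
Context (n : nat) (mu : {sigma_finite_measure set 'rV[R]_n -> \bar R}).

Definition rV_cons_measure : set 'rV[R]_n.+1 -> \bar R :=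
  pushforward (lebesgue_measure \x mu)%E (@rV_cons n).

Let mcons := @measurable_rV_cons n.
Let rV_cons_measure0 : rV_cons_measure set0 = 0%E.
Proof. exact: measure0. Qed.
Let rV_cons_measure_ge0 A : (0 <= rV_cons_measure A)%E.
Proof. exact: measure_ge0. Qed.
Let rV_cons_measure_sigma_additive : semi_sigma_additive rV_cons_measure.
Proof. exact: measure_semi_sigma_additive. Qed.

HB.instance Definition _ := isMeasure.Build _ _ _ rV_cons_measure
  rV_cons_measure0 rV_cons_measure_ge0 rV_cons_measure_sigma_additive.

Lemma rV_cons_measure_sigma_finite : sigma_finite setT rV_cons_measure.
Proof.
have /sigma_finiteP[F [FT ndF Foo]] := sigma_finiteT (@lebesgue_measure R).
have /sigma_finiteP[G [GT ndG Goo]] := sigma_finiteT mu.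
have mFG k : measurable (F k `*` G k).
  by apply: measurableX; [exact: (Foo k).1|exact: (Goo k).1].
exists (fun k => @rV_uncons n @^-1` (F k `*` G k)).
  apply/seteqP; split => // x _.
  have [i _ Fi] : (\bigcup_i F i) (rV_uncons x).1 by rewrite -FT.
  have [j _ Gj] : (\bigcup_i G i) (rV_uncons x).2 by rewrite -GT.
  exists (maxn i j) => //; split.
  - by move: Fi; exact/subsetPset/ndF/leq_maxl.
  - by move: Gj; exact/subsetPset/ndG/leq_maxr.
move=> k; split.
  by rewrite -[X in measurable X]setTI; exact: measurable_rV_uncons.
rewrite /rV_cons_measure /pushforward/= -comp_preimage.
rewrite (_ : _ \o _ = id); last by apply/funext => p; exact: rV_consK.
rewrite preimage_id [ltLHS]product_measure1E; last 2 first.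
- exact: (Foo k).1.
- exact: (Goo k).1.
by rewrite lte_mul_pinfty// ?ge0_fin_numE//; [exact: (Foo k).2|exact: (Goo k).2].
Qed.

HB.instance Definition _ := Measure_isSigmaFinite.Build _ _ _
  rV_cons_measure rV_cons_measure_sigma_finite.

End Cons.

Fixpoint rV_lebesgue n : {sigma_finite_measure set 'rV[R]_n -> \bar R} :=
  if n is m.+1 then rV_cons_measure (rV_lebesgue m) else \d_(0 : 'rV[R]_0).

End RowLebesgue.
Arguments rV_lebesgue {R} n.

(** Surface measure on the unit sphere, by integration in polar coordinates:
    the area of E is n times the volume of the cone { r u | u in E, 0 < r <= 1 }. *)

Section SphereMeasure.
Context {R : realType} (n : nat).

Lemma measurable_enorm : measurable_fun [set: 'rV[R]_n] (@enorm R n).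
Proof.
have msqr : measurable_fun [set: 'rV[R]_n] (fun x => dot x x).
  apply: measurable_sum => i.
  by apply: measurable_funM; exact: measurable_coord.
apply: (measurableT_comp (f := @Num.sqrt R) _ msqr).
apply: continuous_measurable_fun; exact: sqrt_continuous.
Qed.

Lemma measurable_eball : measurable (eball n : set 'rV[R]_n).
Proof.
rewrite (_ : eball n = setT `&` @enorm R n @^-1` `]-oo, 1]).
  exact: measurable_enorm.
by rewrite setTI; apply/seteqP; split => x; rewrite /= in_itv.
Qed.

Definition normalize (x : 'rV[R]_n) : 'rV[R]_n := (enorm x)^-1 *: x.

Let measurable_invr : measurable_fun [set: R] (@GRing.inv R).
Proof.
rewrite -(setvU [set 0]) measurable_funU//; last exact: measurableC.
split; last exact: measurable_fun_set1.
apply: open_continuous_measurable_fun.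
  by apply: closed_openC; exact: closed_eq.
by move=> x; rewrite inE/= => /eqP; exact: inv_continuous.
Qed.

Lemma measurable_normalize : measurable_fun setT normalize.
Proof.
apply: measurable_fun_rVP => i.
rewrite (_ : (fun _ => _) = fun x : 'rV[R]_n => (enorm x)^-1 * x 0 i); last first.
  by apply/funext => x; rewrite mxE.
apply: measurable_funM; last exact: measurable_coord.
by apply: measurableT_comp; [exact: measurable_invr|exact: measurable_enorm].
Qed.

Definition cone_measure : set 'rV[R]_n -> \bar R :=
  pushforward (mrestr (rV_lebesgue n) measurable_eball) normalize.

Let mnormalize := measurable_normalize.
Let cone_measure0 : cone_measure set0 = 0%E.
Proof. exact: measure0. Qed.
Let cone_measure_ge0 A : (0 <= cone_measure A)%E.
Proof. exact: measure_ge0. Qed.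
Let cone_measure_sigma_additive : semi_sigma_additive cone_measure.
Proof. exact: measure_semi_sigma_additive. Qed.

HB.instance Definition _ := isMeasure.Build _ _ _ cone_measure
  cone_measure0 cone_measure_ge0 cone_measure_sigma_additive.

Definition sphere_measure : set 'rV[R]_n -> \bar R :=
  mscale n%:R%:nng cone_measure.

HB.instance Definition _ := Measure.on sphere_measure.

End SphereMeasure.
Arguments sphere_measure {R} n.

Section Bodies.
Context {R : realType} {n : nat}.
Implicit Types (D : set 'rV[R]_n) (x p u v : 'rV[R]_n).

Definition support_fun D v : R := sup [set dot x v | x in D].

Definition steiner_point D : 'rV[R]_n :=
  (fine (rV_lebesgue n (eball n)))^-1 *:
    \row_i \int[sphere_measure n]_(u in esphere n) (u 0 i * support_fun D u).

Definition convex D := convex_set (D : set (convex_lmodType 'rV[R]_n)).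

Definition convex_body D := [/\ compact D, convex D & D° !=set0].

Definition boundary D := closure D `\` D°.

(** [Ck_on k U f]: on the open set U the partial derivatives of f up to order k
    exist, and those of order k are continuous. *)
Fixpoint Ck_on (W : normedModType R) k (U : set 'rV[R]_n) (f : 'rV[R]_n -> W) :=
  if k is k'.+1 then
    forall i : 'I_n, (forall x, U x -> derivable f x (delta_mx 0 i)) /\
      Ck_on k' U (fun x => 'D_(delta_mx 0 i) f x)
  else {in U, continuous f}.

Definition smooth_on (W : normedModType R) (U : set 'rV[R]_n)
    (f : 'rV[R]_n -> W) := forall k, Ck_on k U f.

(** Embedded submanifolds of dimension d, by slice charts. *)
Definition smooth_submanifold (d : nat) (M : set 'rV[R]_n) :=
  forall p, M p -> exists (U V : set 'rV[R]_n) (phi psi : 'rV[R]_n -> 'rV[R]_n),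
    [/\ open U, open V & U p] /\
    [/\ smooth_on U phi, smooth_on V psi,
        forall x, U x -> V (phi x) /\ psi (phi x) = x &
        forall y, V y -> U (psi y) /\ phi (psi y) = y] /\
    forall x, U x -> (M x <-> forall i : 'I_n, (d <= i)%N -> phi x 0 i = 0).

(** The boundary of a convex body is a topological (n-1)-sphere, so n-1 is the
    only dimension it can have as a submanifold. *)
Definition smooth_convex_body D :=
  convex_body D /\ smooth_submanifold n.-1 (boundary D).

Definition outer_unit_normal D p u :=
  enorm u = 1 /\ forall x, D x -> dot x u <= dot p u.

(** Gaussian curvature at the boundary point p is the determinant of the
    Weingarten map, i.e. of the derivative of the Gauss map nu on the tangent
    space nu(p)^⊥, computed in an orthonormal basis (the rows of e).  Here nu is
    extended to a neighbourhood U of p; the derivatives along tangent vectors do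
    not depend on the extension. *)
Definition gauss_curvature D p (kappa : R) :=
  exists (U : set 'rV[R]_n) (nu : 'rV[R]_n -> 'rV[R]_n) (e : 'M[R]_(n.-1, n)),
    [/\ open U, U p, smooth_on U nu &
        forall x, U x -> boundary D x -> outer_unit_normal D x (nu x)] /\
    [/\ e *m e^T = 1%:M, forall i, dot (row i e) (nu p) = 0 &
        kappa = \det (\matrix_(i, j) dot ('D_(row i e) nu p) (row j e))].

Definition positively_curved D :=
  forall p, boundary D p -> exists2 kappa, gauss_curvature D p kappa & 0 < kappa.

(** g acts on (column) vectors by x |-> g x, i.e. on rows by x |-> x g^T. *)
Definition mx_image (g : 'M[R]_n) D := [set x *m g^T | x in D].

Definition orthogonal_group := [set g : 'M[R]_n | g *m g^T = 1%:M].

Definition isotropy D := [set g | orthogonal_group g /\ mx_image g D = D].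

Definition hausdorff_radii (A B : set 'rV[R]_n) := [set r : R | [/\ 0 <= r,
  forall a, A a -> exists2 b, B b & enorm (a - b) <= r &
  forall b, B b -> exists2 a, A a & enorm (a - b) <= r]].

Definition hausdorff_dist A B : R := inf (hausdorff_radii A B).

Lemma compact_enorm_bounded D : compact D ->
  exists2 M : R, 0 <= M & forall x, D x -> enorm x <= M.
Proof.
move=> /compact_bounded[M0 [_ /(_ (`|M0| + 1))]].
have -> : M0 < `|M0| + 1 by rewrite (le_lt_trans (ler_norm _))// ltrDl.
move=> /(_ isT) DM; exists (Num.sqrt (n%:R * (`|M0| + 1) ^+ 2)).
  exact: sqrtr_ge0.
move=> x /DM xM; apply: ler_wsqrtr; apply: le_trans (dotxx_le _) _.
by rewrite ler_wpM2l// ler_pXn2r ?nnegrE ?addr_ge0//.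
Qed.

Section HausdorffDist.
Let has_inf_radii A B : A !=set0 -> B !=set0 -> compact A -> compact B ->
  has_inf (hausdorff_radii A B).
Proof.
move=> [a Aa] [b Bb] /compact_enorm_bounded[M M0 AM] /compact_enorm_bounded[N N0 BN].
split; last by exists 0 => r [].
have MN x y : A x -> B y -> enorm (x - y) <= M + N.
  by move=> /AM ? /BN ?; rewrite (le_trans (enormD _ _))// enormN lerD.
exists (M + N); split; first exact: addr_ge0.
- by move=> x Ax; exists b => //; exact: MN.
- by move=> y By; exists a => //; exact: MN.
Qed.

Lemma hausdorff_dist_sym A B : hausdorff_dist A B = hausdorff_dist B A.
Proof.
congr inf; apply/seteqP; split => r [r0 h1 h2]; split => // x.
- by move=> /h2[y ? ?]; exists y => //; rewrite enormB.
- by move=> /h1[y ? ?]; exists y => //; rewrite enormB.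
- by move=> /h2[y ? ?]; exists y => //; rewrite enormB.
- by move=> /h1[y ? ?]; exists y => //; rewrite enormB.
Qed.

Let dist_ge0 A B : A !=set0 -> B !=set0 -> compact A -> compact B ->
  0 <= hausdorff_dist A B.
Proof.
by move=> A0 B0 cA cB; apply: lb_le_inf; [exact: (has_inf_radii _ _ _ _).1|move=> r []].
Qed.

Lemma hausdorff_distxx A : A !=set0 -> compact A -> hausdorff_dist A A = 0.
Proof.
move=> A0 cA; apply/eqP; rewrite eq_le dist_ge0// andbT.
by apply: ge_inf; [exact: (has_inf_radii _ _ _ _).2|split => // x Ax; exists x;
  rewrite ?subrr ?enorm0].
Qed.

Lemma hausdorff_dist_triangle B A C :
  A !=set0 -> B !=set0 -> C !=set0 -> compact A -> compact B -> compact C ->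
  hausdorff_dist A C <= hausdorff_dist A B + hausdorff_dist B C.
Proof.
move=> A0 B0 C0 cA cB cC; apply/ler_addgt0Pl => eps eps0.
have e20 : 0 < eps / 2 by rewrite divr_gt0.
have [r [r0 r1 r2] rlt] := inf_adherent e20 (has_inf_radii A0 B0 cA cB).
have [s [s0 s1 s2] slt] := inf_adherent e20 (has_inf_radii B0 C0 cB cC).
rewrite -!/(hausdorff_dist _ _) in rlt slt.
apply: (@le_trans _ _ (r + s)); last first.
  by rewrite [eps]splitr addrACA addrC; lra.
apply: ge_inf; first by exact: (has_inf_radii _ _ _ _).2.
split; first exact: addr_ge0.
- move=> a /r1[b Bb ab]; have [c Cc bc] := s1 _ Bb; exists c => //.
  by apply: le_trans (enorm_triangle b _ _) _; rewrite lerD.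
- move=> c /s2[b Bb bc]; have [a Aa ab] := r2 _ Bb; exists a => //.
  by apply: le_trans (enorm_triangle b _ _) _; rewrite lerD.
Qed.

Let dist0_sub A B : A !=set0 -> B !=set0 -> compact A -> compact B ->
  hausdorff_dist A B = 0 -> A `<=` B.
Proof.
move=> A0 B0 cA cB d0 a Aa.
have clB : closed B by apply: compact_closed => //; exact: norm_hausdorff.
apply: clB => V /nbhs_ballP[eps /= eps0 epsV].
have [r [_ r1 _]] := inf_adherent eps0 (has_inf_radii A0 B0 cA cB).
rewrite -/(hausdorff_dist _ _) d0 add0r => reps.
have [b Bb ab] := r1 _ Aa; exists b; split => //; apply: epsV.
rewrite -ball_normE/=; apply: le_lt_trans reps; apply: le_trans ab.
exact: norm_le_enorm.
Qed.

Lemma hausdorff_dist0 A B : A !=set0 -> B !=set0 -> compact A -> compact B ->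
  hausdorff_dist A B = 0 -> A = B.
Proof.
move=> A0 B0 cA cB d0; apply/seteqP; split; first exact: dist0_sub.
by apply: dist0_sub => //; rewrite hausdorff_dist_sym.
Qed.

End HausdorffDist.
End Bodies.

Section Ks.
Context (R : realType) (n : nat).

Record Ks := MkKs {
  Ks_set :> set 'rV[R]_n;
  Ks_nonempty : Ks_set !=set0;
  Ks_compact : compact Ks_set;
  Ks_convex : convex Ks_set;
  Ks_steiner : steiner_point Ks_set = 0 }.

HB.instance Definition _ := gen_eqMixin Ks.
HB.instance Definition _ := gen_choiceMixin Ks.

Lemma Ks_inj (A B : Ks) : Ks_set A = Ks_set B -> A = B.
Proof.
case: A B => [A a1 a2 a3 a4] [B b1 b2 b3 b4] /= AB.
by case: B / AB in b1 b2 b3 b4 *; congr MkKs; exact: Prop_irrelevance.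
Qed.

Let Ks_dist (A B : Ks) : R := hausdorff_dist A B.

Let Ks_distxx A : Ks_dist A A = 0.
Proof. exact: hausdorff_distxx (@Ks_nonempty A) (@Ks_compact A). Qed.

Let Ks_dist0 A B : Ks_dist A B = 0 -> A = B.
Proof.
by move=> AB; apply/Ks_inj/hausdorff_dist0;
  [exact: Ks_nonempty|exact: Ks_nonempty|exact: Ks_compact|exact: Ks_compact|].
Qed.

Let Ks_dist_sym A B : Ks_dist A B = Ks_dist B A.
Proof. exact: hausdorff_dist_sym. Qed.

Let Ks_dist_triangle B A C : Ks_dist A C <= Ks_dist A B + Ks_dist B C.
Proof.
by apply: hausdorff_dist_triangle;
  do ?[exact: Ks_nonempty|exact: Ks_compact].
Qed.

HB.instance Definition _ := isMetric.Build R Ks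
  Ks_distxx Ks_dist0 Ks_dist_sym Ks_dist_triangle.

Definition Bp : set Ks := [set D | smooth_convex_body D /\ positively_curved D].

Definition Bp_free : set Ks := [set D | Bp D /\ isotropy D = [set 1%:M]].

End Ks.

Arguments Bp : clear implicits.
Arguments Bp_free : clear implicits.

Definition homotopy_dense (R : realType) (Y : topologicalType) (A : set Y) :=
  exists h : Y * R -> Y,
    [/\ {within [set: Y] `*` `[0, 1]%classic, continuous h},
        forall y, h (y, 0) = y &
        forall y t, 0 < t <= 1 -> A (h (y, t))].
Arguments homotopy_dense R {Y} A.

(* Main.v *)
(** Bodies are handled through their support functions.  Projecting a finite grid
    to D gives points whose convex hull is Hausdorff-close to D and varies
    continuously with D; in its support function, a maximum of linear functions,
    each [max a 0] is replaced by (a + sqrt (a^2 + e^2 |x|^2)) / 2, which keeps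
    sublinearity and gives smoothness off the origin.  At time t the homotopy
    interpolates between two such approximations with meshes comparable to t, adds
    t |x| and t times a marker
      (1 + c) |x| + |x| theta (ell x / |x| - c),   theta s = s exp (-1/s),
    where [ell] is the support function of an ellipsoid without symmetries, and
    translates the Steiner point to the origin.

    The summand t |x| turns a body with smooth support function h into its
    parallel body at distance t, on whose boundary the Gauss map is, up to the
    factor t, the inverse of z |-> grad h z + z, whose Jacobian is at least the identity:
    the parallel body is smooth and positively curved.

    Along lines every summand but the one with theta is integral over the
    polynomials, so a difference of such functions that vanishes on an interval
    vanishes identically.  An isometry g fixing the body makes
    |x| theta (ell x / |x| - c) minus its transform by g such a difference; it is
    zero near some point since theta vanishes on the negative axis.  Hence g
    preserves that summand, so it preserves ell where ell x > c |x|, so ell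
    everywhere, and g = 1. *)

Require Import Defs.
From HB Require Import structures.
From mathcomp Require Import perm.
From mathcomp Require Import all_boot all_order all_algebra.
From mathcomp Require Import all_classical all_reals all_analysis.
From mathcomp Require Import measurable_realfun.
From mathcomp Require Import ring lra.

Set Implicit Arguments.
Unset Strict Implicit.
Unset Printing Implicit Defensive.
Import Order.TTheory GRing.Theory Num.Theory.
Import numFieldNormedType.Exports.
Local Open Scope classical_set_scope.
Local Open Scope ring_scope.

(** * Euclidean convex geometry *)

(** No general position argument is available: the isotropy must be trivial for every body and every
    t > 0, with continuous dependence on both. So everything that depends on D is kept in one class
    of functions that is rigid under continuation along lines, and symmetry is broken by a fixed
    term outside this class. Rigidity comes from the integral equation of f: after cancelling powers
    of f its constant coefficient is a nonzero polynomial divisible by f, so f cannot be flat at the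
    end of an interval of zeros without vanishing beyond it. Continuation from one point to another
    needs a line that misses the origin; this is where n >= 2 enters. The threshold c is sqrt n +
    1/2, because on unit vectors [ell] is at most sqrt n on a closed half-space through the origin,
    while it equals sqrt n + 1 at the last basis vector. The bodies have no common bound, so the
    grid has to grow while its mesh shrinks: at level k it fills the cube of half-width k + 1 with
    step 1 / (k + 1), and k is about 1 / t. *)

Section Dot.
Context {R : realType} {n : nat}.
Implicit Types (x y z v : 'rV[R]_n) (k r : R).

Lemma dotDl x y z : dot (x + y) z = dot x z + dot y z.
Proof. by rewrite /dot -big_split; apply: eq_bigr => i _; rewrite mxE mulrDl. Qed.

Lemma dotZl k x y : dot (k *: x) y = k * dot x y.
Proof. by rewrite /dot mulr_sumr; apply: eq_bigr => i _; rewrite mxE mulrA. Qed.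

Lemma dotDr x y z : dot x (y + z) = dot x y + dot x z.
Proof. by rewrite dotC dotDl !(dotC x). Qed.

Lemma dotZr k x y : dot x (k *: y) = k * dot x y.
Proof. by rewrite dotC dotZl dotC. Qed.

Lemma dotNl x y : dot (- x) y = - dot x y.
Proof. by rewrite -scaleN1r dotZl mulN1r. Qed.

Lemma dotNr x y : dot x (- y) = - dot x y.
Proof. by rewrite dotC dotNl dotC. Qed.

Lemma dotBl x y z : dot (x - y) z = dot x z - dot y z.
Proof. by rewrite dotDl dotNl. Qed.

Lemma dotBr x y z : dot x (y - z) = dot x y - dot x z.
Proof. by rewrite dotDr dotNr. Qed.

Lemma dot0l x : dot 0 x = 0.
Proof. by rewrite -(scale0r x) dotZl mul0r. Qed.

Lemma dot0r x : dot x 0 = 0.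
Proof. by rewrite dotC dot0l. Qed.

Lemma dotE x y : dot x y = (x *m y^T) 0 0.
Proof. by rewrite mxE; apply: eq_bigr => i _; rewrite mxE. Qed.

Lemma dot_delta x i : dot x (delta_mx 0 i) = x 0 i.
Proof.
rewrite /dot (bigD1 i)//= mxE !eqxx mulr1 big1 ?addr0// => j ji.
by rewrite mxE eqxx (negbTE ji) mulr0.
Qed.

Lemma dot_ext x y : (forall v, dot x v = dot y v) -> x = y.
Proof. by move=> xy; apply/rowP => i; rewrite -!dot_delta xy. Qed.

Lemma enormZ k x : enorm (k *: x) = `|k| * enorm x.
Proof. by rewrite /enorm dotZl dotZr mulrA -expr2 sqrtrM ?sqr_ge0// sqrtr_sqr. Qed.

Lemma enorm_eq0 x : (enorm x == 0) = (x == 0).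
Proof.
apply/eqP/eqP => [x0|->]; last exact: enorm0.
by apply/eqP; rewrite -normr_le0 -x0 norm_le_enorm.
Qed.

Lemma enorm_gt0 x : (0 < enorm x) = (x != 0).
Proof. by rewrite lt_neqAle enorm_ge0 andbT eq_sym enorm_eq0. Qed.

Lemma ler_norm_dot x y : `|dot x y| <= enorm x * enorm y.
Proof.
by rewrite ler_norml dot_CauchySchwarz andbT lerNl -dotNl -(enormN x) dot_CauchySchwarz.
Qed.

Lemma enorm_le_norm x : enorm x <= Num.sqrt n%:R * `|x|.
Proof.
rewrite -[X in _ * X]ger0_norm// -sqrtr_sqr -sqrtrM ?ler0n//.
by apply: ler_wsqrtr; exact: dotxx_le.
Qed.

Lemma continuous_dot v : continuous (fun x => dot x v).
Proof.
apply: continuous_big => [|i _ x]; first exact: add_continuous.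
have ci : continuous (fun M : 'rV[R]_n => M 0 i) by exact: coord_continuous.
exact: (continuousM (ci x) (@cst_continuous _ _ (v 0 i) x)).
Qed.

Lemma continuous_enorm : continuous (@enorm R n).
Proof.
move=> x; apply: continuous_comp; last exact: sqrt_continuous.
apply: continuous_big => [|i _ y]; first exact: add_continuous.
have ci : continuous (fun M : 'rV[R]_n => M 0 i) by exact: coord_continuous.
exact: (continuousM (ci y) (ci y)).
Qed.

Lemma convexP (D : set 'rV[R]_n) : convex D <->
  forall x y t, D x -> D y -> 0 <= t <= 1 -> D (t *: x + (1 - t) *: y).
Proof.
split=> [cD x y t Dx Dy t01|cD x y t xD yD].
  have /andP[t0 t1] := t01.
  have := cD x y (Itv01 t0 t1) (mem_set Dx) (mem_set Dy).
  by move=> /set_mem; rewrite /conv/= .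
apply/mem_set; apply: (cD x y t%:num); [exact: set_mem|exact: set_mem|].
by apply/andP.
Qed.

End Dot.

Lemma dot_mulmx (R : realType) a b (x : 'rV[R]_a) (y : 'rV[R]_b) (A : 'M[R]_(a, b)) :
  dot (x *m A) y = dot x (y *m A^T).
Proof. by rewrite !dotE trmx_mul trmxK mulmxA. Qed.

(** * Nearest points of a compact convex set and their dependence on the set *)

Section Projection.
Context {R : realType} {n : nat}.
Implicit Types (K : set 'rV[R]_n) (x y p q : 'rV[R]_n).

(** The variational inequality of the nearest point. In this form two projections are compared by
    adding their inequalities. *)
Definition is_proj K y p := K p /\ forall q, K q -> dot (y - p) (q - p) <= 0.

Definition proj K y : 'rV[R]_n := get (is_proj K y).

Lemma proj_exists K y : K !=set0 -> compact K -> convex K -> exists p, is_proj K y p.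
Proof.
move=> K0 cK /convexP vK.
have cf : continuous (fun q => enorm (q - y)).
  move=> x; apply: continuous_comp; last exact: continuous_enorm.
  by apply: continuousB; [exact: cvg_id|exact: cst_continuous].
have [p /set_mem Kp pmin] := EVT_min_rV K0 cK (continuous_subspaceT cf).
exists p; split => // q Kq; apply/ler_addgt0Pl => e e0; rewrite addr0.
set a := dot _ _; have [//|a0] := leP a e.
(* Moving from [p] a fraction [t] towards [q] does not decrease the distance to [y], so 2 a <= t |q
   - p|^2. This [t] makes the right side at most [e]; the added 1 covers q = p. *)
pose t := Num.min 1 (e / (1 + dot (q - p) (q - p))).
have d0 : 0 < 1 + dot (q - p) (q - p) by rewrite ltr_pwDl// dotxx_ge0.
have t0 : 0 < t by rewrite lt_min ltr01 divr_gt0.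
have t1 : 0 <= t <= 1 by rewrite ltW//= ge_min lexx.
have := pmin _ (mem_set (vK q p t Kq Kp t1)).
rewrite -(@ler_pXn2r _ 2) ?nnegrE ?enorm_ge0// !enorm_sqr.
have -> : t *: q + (1 - t) *: p - y = t *: (q - p) - (y - p).
  by apply/rowP => i; rewrite !mxE; ring.
have -> : dot (p - y) (p - y) = dot (y - p) (y - p) by rewrite -opprB dotNl dotNr opprK.
have -> (w z : 'rV[R]_n) : dot (t *: w - z) (t *: w - z) = t ^+ 2 * dot w w - 2 * t * dot z w + dot z z.
  by rewrite dotBl !dotBr !dotZl !dotZr (dotC w z); ring.
rewrite -/a.
have : t * (1 + dot (q - p) (q - p)) <= e.
  by rewrite -ler_pdivlMr// ge_min lexx orbT.
move: (dot (q - p) (q - p)) => D tle h.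
have : t * (2 * a) <= t * (t * D) by move: h; rewrite expr2; lra.
by rewrite ler_pM2l// => h2; lra.
Qed.

Lemma projP K y : K !=set0 -> compact K -> convex K -> is_proj K y (proj K y).
Proof. by move=> K0 cK vK; apply: getPex; exact: proj_exists. Qed.

Lemma is_proj_unique K y p q : is_proj K y p -> is_proj K y q -> p = q.
Proof.
move=> [Kp pP] [Kq qP]; apply/eqP; rewrite -subr_eq0 -enorm_eq0 -sqrf_eq0 enorm_sqr.
rewrite eq_le dotxx_ge0 andbT.
have := lerD (pP _ Kq) (qP _ Kp); rewrite addr0.
by rewrite !dotBl !dotBr !(dotC q p); lra.
Qed.

Lemma proj_eq K y p : K !=set0 -> compact K -> convex K -> is_proj K y p -> proj K y = p.
Proof. by move=> K0 cK vK pP; apply: is_proj_unique pP; exact: projP. Qed.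

(** Each projection is replaced by a point of the other set within [r], and the two variational
    inequalities are added. The resulting modulus, of order sqrt r, is what makes [approx]
    continuous in the body. *)
Lemma proj_hausdorff K K' q p p' r : is_proj K q p -> is_proj K' q p' ->
  hausdorff_radii K K' r -> enorm (p - p') ^+ 2 <= r * (2 * enorm (q - p) + r).
Proof.
move=> [Kp pP] [Kp' p'P] [r0 KK' K'K].
have [b' K'b' pb'] := KK' _ Kp; have [b Kb bp'] := K'K _ Kp'.
have h1 := pP _ Kb; have h2 := p'P _ K'b'.
have h3 : dot (q - p') (p - b') <= enorm (q - p') * r.
  by apply: le_trans (dot_CauchySchwarz _ _) _; rewrite ler_wpM2l// enorm_ge0.
have h4 : dot (q - p) (p' - b) <= enorm (q - p) * r.
  apply: le_trans (dot_CauchySchwarz _ _) _; rewrite ler_wpM2l ?enorm_ge0//.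
  by rewrite enormB.
have h5 : enorm (q - p') <= enorm (q - p) + r.
  have qb : enorm (q - b') <= enorm (q - p) + r.
    by apply: le_trans (enorm_triangle p _ _) _; rewrite lerD2l.
  apply: le_trans qb; rewrite -(@ler_pXn2r _ 2) ?nnegrE ?enorm_ge0// !enorm_sqr.
  have -> : q - b' = (q - p') - (b' - p') by rewrite opprB addrA subrK.
  rewrite [leRHS]dotBl ![dot _ (_ - _ - _)]dotBr (dotC (b' - p') (q - p')).
  by have := dotxx_ge0 (b' - p'); lra.
have h6 := ler_wpM2r r0 h5.
rewrite enorm_sqr.
have -> : dot (p - p') (p - p') = dot (q - p') (p - b') + dot (q - p') (b' - p') +
   (dot (q - p) (p' - b) + dot (q - p) (b - p)).
  by rewrite !dotBl !dotBr !(dotC p' p); ring.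
by lra.
Qed.

(** Gradient of half the squared distance to [K]. On the level set at distance t it is t times the
    outer unit normal of the parallel body. *)
Definition offset K y := y - proj K y.

Lemma offset_firm K x y : K !=set0 -> compact K -> convex K ->
  enorm (offset K x - offset K y) ^+ 2 <= dot (offset K x - offset K y) (x - y).
Proof.
move=> K0 cK vK; rewrite enorm_sqr /offset.
have [Kp pP] := projP x K0 cK vK; have [Kq qP] := projP y K0 cK vK.
have := lerD (pP _ Kq) (qP _ Kp); rewrite addr0.
move: (proj K x) (proj K y) => p q.
rewrite !dotBl !dotBr !(dotC p x, dotC p y, dotC q x, dotC q y, dotC q p, dotC y x).
by lra.
Qed.

Lemma offset_lipschitz K x y : K !=set0 -> compact K -> convex K ->
  enorm (offset K x - offset K y) <= enorm (x - y).
Proof.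
move=> K0 cK vK; have := le_trans (offset_firm x y K0 cK vK) (dot_CauchySchwarz _ _).
set a := enorm _; set b := enorm _.
have : 0 <= a by exact: enorm_ge0.
by rewrite le_eqVlt => /orP[/eqP <-|a0]; [rewrite enorm_ge0|rewrite expr2 ler_pM2l].
Qed.

Lemma offset_eq0 K y : K !=set0 -> compact K -> convex K -> (offset K y == 0) = `[< K y >].
Proof.
move=> K0 cK vK; rewrite subr_eq0; apply/eqP/asboolP => [->|Ky].
  by have [] := projP y K0 cK vK.
have [Kp /(_ _ Ky)] := projP y K0 cK vK; rewrite -enorm_sqr => h.
apply/eqP; rewrite -subr_eq0 -enorm_eq0 -sqrf_eq0 eq_le h; exact: sqr_ge0.
Qed.

End Projection.

(** * Support functions and the Hausdorff distance *)

Section Support.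
Context {R : realType} {n : nat}.
Implicit Types (A B K : set 'rV[R]_n) (x y u v : 'rV[R]_n) (r : R).

Lemma support_fun_ub A x v : compact A -> A x -> dot x v <= support_fun A v.
Proof.
move=> cA Ax; apply: ub_le_sup; last by exists x.
have [M M0 AM] := compact_enorm_bounded cA.
exists (M * enorm v) => _ [y /AM yM <-].
by apply: le_trans (dot_CauchySchwarz _ _) _; rewrite ler_wpM2r// enorm_ge0.
Qed.

Lemma support_fun_le A v r : A !=set0 -> (forall x, A x -> dot x v <= r) ->
  support_fun A v <= r.
Proof.
move=> [x Ax] Ar; apply: ge_sup; first by exists (dot x v), x.
by move=> _ [y Ay <-]; exact: Ar.
Qed.

Lemma support_fun_eq A v x : compact A -> A x -> (forall y, A y -> dot y v <= dot x v) ->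
  support_fun A v = dot x v.
Proof.
move=> cA Ax xP; apply/eqP; rewrite eq_le support_fun_ub// andbT.
by apply: support_fun_le => //; exists x.
Qed.

(** The variational inequality says that [offset K y] lies in the normal cone of [K] at the
    projection. *)
Lemma support_fun_offset K y : K !=set0 -> compact K -> convex K ->
  support_fun K (offset K y) = dot (proj K y) (offset K y).
Proof.
move=> K0 cK vK; have [Kp pP] := projP y K0 cK vK.
apply: support_fun_eq => // q /pP; rewrite -/(offset K y) dotBr !(dotC (offset _ _)).
by rewrite subr_le0.
Qed.

Lemma support_funZ A v r : A !=set0 -> compact A -> 0 <= r ->
  support_fun A (r *: v) = r * support_fun A v.
Proof.
move=> A0 cA; rewrite le_eqVlt => /orP[/eqP <-|r0].
  rewrite scale0r mul0r; have [x Ax] := A0.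
  rewrite (support_fun_eq cA Ax) ?dot0r// => y _; by rewrite !dot0r.
apply/eqP; rewrite eq_le; apply/andP; split.
  by apply: support_fun_le => // x Ax; rewrite dotZr ler_pM2l// support_fun_ub.
rewrite -ler_pdivlMl//; apply: support_fun_le => // x Ax.
by rewrite ler_pdivlMl// -dotZr support_fun_ub.
Qed.

Lemma hausdorff_dist_lt A B r : A !=set0 -> B !=set0 -> compact A -> compact B ->
  hausdorff_dist A B < r -> exists2 s, hausdorff_radii A B s & s < r.
Proof.
move=> A0 B0 cA cB ABr.
have hi : has_inf (hausdorff_radii A B).
  have [M M0 AM] := compact_enorm_bounded cA; have [N N0 BN] := compact_enorm_bounded cB.
  split; last by exists 0 => s [].
  have MN x y : A x -> B y -> enorm (x - y) <= M + N.
    by move=> /AM ? /BN ?; rewrite (le_trans (enormD _ _))// enormN lerD.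
  have [a Aa] := A0; have [b Bb] := B0.
  exists (M + N); split; first exact: addr_ge0.
  - by move=> x Ax; exists b => //; exact: MN.
  - by move=> y By; exists a => //; exact: MN.
have [s ABs sr] := inf_lt hi.1 ABr.
by exists s.
Qed.

Lemma support_fun_dist_le A B r v : A !=set0 -> B !=set0 -> compact A -> compact B ->
  hausdorff_dist A B < r -> `|support_fun A v - support_fun B v| <= r * enorm v.
Proof.
move=> A0 B0 cA cB ABr.
have [s [s0 s1 s2] sr] := hausdorff_dist_lt A0 B0 cA cB ABr.
have H (C D : set 'rV[R]_n) : C !=set0 -> compact D ->
    (forall c, C c -> exists2 d, D d & enorm (c - d) <= s) ->
    support_fun C v - support_fun D v <= r * enorm v.
  move=> C0 cD CD; rewrite lerBlDr; apply: support_fun_le => // c Cc.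
  have [d Dd cd] := CD _ Cc.
  rewrite -[c](subrK d) dotDl; apply: lerD; last exact: support_fun_ub.
  apply: le_trans (dot_CauchySchwarz _ _) _; rewrite ler_wpM2r ?enorm_ge0//.
  exact: le_trans cd (ltW sr).
rewrite ler_norml lerNl opprB; apply/andP; split; last exact: H.
by apply: H => // b /s2[a Aa ab]; exists a => //; rewrite enormB.
Qed.

(** A point of one body is tested in the direction of its own offset w from the other: there the
    support inequality reads |w|^2 <= r |w|. *)
Lemma hausdorff_radii_support A B r : A !=set0 -> compact A -> convex A ->
  B !=set0 -> compact B -> convex B -> 0 <= r ->
  (forall v, `|support_fun A v - support_fun B v| <= r * enorm v) -> hausdorff_radii A B r.
Proof.
move=> A0 cA vA B0 cB vB r0 ABr.
have H (C D : set 'rV[R]_n) c : compact C -> D !=set0 -> compact D -> convex D -> C c ->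
    (forall v, support_fun C v <= support_fun D v + r * enorm v) ->
    exists2 d, D d & enorm (c - d) <= r.
  move=> cC D0 cD vD Cc CD; have [Dp pP] := projP c D0 cD vD.
  exists (proj D c) => //; rewrite -/(offset D c).
  have := le_trans (support_fun_ub (offset D c) cC Cc) (CD (offset D c)).
  rewrite support_fun_offset// -lerBlDl -dotBl -/(offset D c) -enorm_sqr.
  have : 0 <= enorm (offset D c) by exact: enorm_ge0.
  rewrite le_eqVlt => /orP[/eqP <-//|e0].
  by rewrite expr2 ler_pM2r.
split => //.
- move=> a Aa; apply: (H A B) => // v; rewrite -lerBlDl.
  exact: le_trans (ler_norm _) (ABr v).
- move=> b Bb; have [] := H B A b cB A0 cA vA Bb.
    move=> v; rewrite -lerBlDl; apply: le_trans (ler_norm _) _.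
    by rewrite distrC; exact: ABr.
  by move=> a Aa ab; exists a => //; rewrite enormB.
Qed.

Lemma hausdorff_dist_support A B r : A !=set0 -> compact A -> convex A ->
  B !=set0 -> compact B -> convex B -> 0 <= r ->
  (forall v, `|support_fun A v - support_fun B v| <= r * enorm v) -> hausdorff_dist A B <= r.
Proof.
move=> A0 cA vA B0 cB vB r0 ABr; apply: ge_inf; first by exists 0 => s [].
exact: hausdorff_radii_support.
Qed.

End Support.

(** * Calculus of finitely differentiable functions *)

Section Derivatives.
Context {R : realType}.

Lemma is_deriveE (V W : normedModType R) (f : V -> W) (a v : V) (d : W) :
  is_derive a v f d <-> (fun h : R => h^-1 *: (f (h *: v + a) - f a)) @ 0^' --> d.
Proof.
split=> [[fv <-]|fd]; first exact: fv.
by apply: DeriveDef; [apply/cvg_ex; exists d|apply/cvg_lim].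
Qed.

Lemma continuous_sum_at (T : topologicalType) (x : T) (I : Type) (r : seq I) (P : pred I)
    (f : I -> T -> R) : (forall i, P i -> {for x, continuous (f i)}) ->
  {for x, continuous (fun y => \sum_(i <- r | P i) f i y)}.
Proof.
by move=> fl; apply: cvg_big => //; exact: add_continuous.
Qed.

Lemma is_derive_line (V W : normedModType R) (f : V -> W) (a v : V) (s : R) (d : W) :
  is_derive (a + s *: v) v f d <-> is_derive s 1 (fun r : R => f (a + r *: v)) d.
Proof.
rewrite !is_deriveE; suff -> : (fun h : R => h^-1 *: (f (h *: v + (a + s *: v)) - f (a + s *: v))) =
  (fun h : R => h^-1 *: (f (a + (h *: (1 : R) + s) *: v) - f (a + s *: v))) by [].
by apply/funext => h; rewrite [_ *: (1 : R)]mulr1 scalerDl addrCA.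
Qed.

Lemma derivable_at (V W : normedModType R) (f : V -> W) (a v : V) :
  derivable f a v -> is_derive a v f ('D_v f a).
Proof. exact: derivableP. Qed.

Lemma mvt_bound (g dg : R -> R) (b c e : R) :
  (forall s : R, `|s| <= `|b| -> is_derive s 1 g (dg s)) ->
  (forall s : R, `|s| <= `|b| -> `|dg s - c| <= e) ->
  `|g b - g 0 - c * b| <= e * `|b|.
Proof.
move=> gd ge.
have gcont (s : R) : `|s| <= `|b| -> {for s, continuous g}.
  move=> /gd gs; have gs1 : derivable g s 1 by [].
  exact/differentiable_continuous/derivable1_diffP.
have wc (i : interval R) : (forall s, s \in i -> `|s| <= `|b|) -> {within [set` i], continuous g}.
  by move=> ib; apply: continuous_in_subspaceT => s; rewrite inE /= => /ib/gcont.
have [b0|b0] := leP 0 b.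
  have ib s : s \in `[0, b] -> `|s| <= `|b|.
    by rewrite in_itv/= => /andP[s0 sb]; rewrite !ger0_norm.
  have [||s sb] := @MVT_segment R g dg 0 b b0.
  - by move=> x xb; apply: gd; apply: ib; exact: subset_itv_oo_cc.
  - by apply: wc => s; exact: ib.
  rewrite subr0 => ->; rewrite -mulrBl normrM ler_wpM2r//.
  by apply: ge; exact: ib.
have ib s : s \in `[b, 0] -> `|s| <= `|b|.
  by rewrite in_itv/= => /andP[bs s0]; rewrite !ler0_norm ?lerN2 // ltW.
have [||s sb] := @MVT_segment R g dg b 0 (ltW b0).
- by move=> x xb; apply: gd; apply: ib; exact: subset_itv_oo_cc.
- by apply: wc => s; exact: ib.
rewrite sub0r mulrN => gE.
have -> : g b - g 0 = dg s * b by rewrite -[RHS]opprK -gE opprB.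
rewrite -mulrBl normrM ler_wpM2r//; apply: ge; exact: ib.
Qed.

Context {n : nat}.
Notation e_ i := (delta_mx 0 i : 'rV[R]_n).
Implicit Types (U : set 'rV[R]_n) (f : 'rV[R]_n -> R).

Lemma norm_le_coord (v : 'rV[R]_n) (r : R) : 0 <= r ->
  (forall i, `|v 0 i| <= r) -> `|v| <= r.
Proof.
move=> r0 vr; rewrite [leLHS]/Num.norm/= mx_normrE; apply/bigmax_leP; split => //.
by move=> [i j] _ /=; rewrite ord1.
Qed.

Definition row_lin (c : 'I_n -> R) (v : 'rV[R]_n) : R := \sum_(i < n) v 0 i * c i.

Lemma row_lin_is_linear c : linear (row_lin c : 'rV[R]_n -> R^o).
Proof.
move=> k u v; rewrite /row_lin scaler_sumr -big_split/=; apply: eq_bigr => i _.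
by rewrite !mxE mulrDl -mulrA.
Qed.

HB.instance Definition _ c := GRing.isLinear.Build R 'rV[R]_n R^o _ (row_lin c) (row_lin_is_linear c).

Lemma continuous_row_lin c : continuous (row_lin c).
Proof.
move=> x; apply: continuous_sum_at => i _.
have ci : continuous (fun M : 'rV[R]_n => M 0 i) by exact: coord_continuous.
exact: (continuousM (ci x) (@cst_continuous _ _ (c i) x)).
Qed.

(** The increment is travelled one coordinate at a time, with the mean value inequality on each leg.
    The conclusion is the expansion itself because the remainder estimate is used again when the
    inverse Gauss map is inverted. *)
Lemma diff_row_lin_of_partials U f x : open U -> U x ->
  (forall i y, U y -> derivable f y (e_ i)) ->
  (forall i, {for x, continuous (fun y => 'D_(e_ i) f y)}) ->
  f \o shift x = cst (f x) + row_lin (fun i => 'D_(e_ i) f x) +o_ (0 : 'rV[R]_n) id.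
Proof.
move=> oU Ux fd fc; apply/eqaddoP => /= _/posnumP[e].
pose e' := e%:num / (n%:R + 1).
have n1 : 0 < n%:R + 1 :> R by rewrite ltr_wpDl.
have e'0 : 0 < e' by rewrite divr_gt0.
have /nbhs_ballP[d1 /= d10 d1U] : nbhs x U by exact: open_nbhs_nbhs.
have : \forall y \near x, forall i, `|'D_(e_ i) f x - 'D_(e_ i) f y| <= e'.
  apply: (@filter_forall _ 'I_n (fun i y => `|'D_(e_ i) f x - 'D_(e_ i) f y| <= e') (nbhs x) _).
  move=> i; have /cvgrPdist_le h := fc i; exact: h.
move=> /nbhs_ballP[d2 /= d20 d2f].
pose d := Num.min d1 d2; have d0 : 0 < d by rewrite lt_min d10.
have dU y : `|x - y| < d -> U y.
  by move=> xy; apply: d1U; rewrite -ball_normE/= (lt_le_trans xy)// ge_min lexx.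
have df y i : `|x - y| < d -> `|'D_(e_ i) f y - 'D_(e_ i) f x| <= e'.
  move=> xy; rewrite distrC; apply: d2f; rewrite -ball_normE/= (lt_le_trans xy)//.
  by rewrite ge_min lexx orbT.
apply/nbhs_ballP; exists d => //= v; rewrite -ball_normE/= sub0r normrN => vd.
rewrite -[_ v]/(f (v + x) - (f x + row_lin (fun i => 'D_(e_ i) f x) v)).
(* [tr k] is the part of the increment covered by the first [k] legs. *)
pose tr (k : nat) : 'rV[R]_n := \row_i (if (i < k)%N then v 0 i else 0).
suff H k : (k <= n)%N -> `|f (tr k + x) - f x -
    \sum_(i < n | (i < k)%N) v 0 i * 'D_(e_ i) f x| <= k%:R * e' * `|v|.
  have := H n (leqnn n).
  have -> : tr n = v by apply/rowP => i; rewrite mxE ltn_ord.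
  rewrite (eq_bigl xpredT); last by move=> i; rewrite ltn_ord.
  rewrite opprD addrA => /le_trans; apply; rewrite ler_wpM2r// /e' mulrCA ger_pMr//.
  by rewrite ler_pdivrMr// mul1r lerDl.
elim: k => [_|k IH kn].
  have -> : tr 0%N = 0 by apply/rowP => i; rewrite !mxE.
  by rewrite add0r subrr big_pred0// subr0 normr0 !mul0r.
pose i0 := Ordinal kn.
have trS : tr k.+1 = tr k + v 0 i0 *: e_ i0.
  apply/rowP => i; rewrite !mxE eqxx/= ltnS leq_eqVlt.
  have [->|ii0] := eqVneq i i0; first by rewrite eqxx ltnn mulr1 add0r.
  suff -> : (i == k :> nat) = false by rewrite mulr0 addr0.
  by apply/negbTE; apply: contra ii0 => /eqP ik; apply/eqP/val_inj.
have small s : `|s| <= `|v 0 i0| -> `|x - (tr k + x + s *: e_ i0)| < d.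
  move=> sv; apply: le_lt_trans vd.
  rewrite addrAC opprD addrCA subrr addr0 normrN.
  apply: norm_le_coord => // i; rewrite !mxE eqxx/=.
  have [->|ii0] := eqVneq i i0.
    by rewrite ltnn add0r mulr1 (le_trans sv)// coord_le_norm.
  by rewrite mulr0 addr0; case: ifP; rewrite ?normr0// coord_le_norm.
have h1 := @mvt_bound (fun s => f (tr k + x + s *: e_ i0))
  (fun s => 'D_(e_ i0) f (tr k + x + s *: e_ i0)) (v 0 i0) ('D_(e_ i0) f x) e'
  (fun s sv => (is_derive_line f (tr k + x) (e_ i0) s _).1
     (derivable_at (fd i0 _ (dU _ (small s sv)))))
  (fun s sv => df _ i0 (small s sv)).
rewrite /= scale0r addr0 in h1.
rewrite (bigD1 i0)//= (eq_bigl (fun i : 'I_n => (i < k)%N)); last first.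
  move=> i; rewrite ltnS leq_eqVlt -[i == i0]/(i == k :> nat).
  by case: eqVneq => [->|]; rewrite ?ltnn//= andbT.
rewrite trS [tr k + _ + x]addrAC.
set A := \sum_(_ < _ | _) _ in IH *; set B := f (tr k + x) in IH h1 *.
set C := f (_ + _ + _) in h1 *.
have -> : C - f x - (v 0 i0 * 'D_(e_ i0) f x + A) =
  (C - B - 'D_(e_ i0) f x * v 0 i0) + (B - f x - A) by ring.
apply: le_trans (ler_normD _ _) _.
rewrite -natr1 -addrA mulrDl mulrDl [leRHS]addrC mul1r.
apply: lerD; last exact: IH (ltnW kn).
by rewrite addrA; apply: le_trans h1 _; rewrite (ler_wpM2l (ltW e'0))// coord_le_norm.
Qed.

Lemma differentiable_of_partials U f x : open U -> U x ->
  (forall i y, U y -> derivable f y (e_ i)) ->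
  (forall i, {for x, continuous (fun y => 'D_(e_ i) f y)}) ->
  differentiable f x.
Proof.
move=> oU Ux fd fc.
have h := diff_row_lin_of_partials oU Ux fd fc.
have cL := @continuous_row_lin (fun i => 'D_(e_ i) f x).
have dE := @diff_unique _ _ _ f (row_lin (fun i => 'D_(e_ i) f x) : {linear 'rV[R]_n -> R^o}) x cL h.
by apply/diff_locallyP; rewrite dE.
Qed.

Lemma derive_partials U f x w : open U -> U x ->
  (forall i y, U y -> derivable f y (e_ i)) ->
  (forall i, {for x, continuous (fun y => 'D_(e_ i) f y)}) ->
  'D_w f x = \sum_(i < n) w 0 i * 'D_(e_ i) f x.
Proof.
move=> oU Ux fd fc.
have h := diff_row_lin_of_partials oU Ux fd fc.
have cL := @continuous_row_lin (fun i => 'D_(e_ i) f x).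
have dE := @diff_unique _ _ _ f (row_lin (fun i => 'D_(e_ i) f x) : {linear 'rV[R]_n -> R^o}) x cL h.
rewrite deriveE; last exact: (differentiable_of_partials oU Ux fd fc).
by rewrite dE.
Qed.

Lemma is_derive_comp1 (V : normedModType R) (f : V -> R) (phi : R -> R) (x v : V) (d d' : R) :
  is_derive x v f d -> is_derive (f x) 1 phi d' -> is_derive x v (phi \o f) (d' * d).
Proof.
rewrite -{1}(addr0 x) -(scale0r v) is_derive_line => fd pd.
rewrite -(addr0 x) -(scale0r v) is_derive_line.
have pd' : is_derive (f (x + 0 *: v)) 1 phi d' by rewrite scale0r addr0.
by have := @is_derive1_comp R phi (fun r => f (x + r *: v)) 0 d' d pd' fd.
Qed.

(** Only the derivative of [N] in the direction [v] is given, so the chain rule is applied to its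
    restriction to the line through [x]. *)
Lemma is_derive_comp_partials m (N : 'rV[R]_m -> 'rV[R]_n) f U x v (d : 'I_n -> R) :
  open U -> U (N x) ->
  (forall i y, U y -> derivable f y (e_ i)) ->
  (forall i, {for N x, continuous (fun y => 'D_(e_ i) f y)}) ->
  (forall j, is_derive x v (fun y => N y 0 j) (d j)) ->
  is_derive x v (f \o N) (\sum_(j < n) d j * 'D_(e_ j) f (N x)).
Proof.
move=> oU UNx fd fc Nd.
have dN : derivable N x v.
  by apply/derivable_mxP => i j; rewrite ord1; exact: ex_derive.
have DN : 'D_v N x = \row_j d j.
  rewrite derive_mx//; apply/rowP => j; rewrite !mxE; exact: derive_val.
have df : differentiable f (N x) by exact: (differentiable_of_partials oU UNx fd fc).
have dN' : is_derive x v N (\row_j d j) by rewrite -DN; exact: derivable_at.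
move: dN'; rewrite -{1}(addr0 x) -(scale0r v) is_derive_line => dN'.
rewrite -{1}(addr0 x) -(scale0r v) is_derive_line.
pose g (r : R) := N (x + r *: v).
have g0 : g 0 = N x by rewrite /g scale0r addr0.
have dg : differentiable g 0 by apply/derivable1_diffP; exact: (@ex_derive _ _ _ _ _ _ _ dN').
have dfg : differentiable f (g 0) by rewrite g0.
apply: DeriveDef; first by apply/derivable1_diffP; exact: (differentiable_comp dg dfg).
rewrite deriveE; last exact: (differentiable_comp dg dfg).
rewrite (_ : (fun r => _) = f \o g)// diff_comp//= -deriveE//.
have -> : 'd g 0 (1 : R) = \row_j d j.
  by rewrite -deriveE//; exact: (@derive_val _ _ _ _ _ _ _ dN').
rewrite g0 (derive_partials _ oU UNx fd fc).
by apply: eq_bigr => i _; rewrite mxE.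
Qed.

Lemma continuous_rV_at (T : topologicalType) (x : T) (N : T -> 'rV[R]_n) :
  (forall j, {for x, continuous (fun y => N y 0 j)}) -> {for x, continuous N}.
Proof.
move=> Nc; apply/cvgrPdist_le => e e0.
have : \forall y \near x, forall j, `|N x 0 j - N y 0 j| <= e.
  apply: (@filter_forall _ 'I_n (fun j y => `|N x 0 j - N y 0 j| <= e) (nbhs x) _).
  by move=> j; have /cvgrPdist_le h := Nc j; exact: h.
apply: filterS => y h; apply: norm_le_coord; first exact: ltW.
by move=> j; rewrite !mxE.
Qed.

(** [Ck_on k] asks for continuity of the partials of order exactly k. Asking for all orders up to k
    makes the class decreasing in k, as the inductions for the product and chain rules require. *)
Definition Ckle k U f := forall j, (j <= k)%N -> Ck_on j U f.

Lemma Ckle0 U f : Ckle 0 U f <-> forall x, U x -> {for x, continuous f}.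
Proof.
split=> [h x Ux|fc j]; first exact/(h 0%N isT)/mem_set.
by rewrite leqn0 => /eqP -> x /set_mem; exact: fc.
Qed.

Lemma CkleS k U f : Ckle k.+1 U f <-> (forall x, U x -> {for x, continuous f}) /\
  forall i, (forall x, U x -> derivable f x (e_ i)) /\ Ckle k U (fun x => 'D_(e_ i) f x).
Proof.
split=> [fk|[fc fk] [_ x /set_mem|j jk]]; last first.
- by move=> i; split; [exact: (fk i).1|exact: (fk i).2].
- exact: fc.
split; first by move=> x /mem_set; exact: (fk 0%N).
move=> i; split; first exact: (fk 1%N isT i).1.
by move=> j jk; exact: (fk j.+1 jk i).2.
Qed.

Lemma Ckle_le k l U f : (l <= k)%N -> Ckle k U f -> Ckle l U f.
Proof. by move=> lk fk j jl; apply: fk; exact: leq_trans lk. Qed.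

Lemma Ckle_continuous k U f x : Ckle k U f -> U x -> {for x, continuous f}.
Proof. by move=> h /mem_set; exact: (h 0%N). Qed.

Lemma Ckle_derivable k U f i x : Ckle k.+1 U f -> U x -> derivable f x (e_ i).
Proof. by move=> /CkleS[_ /(_ i)[]] h _ /h. Qed.

Lemma Ckle_derive k U f i : Ckle k.+1 U f -> Ckle k U (fun x => 'D_(e_ i) f x).
Proof. by move=> /CkleS[_ /(_ i)[]]. Qed.

Lemma near_eq_open (T : topologicalType) (A : Type) (V : set T) (f g : T -> A) x :
  open V -> V x -> (forall y, V y -> f y = g y) -> \forall y \near x, f y = g y.
Proof.
move=> oV Vx fg; have : nbhs x V by exact: open_nbhs_nbhs.
by apply: filterS.
Qed.

Lemma continuous_ext_open (T : topologicalType) (V : set T) (f g : T -> R) x : open V -> V x ->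
  (forall y, V y -> f y = g y) -> {for x, continuous f} -> {for x, continuous g}.
Proof.
move=> oV Vx fg fc; rewrite /prop_for /continuous_at -fg//.
by apply: cvg_trans fc; apply: near_eq_cvg; exact: near_eq_open oV Vx fg.
Qed.

Lemma Ckle_ext k U f g : open U -> Ckle k U f -> (forall x, U x -> f x = g x) ->
  Ckle k U g.
Proof.
move=> oU; elim: k f g => [|k IH] f g fk fg.
  by apply/Ckle0 => x Ux; apply: (continuous_ext_open oU Ux fg); exact: (Ckle_continuous fk Ux).
move/CkleS: fk => [fc fd]; apply/CkleS; split.
  by move=> x Ux; exact: (continuous_ext_open oU Ux fg (fc _ Ux)).
move=> i; have [fd1 fd2] := fd i; split.
  move=> x Ux; apply: near_eq_derivable (fd1 x Ux).
  exact: near_eq_open oU Ux fg.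
apply: IH fd2 _ => x Ux; apply: near_eq_derive.
exact: near_eq_open oU Ux fg.
Qed.

Lemma Ckle_sub k U V f : U `<=` V -> Ckle k V f -> Ckle k U f.
Proof.
move=> UV; elim: k f => [|k IH] f.
  by move=> /Ckle0 fc; apply/Ckle0 => x /UV; exact: fc.
move=> /CkleS[fc fd]; apply/CkleS; split; first by move=> x /UV; exact: fc.
move=> i; have [d1 d2] := fd i; split; last exact: IH.
by move=> x /UV; exact: d1.
Qed.

Lemma Ckle_cst k U (c : R) : Ckle k U (fun=> c).
Proof.
elim: k c => [|k IH] c; first by apply/Ckle0 => x _; exact: cst_continuous.
apply/CkleS; split; first by move=> x _; exact: cst_continuous.
move=> i; split; first by move=> x _; exact: derivable_cst.
suff -> : (fun x => 'D_(e_ i) (fun=> c) x) = fun=> 0 by [].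
by apply/funext => x; rewrite derive_cst.
Qed.

Lemma is_derive_coord (x v : 'rV[R]_n) j : is_derive x v (fun y => y 0 j) (v 0 j).
Proof.
apply/is_deriveE; apply: cvg_trans (@cvg_cst _ (v 0 j) _ 0^' _).
apply: near_eq_cvg; near=> h; rewrite !mxE addrK.
have h0 : h != 0 by near: h; exact: nbhs_dnbhs_neq.
by rewrite [_ *: _]mulKf.
Unshelve. all: by end_near. Qed.

Lemma Ckle_coord k U j : Ckle k U (fun x => x 0 j).
Proof.
have cj : continuous (fun M : 'rV[R]_n => M 0 j) by exact: coord_continuous.
case: k => [|k]; first by apply/Ckle0 => x _; exact: cj.
apply/CkleS; split; first by move=> x _; exact: cj.
move=> i; split; first by move=> x _; exact: (@ex_derive _ _ _ _ _ _ _ (is_derive_coord x (e_ i) j)).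
suff -> : (fun x => 'D_(e_ i) (fun y : 'rV[R]_n => y 0 j) x) = fun=> e_ i 0 j by exact: Ckle_cst.
by apply/funext => x; rewrite (@derive_val _ _ _ _ _ _ _ (is_derive_coord x (e_ i) j)).
Qed.

Lemma CkleD k U f g : open U -> Ckle k U f -> Ckle k U g -> Ckle k U (fun x => f x + g x).
Proof.
move=> oU; elim: k f g => [|k IH] f g fk gk.
  apply/Ckle0 => x xU; exact: (continuousD (Ckle_continuous fk xU) (Ckle_continuous gk xU)).
apply/CkleS; split.
  move=> x xU; exact: (continuousD (Ckle_continuous fk xU) (Ckle_continuous gk xU)).
move=> i; split.
  move=> x Ux; exact: (derivableD (Ckle_derivable fk Ux) (Ckle_derivable gk Ux)).
apply: (Ckle_ext oU (IH _ _ (Ckle_derive i fk) (Ckle_derive i gk))) => x Ux.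
by rewrite -deriveD//; [exact: (Ckle_derivable fk Ux)|exact: (Ckle_derivable gk Ux)].
Qed.

Lemma CkleM k U f g : open U -> Ckle k U f -> Ckle k U g -> Ckle k U (fun x => f x * g x).
Proof.
move=> oU; elim: k f g => [|k IH] f g fk gk.
  apply/Ckle0 => x xU; exact: (continuousM (Ckle_continuous fk xU) (Ckle_continuous gk xU)).
apply/CkleS; split.
  move=> x xU; exact: (continuousM (Ckle_continuous fk xU) (Ckle_continuous gk xU)).
move=> i; split.
  move=> x Ux; exact: (derivableM (Ckle_derivable fk Ux) (Ckle_derivable gk Ux)).
have fk' := Ckle_le (leqnSn k) fk; have gk' := Ckle_le (leqnSn k) gk.
apply: (Ckle_ext oU (CkleD oU (IH _ _ fk' (Ckle_derive i gk)) (IH _ _ gk' (Ckle_derive i fk)))).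
by move=> x Ux; rewrite -deriveM//; [exact: (Ckle_derivable fk Ux)|exact: (Ckle_derivable gk Ux)].
Qed.

Lemma CkleN k U f : open U -> Ckle k U f -> Ckle k U (fun x => - f x).
Proof.
move=> oU fk. apply: (Ckle_ext oU (CkleM oU (Ckle_cst U (-1)) fk)) => x _.
by rewrite mulN1r.
Qed.

Lemma CkleB k U f g : open U -> Ckle k U f -> Ckle k U g -> Ckle k U (fun x => f x - g x).
Proof. by move=> oU fk gk; apply: CkleD => //; exact: CkleN. Qed.

Lemma Ckle_sum k U (I : Type) (r : seq I) (P : pred I) (F : I -> 'rV[R]_n -> R) : open U ->
  (forall i, P i -> Ckle k U (F i)) -> Ckle k U (fun x => \sum_(i <- r | P i) F i x).
Proof.
move=> oU Fk; elim: r => [|i r IH].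
  by apply: (Ckle_ext oU (Ckle_cst U 0)) => x _; rewrite big_nil.
case: (boolP (P i)) => Pi; last first.
  by apply: (Ckle_ext oU IH) => x _; rewrite big_cons (negbTE Pi).
by apply: (Ckle_ext oU (CkleD oU (Fk i Pi) IH)) => x _; rewrite big_cons Pi.
Qed.

Lemma Ckle_prod k U (I : Type) (r : seq I) (P : pred I) (F : I -> 'rV[R]_n -> R) : open U ->
  (forall i, P i -> Ckle k U (F i)) -> Ckle k U (fun x => \prod_(i <- r | P i) F i x).
Proof.
move=> oU Fk; elim: r => [|i r IH].
  by apply: (Ckle_ext oU (Ckle_cst U 1)) => x _; rewrite big_nil.
case: (boolP (P i)) => Pi; last first.
  by apply: (Ckle_ext oU IH) => x _; rewrite big_cons (negbTE Pi).
by apply: (Ckle_ext oU (CkleM oU (Fk i Pi) IH)) => x _; rewrite big_cons Pi.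
Qed.

(** The outer function comes as the sequence of its successive derivatives, so that the induction on
    [k] can pass from [phi j] to [phi j.+1]. *)
Lemma Ckle_comp1 k U f (phi : nat -> R -> R) (O : set R) j : open U ->
  (forall j s, O s -> is_derive s 1 (phi j) (phi j.+1 s)) ->
  (forall x, U x -> O (f x)) -> Ckle k U f -> Ckle k U (fun x => phi j (f x)).
Proof.
move=> oU phid fO.
have phic i x : U x -> {for f x, continuous (phi i)}.
  move=> /fO/(phid i) h; have h1 : derivable (phi i) (f x) 1 by [].
  exact/differentiable_continuous/derivable1_diffP.
elim: k j => [|k IH] j fk.
  apply/Ckle0 => x xU; apply: continuous_comp; [exact: (Ckle_continuous fk xU)|exact: phic].
apply/CkleS; split.
  move=> x xU; apply: continuous_comp; [exact: (Ckle_continuous fk xU)|exact: phic].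
have H i x : U x -> is_derive x (e_ i) (fun x => phi j (f x)) (phi j.+1 (f x) * 'D_(e_ i) f x).
  move=> Ux; apply: is_derive_comp1; last exact/phid/fO.
  by apply: derivable_at; exact: (Ckle_derivable fk Ux).
move=> i; split; first by move=> x /(H i) h; exact: (@ex_derive _ _ _ _ _ _ _ h).
have fk' := Ckle_le (leqnSn k) fk.
apply: (Ckle_ext oU (CkleM oU (IH j.+1 fk') (Ckle_derive i fk))) => x Ux.
by rewrite (@derive_val _ _ _ _ _ _ _ (H i x Ux)).
Qed.

(** The partials of 1 / f are polynomials in 1 / f and the partials of f, so the induction
    hypothesis is applied to 1 / f itself. [Ckle_sqrt] follows the same pattern. *)
Lemma CkleV k U f : open U -> (forall x, U x -> f x != 0) -> Ckle k U f ->
  Ckle k U (fun x => (f x)^-1).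
Proof.
move=> oU f0; elim: k => [|k IH] fk.
  apply/Ckle0 => x xU; apply: continuousV; [exact/f0|exact: (Ckle_continuous fk xU)].
apply/CkleS; split.
  move=> x xU; apply: continuousV; [exact/f0|exact: (Ckle_continuous fk xU)].
move=> i; split.
  by move=> x Ux; apply: derivableV; [exact: f0|exact: (Ckle_derivable fk Ux)].
have Vk := IH (Ckle_le (leqnSn k) fk).
apply: (Ckle_ext oU (CkleN oU (CkleM oU (CkleM oU Vk Vk) (Ckle_derive i fk)))) => x Ux.
rewrite (deriveV (f0 _ Ux)); last exact: (Ckle_derivable fk Ux).
by rewrite [_ *: _]mulNr -invfM -expr2.
Qed.

Lemma Ckle_sqrt k U f : open U -> (forall x, U x -> 0 < f x) -> Ckle k U f ->
  Ckle k U (fun x => Num.sqrt (f x)).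
Proof.
move=> oU f0; elim: k => [|k IH] fk.
  by apply/Ckle0 => x xU; apply: continuous_comp; [exact: (Ckle_continuous fk xU)|exact: sqrt_continuous].
apply/CkleS; split.
  by move=> x xU; apply: continuous_comp; [exact: (Ckle_continuous fk xU)|exact: sqrt_continuous].
have H i x : U x -> is_derive x (e_ i) (fun x => Num.sqrt (f x)) ((2 * Num.sqrt (f x))^-1 * 'D_(e_ i) f x).
  move=> Ux; apply: is_derive_comp1; last exact/is_derive1_sqrt/f0.
  by apply: derivable_at; exact: (Ckle_derivable fk Ux).
move=> i; split; first by move=> x /(H i) h; exact: (@ex_derive _ _ _ _ _ _ _ h).
have Sk := IH (Ckle_le (leqnSn k) fk).
have S0 x : U x -> 2 * Num.sqrt (f x) != 0.
  by move=> /f0 fx; rewrite mulf_neq0// gt_eqF// sqrtr_gt0.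
apply: (Ckle_ext oU (CkleM oU (CkleV oU S0 (CkleM oU (Ckle_cst U 2) Sk)) (Ckle_derive i fk))).
by move=> x Ux; rewrite (@derive_val _ _ _ _ _ _ _ (H i x Ux)).
Qed.

Lemma Ckle_differentiable k U f x : open U -> Ckle k.+1 U f -> U x -> differentiable f x.
Proof.
move=> oU fk Ux; apply: (differentiable_of_partials oU Ux) => i.
  by move=> y Uy; exact: (Ckle_derivable fk Uy).
by apply: (Ckle_continuous (Ckle_derive i fk)).
Qed.

Lemma Ckle_deriveE k U f x w : open U -> Ckle k.+1 U f -> U x ->
  'D_w f x = \sum_(i < n) w 0 i * 'D_(e_ i) f x.
Proof.
move=> oU fk Ux; apply: (derive_partials w oU Ux) => i.
  by move=> y Uy; exact: (Ckle_derivable fk Uy).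
by apply: (Ckle_continuous (Ckle_derive i fk)).
Qed.

Lemma Ckle_is_derive k U f x w : open U -> Ckle k.+1 U f -> U x -> is_derive x w f ('D_w f x).
Proof.
move=> oU fk Ux; apply/derivable_at/diff_derivable.
exact: (Ckle_differentiable oU fk Ux).
Qed.

Lemma Ckle_deriveD k U f w : open U -> Ckle k.+1 U f -> Ckle k U (fun x => 'D_w f x).
Proof.
move=> oU fk; apply: (@Ckle_ext k U (fun x => \sum_(i < n) w 0 i * 'D_(e_ i) f x) _ oU); last first.
  by move=> x Ux; rewrite (Ckle_deriveE w oU fk Ux).
by apply: Ckle_sum => // i _; apply: CkleM => //; [exact: Ckle_cst|exact: Ckle_derive].
Qed.

End Derivatives.

Lemma Ckle_comp (R : realType) m n k (U : set 'rV[R]_m) (W : set 'rV[R]_n)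
    (N : 'rV[R]_m -> 'rV[R]_n) (f : 'rV[R]_n -> R) :
  open U -> open W -> (forall x, U x -> W (N x)) ->
  (forall j, Ckle k U (fun x => N x 0 j)) -> Ckle k W f -> Ckle k U (fun x => f (N x)).
Proof.
move=> oU oW UW.
have Ncont l x : (forall j, Ckle l U (fun x => N x 0 j)) -> U x -> {for x, continuous N}.
  by move=> Nk Ux; apply: continuous_rV_at => j; exact: (Ckle_continuous (Nk j) Ux).
elim: k f => [|k IH] f Nk fk.
  apply/Ckle0 => x xU; apply: continuous_comp; first exact: (Ncont _ _ Nk xU).
  exact: (Ckle_continuous fk (UW _ xU)).
have Nk' j := Ckle_le (leqnSn k) (Nk j).
apply/CkleS; split.
  move=> x xU; apply: continuous_comp; first exact: (Ncont _ _ Nk xU).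
  exact: (Ckle_continuous fk (UW _ xU)).
have H i x : U x -> is_derive x (delta_mx 0 i) (f \o N)
    (\sum_(j < n) 'D_(delta_mx 0 i) (fun y => N y 0 j) x * 'D_(delta_mx 0 j) f (N x)).
  move=> Ux; apply: (is_derive_comp_partials oW (UW _ Ux)).
  - by move=> j y Wy; exact: (Ckle_derivable fk Wy).
  - by move=> j; apply: (Ckle_continuous (Ckle_derive j fk)); exact/UW.
  - by move=> j; apply: derivable_at; exact: (Ckle_derivable (Nk j) Ux).
move=> i; split; first by move=> x /(H i) h; exact: (@ex_derive _ _ _ _ _ _ _ h).
apply: (@Ckle_ext _ _ k U (fun x => \sum_(j < n) 'D_(delta_mx 0 i) (fun y => N y 0 j) x *
   'D_(delta_mx 0 j) f (N x)) _ oU); last first.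
  by move=> x Ux; rewrite (@derive_val _ _ _ _ _ _ _ (H i x Ux)).
apply: Ckle_sum => // j _; apply: CkleM => //; first exact: (Ckle_derive i (Nk j)).
exact: (IH _ Nk' (Ckle_derive j fk)).
Qed.

(** * Algebraic functions on a line *)

Section AlgebraicFunctions.
Context {R : realType}.
Implicit Types (f g : R -> R) (s : R).

Definition poly_fun (p : {poly R}) : R -> R := fun s => p.[s].

Lemma poly_fun_is_zmod : zmod_morphism poly_fun.
Proof. by move=> p q; apply/funext => s; rewrite /poly_fun hornerD hornerN. Qed.

Lemma poly_fun_is_monoid : monoid_morphism poly_fun.
Proof.
split; first by apply/funext => s; rewrite /poly_fun hornerC.
by move=> p q; apply/funext => s; rewrite /poly_fun hornerM.
Qed.

HB.instance Definition _ := GRing.isZmodMorphism.Build {poly R} (R -> R) poly_fun poly_fun_is_zmod.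
HB.instance Definition _ := GRing.isMonoidMorphism.Build {poly R} (R -> R) poly_fun poly_fun_is_monoid.

(** Integral elements form a subring in any commutative ring, so the ring of all functions on the
    line serves as it is, zero divisors included. *)
Definition algfun f := integralOver poly_fun f.

Lemma algfun_poly (p : {poly R}) : algfun (fun s => p.[s]).
Proof. exact: (@integral_id _ _ poly_fun p). Qed.

Lemma algfunD f g : algfun f -> algfun g -> algfun (fun s => f s + g s).
Proof. exact: integral_add. Qed.

Lemma algfunB f g : algfun f -> algfun g -> algfun (fun s => f s - g s).
Proof. exact: integral_sub. Qed.

Lemma algfunM f g : algfun f -> algfun g -> algfun (fun s => f s * g s).
Proof. exact: integral_mul. Qed.

Lemma algfun_cst (c : R) : algfun (fun=> c).
Proof.
have := algfun_poly c%:P; suff -> : (fun s => c%:P.[s]) = (fun=> c) by [].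
by apply/funext => s; rewrite hornerC.
Qed.

Lemma algfun_sum (I : Type) (r : seq I) (P : pred I) (F : I -> R -> R) :
  (forall i, P i -> algfun (F i)) -> algfun (fun s => \sum_(i <- r | P i) F i s).
Proof.
move=> FP; elim: r => [|i r IH].
  rewrite (_ : (fun s => _) = fun=> 0); first exact: algfun_cst.
  by apply/funext => s; rewrite big_nil.
case: (boolP (P i)) => Pi.
  rewrite (_ : (fun s => _) = fun s => F i s + \sum_(i <- r | P i) F i s).
    by apply: algfunD => //; exact: FP.
  by apply/funext => s; rewrite big_cons Pi.
rewrite (_ : (fun s => _) = fun s => \sum_(i <- r | P i) F i s)//.
by apply/funext => s; rewrite big_cons (negbTE Pi).
Qed.

(** Transitivity of integrality, for the monic polynomial X^2 - f, whose coefficients are themselves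
    integral. *)
Lemma algfun_sqrt f : (forall s, 0 <= f s) -> algfun f -> algfun (fun s => Num.sqrt (f s)).
Proof.
move=> f0 fa; apply: (@integral_root_monic _ _ _ _ ('X^2 - (f : R -> R)%:P)).
- by rewrite monicE lead_coefDl ?lead_coefXn// size_polyN size_polyXn (leq_ltn_trans (size_polyC_leq1 _)).
- apply/rootP; rewrite hornerD hornerN hornerXn hornerC; apply/funext => s.
  by rewrite /GRing.add/= /GRing.opp/= expr2 /GRing.mul/= -expr2 sqr_sqrtr// subrr.
- move=> u /(nthP 0)[i _ <-]; rewrite coefB coefXn coefC.
  apply: integral_sub; first by case: (_ == _); rewrite ?mulr1n ?mulr0n; [exact: (@mxpoly.integral1 _ _ poly_fun)|exact: (@mxpoly.integral0 _ _ poly_fun)].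
  by case: ifP => _ //; exact: (@mxpoly.integral0 _ _ poly_fun).
Qed.

Definition poly_eval (P : {poly {poly R}}) f s := (map_poly (horner_eval s) P).[f s].

Lemma poly_evalMXaddC P p f s : poly_eval (P * 'X + p%:P) f s = poly_eval P f s * f s + p.[s].
Proof. by rewrite /poly_eval rmorphD rmorphM/= map_polyX map_polyC hornerD hornerMX hornerC. Qed.

Lemma continuous_poly_eval P f : continuous f -> continuous (poly_eval P f).
Proof.
move=> fc; elim/poly_ind: P => [|P p IH] s.
  rewrite (_ : poly_eval 0 f = fun=> 0); first exact: cst_continuous.
  by apply/funext => r; rewrite /poly_eval rmorph0 horner0.
rewrite (_ : poly_eval _ f = fun r => poly_eval P f r * f r + p.[r]).
  apply: (@continuousD _ _ _ (fun r => poly_eval P f r * f r) (fun r => p.[r])).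
    exact: (@continuousM _ _ (poly_eval P f) f s (IH s) (fc s)).
  exact: continuous_horner.
by apply/funext => r; rewrite poly_evalMXaddC.
Qed.

(** Wherever f is nonzero, factors of f can be cancelled from its monic equation until the constant
    coefficient is a nonzero polynomial; the other terms are f times a continuous function. *)
Lemma algfun_lowest_coef f : continuous f -> algfun f -> exists (c : {poly R}) (S : R -> R),
  [/\ c != 0, continuous S & forall s, f s != 0 -> c.[s] = f s * S s].
Proof.
move=> fc [P Pmonic /rootP Pf].
have : P != 0 by exact: monic_neq0.
have : forall s, f s != 0 -> poly_eval P f s = 0.
  move=> s _; have := congr1 (fun h : R -> R => h s) Pf.
  move=> E; transitivity ((0 : R -> R) s) => //; rewrite -E /poly_eval /map_poly !horner_poly.
  rewrite fct_sumE; apply: eq_bigr => i _.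
  by rewrite /GRing.mul/= exprfctE.
elim/poly_ind: P {Pmonic Pf} => [|P p IH]; first by rewrite eqxx.
have [->|p0] := eqVneq p 0.
  rewrite polyC0 addr0 => Pf PX; apply: IH.
    move=> s fs; have := Pf s fs.
    have := poly_evalMXaddC P 0 f s; rewrite polyC0 addr0 horner0 addr0 => ->.
    by move=> /eqP; rewrite mulf_eq0 (negbTE fs) orbF => /eqP.
  by apply: contra PX => /eqP ->; rewrite mul0r.
move=> Pf _; exists p, (fun s => - poly_eval P f s); split => //.
  by move=> s; apply: continuousN; exact: continuous_poly_eval.
by move=> s /Pf; rewrite poly_evalMXaddC => /eqP; rewrite addr_eq0 => /eqP E; lra.
Qed.

Section Identity.
Variables (g : nat -> R -> R) (a : R).
Hypothesis gd : forall k (s : R), is_derive s 1 (g k) (g k.+1 s).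

Let gc k : continuous (g k).
Proof.
move=> s; have h : derivable (g k) s 1 by have := gd k s.
exact/differentiable_continuous/derivable1_diffP.
Qed.

(** Every derivative vanishes on the interval to the left of [sigma], and continuity carries this to
    [sigma]. *)
Let flat_derivs sigma : a < sigma -> (forall s, a < s < sigma -> g 0 s = 0) ->
  forall k, g k sigma = 0.
Proof.
move=> as_ g0.
have gk k s : a < s < sigma -> g k s = 0.
  elim: k s => [|k IH] s sI; first exact: g0.
  rewrite -(@derive_val _ _ _ _ _ _ _ (gd k s)).
  rewrite -[RHS](derive_cst (0 : R) s (1 : R)).
  apply: near_eq_derive; near=> r; apply: IH; near: r.
  by have : s \in `]a, sigma[%R by []; exact: near_in_itvoo.
move=> k; apply/eqP; apply: contraT => gs0.
have /cvgrPdist_lt /(_ `|g k sigma|) := @gc k sigma; rewrite normr_gt0 => /(_ gs0).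
move=> /nbhs_ballP[e /= e0 he].
have [m [m0 me ma]] : exists m : R, [/\ 0 < m, m < e & m < sigma - a].
  have h1 : 0 < e / 2 by rewrite divr_gt0.
  have h2 : 0 < (sigma - a) / 2 by rewrite divr_gt0// subr_gt0.
  by have [h|h] := leP (e / 2) ((sigma - a) / 2); [exists (e / 2)|exists ((sigma - a) / 2)]; split; lra.
have sI : a < sigma - m < sigma by apply/andP; split; lra.
have := he (sigma - m); rewrite -ball_normE/= opprB addrC subrK gtr0_norm// (gk k _ sI) => /(_ me).
by rewrite subr0 ltxx.
Unshelve. all: by end_near. Qed.

(** Each power of s - sigma is gained by one mean value step on the next derivative, hence the
    induction on [m] for all [k] at once. *)
Let flat_bound sigma m : (forall k, g k sigma = 0) ->
  forall k, exists2 C, 0 <= C & forall s, sigma <= s <= sigma + 1 -> `|g k s| <= C * (s - sigma) ^+ m.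
Proof.
move=> gs; elim: m => [|m IH] k.
  have wc : {within `[sigma, sigma + 1], continuous (fun s => `|g k s|)}.
    apply: continuous_subspaceT => s; apply: continuous_comp; [exact: gc|exact: norm_continuous].
  have s1 : sigma <= sigma + 1 by rewrite lerDl.
  have [c _ cmax] := EVT_max s1 wc.
  by exists `|g k c| => // s sI; rewrite expr0 mulr1; apply: cmax; rewrite in_itv.
have [C C0 hC] := IH k.+1; exists C => // s /andP[ss s1].
have wc : {within `[sigma, s], continuous (g k)}.
  by apply: continuous_subspaceT => r; exact: gc.
have [r] := @MVT_segment R (g k) (g k.+1) sigma s ss (fun x _ => gd k x) wc.
rewrite in_itv/= gs subr0 => /andP[r1 r2] ->.
rewrite normrM (ger0_norm (_ : 0 <= s - sigma)) ?subr_ge0// exprSr mulrA.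
apply: ler_wpM2r; first by rewrite subr_ge0.
apply: le_trans (hC r _) _; first by rewrite r1/=; lra.
by rewrite ler_wpM2l// lerXn2r ?nnegrE ?subr_ge0// lerD2r.
Qed.

(** Let sigma be the end of the zero interval and m its multiplicity as a root of the polynomial c
    of [algfun_lowest_coef]. Beyond sigma, g is O((s - sigma)^(m+1)). Where g is nonzero, c equals g
    times a bounded factor, yet c is of order (s - sigma)^m. So g has only zeros just after sigma,
    and the interval was not maximal. *)
Lemma algfun_identity b : algfun (g 0) -> a < b -> (forall s, a < s < b -> g 0 s = 0) ->
  forall s, a < s -> g 0 s = 0.
Proof.
move=> ga ab g0b s1 as1; apply/eqP; apply: contraT => gs1.
have [c [S [c0 Sc cS]]] := algfun_lowest_coef (@gc 0%N) ga.
pose E := [set s | forall r, a < r < s -> g 0 r = 0].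
have Eb : E b by move=> r /g0b.
have Es1 s : E s -> s <= s1.
  by move=> Es; rewrite leNgt; apply: contra gs1 => s1s; apply/eqP/Es; rewrite as1.
have hE : has_sup E by split; [exists b|exists s1].
set sigma := sup E.
have bs : b <= sigma by apply: ub_le_sup => //; exact: hE.2.
have as_ : a < sigma by exact: lt_le_trans bs.
have Esig : E sigma.
  move=> r /andP[ar rs]; have [s Es rs'] := sup_gt hE.1 rs.
  by apply: Es; rewrite ar.
have gk0 := flat_derivs as_ Esig.
have [m [q /implyP/(_ c0) qs cE]] := multiplicity_XsubC c sigma.
have [C C0 hC] := flat_bound m.+1 gk0 0.
have q0 : 0 < `|q.[sigma]| / 2 by rewrite divr_gt0// normr_gt0.
have : \forall s \near sigma, `|q.[s]| > `|q.[sigma]| / 2 /\ `|S s| <= `|S sigma| + 1.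
  near=> s; split.
    have : `|q.[sigma] - q.[s]| < `|q.[sigma]| / 2.
      near: s; have /cvgrPdist_lt h := @continuous_horner R q sigma; exact: h.
    have := ler_normD (q.[sigma] - q.[s]) q.[s]; rewrite subrK; lra.
  have : `|S sigma - S s| <= 1.
    near: s; have /cvgrPdist_le h := Sc sigma; exact: h.
  by have := ler_normB (S sigma) (S sigma - S s); rewrite opprB addrC subrK; lra.
move=> /nbhs_ballP[d /= d0 hd].
have M0 : 0 < C * (`|S sigma| + 1) + 1 by rewrite ltr_wpDl// mulr_ge0// addr_ge0.
(* Within this radius C (|S sigma| + 1) (r - sigma) stays below |q(sigma)| / 2, a lower bound for
   |q|; the caps 1 and [d] keep to the ranges of [hC] and [hd]. *)
pose e := Num.min (Num.min 1 d) ((`|q.[sigma]| / 2) / (C * (`|S sigma| + 1) + 1)).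
have e0 : 0 < e by rewrite !lt_min ltr01 d0 divr_gt0.
have : E (sigma + e).
  move=> r /andP[ar re]; have [rs|rs|->] := ltgtP r sigma; last by exact: gk0.
    by apply: Esig; rewrite ar.
  apply/eqP; apply: contraT => gr.
  have e1 : e <= 1 by rewrite !ge_min lexx.
  have ed : e <= d by rewrite !ge_min lexx orbT.
  have [qr Sr] : `|q.[r]| > `|q.[sigma]| / 2 /\ `|S r| <= `|S sigma| + 1.
    by apply: hd; rewrite -ball_normE/= distrC gtr0_norm ?subr_gt0//; lra.
  have := cS r gr; rewrite cE hornerM horner_exp hornerXsubC => /(congr1 Num.norm).
  rewrite !normrM normrX (gtr0_norm (_ : 0 < r - sigma)) ?subr_gt0// => qE.
  have gC : `|g 0 r| <= C * (r - sigma) ^+ m.+1 by apply: hC; rewrite ltW//=; lra.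
  have rm : 0 < (r - sigma) ^+ m by rewrite exprn_gt0// subr_gt0.
  have : `|q.[r]| * (r - sigma) ^+ m <= (C * (r - sigma) * (`|S sigma| + 1)) * (r - sigma) ^+ m.
    rewrite qE; apply: (le_trans (ler_pM (normr_ge0 _) (normr_ge0 _) gC Sr)).
    by rewrite le_eqVlt; apply/orP; left; apply/eqP; rewrite exprS; ring.
  rewrite ler_pM2r// => qC.
  have : (r - sigma) * (C * (`|S sigma| + 1) + 1) < `|q.[sigma]| / 2.
    by rewrite -ltr_pdivlMr//; apply: (lt_le_trans (_ : _ < e)); [lra|rewrite !ge_min lexx !orbT].
  have : 0 <= r - sigma by rewrite subr_ge0 ltW.
  by move: qC qr; lra.
move=> /(ub_le_sup hE.2); rewrite -/sigma; lra.
Unshelve. all: by end_near. Qed.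
End Identity.

End AlgebraicFunctions.

(** * Smooth sublinear functions *)

Section Regular.
Context {R : realType} {n : nat}.
Implicit Types (f g h : 'rV[R]_n -> R) (x y : 'rV[R]_n).

Definition nonzero : set 'rV[R]_n := [set x | x != 0].

Lemma open_nonzero : open nonzero.
Proof.
have -> : nonzero = ~` [set 0] by apply/seteqP; split=> x /= /eqP.
by apply: closed_openC; apply: compact_closed; [exact: norm_hausdorff|exact: compact_set1].
Qed.
Let oN := open_nonzero.

Definition regular h := (forall k, Ckle k nonzero h) /\
  forall a b, algfun (fun s : R => h (a + s *: b)).

Lemma regular_cst (c : R) : regular (fun=> c).
Proof. by split=> [k|a b]; [exact: Ckle_cst|exact: algfun_cst]. Qed.

Lemma regular_coord i : regular (fun x => x 0 i).
Proof.
split=> [k|a b]; first exact: Ckle_coord.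
have := algfun_poly ((a 0 i)%:P + (b 0 i)%:P * 'X).
by congr algfun; apply/funext => s; rewrite !hornerE !mxE mulrC.
Qed.

Lemma regularD f g : regular f -> regular g -> regular (fun x => f x + g x).
Proof.
by move=> [fs fa] [gs ga]; split=> [k|a b]; [exact: CkleD|exact: algfunD].
Qed.

Lemma regularM f g : regular f -> regular g -> regular (fun x => f x * g x).
Proof.
by move=> [fs fa] [gs ga]; split=> [k|a b]; [exact: CkleM|exact: algfunM].
Qed.

Lemma regularB f g : regular f -> regular g -> regular (fun x => f x - g x).
Proof.
by move=> [fs fa] [gs ga]; split=> [k|a b]; [exact: CkleB|exact: algfunB].
Qed.

Lemma regular_sum (I : Type) (r : seq I) (P : pred I) (F : I -> 'rV[R]_n -> R) :
  (forall i, P i -> regular (F i)) -> regular (fun x => \sum_(i <- r | P i) F i x).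
Proof.
move=> FP; split=> [k|a b]; first by apply: Ckle_sum => // i /FP[].
by apply: algfun_sum => i /FP[].
Qed.

Lemma regular_sqrt f : regular f -> (forall x, x != 0 -> 0 < f x) -> (forall x, 0 <= f x) ->
  regular (fun x => Num.sqrt (f x)).
Proof. by move=> [fs fa] fp f0; split=> [k|a b]; [exact: Ckle_sqrt|exact: algfun_sqrt]. Qed.

Lemma regular_dot y : regular (fun x => dot x y).
Proof.
apply: regular_sum => i _; apply: regularM; [exact: regular_coord|exact: regular_cst].
Qed.

Lemma dotxx_gt0 x : x != 0 -> 0 < dot x x.
Proof. by rewrite -enorm_gt0 -enorm_sqr => x0; rewrite exprn_gt0. Qed.

Lemma regular_enorm : regular (@enorm R n).
Proof.
apply: regular_sqrt; [|exact: dotxx_gt0|exact: dotxx_ge0].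
by apply: regular_sum => i _; apply: regularM; exact: regular_coord.
Qed.

Definition sublinear h := (forall x y, h (x + y) <= h x + h y) /\
  (forall r x, 0 <= r -> h (r *: x) = r * h x).

Lemma sublinear0 h : sublinear h -> h 0 = 0.
Proof. by move=> [_ hZ]; rewrite -(scale0r 0) hZ// mul0r. Qed.

Lemma sublinearD f g : sublinear f -> sublinear g -> sublinear (fun x => f x + g x).
Proof.
move=> [fD fZ] [gD gZ]; split=> [x y|r x r0]; last by rewrite fZ// gZ// mulrDr.
by rewrite addrACA lerD.
Qed.

Lemma sublinearZ (c : R) f : 0 <= c -> sublinear f -> sublinear (fun x => c * f x).
Proof.
move=> c0 [fD fZ]; split=> [x y|r x r0]; last by rewrite fZ// mulrCA.
by rewrite -mulrDr ler_wpM2l.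
Qed.

Lemma sublinear_cst0 : sublinear (fun=> 0).
Proof. by split=> [x y|r x _]; rewrite ?addr0 ?mulr0. Qed.

Lemma sublinear_sum (I : Type) (r : seq I) (P : pred I) (F : I -> 'rV[R]_n -> R) :
  (forall i, P i -> sublinear (F i)) -> sublinear (fun x => \sum_(i <- r | P i) F i x).
Proof.
move=> FP; elim: r => [|i r IH].
  rewrite (_ : (fun x => _) = fun=> 0); first exact: sublinear_cst0.
  by apply/funext => x; rewrite big_nil.
case: (boolP (P i)) => Pi.
  rewrite (_ : (fun x => _) = fun x => F i x + \sum_(i <- r | P i) F i x).
    by apply: sublinearD => //; exact: FP.
  by apply/funext => x; rewrite big_cons Pi.
rewrite (_ : (fun x => _) = fun x => \sum_(i <- r | P i) F i x)//.
by apply/funext => x; rewrite big_cons (negbTE Pi).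
Qed.

Lemma sublinear_dot y : sublinear (fun x => dot x y).
Proof. by split=> [x z|r x _]; rewrite ?dotDl ?dotZl. Qed.

Lemma sublinear_enorm : sublinear (@enorm R n).
Proof. by split=> [x y|r x r0]; [exact: enormD|rewrite enormZ ger0_norm]. Qed.

Section SmoothPositivePart.
Variable e : R.
Hypothesis e0 : 0 < e.

(* A smooth majorant of [max a 0] that is homogeneous in [(a, r)]; substituting
   a sublinear function for [a] and the Euclidean norm for [r] keeps sublinearity. *)
Definition spos (a r : R) := (a + Num.sqrt (a ^+ 2 + e ^+ 2 * r ^+ 2)) / 2.

Let q (a r : R) := Num.sqrt (a ^+ 2 + e ^+ 2 * r ^+ 2).
Let qin_ge0 (a r : R) : 0 <= a ^+ 2 + e ^+ 2 * r ^+ 2.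
Proof. by rewrite addr_ge0 ?sqr_ge0// mulr_ge0 ?sqr_ge0. Qed.
Let q_sqr a r : q a r ^+ 2 = a ^+ 2 + e ^+ 2 * r ^+ 2.
Proof. by rewrite sqr_sqrtr ?qin_ge0. Qed.
Let q_ge0 a r : 0 <= q a r. Proof. exact: sqrtr_ge0. Qed.
Let q_le a r b : 0 <= b -> a ^+ 2 + e ^+ 2 * r ^+ 2 <= b ^+ 2 -> q a r <= b.
Proof. by move=> b0 h; rewrite -(ger0_norm b0) -sqrtr_sqr ler_wsqrtr. Qed.
Let norm_le_q a r : `|a| <= q a r.
Proof. by rewrite -sqrtr_sqr ler_wsqrtr// lerDl mulr_ge0 ?sqr_ge0. Qed.
Let q_lip a b r : q a r <= q b r + `|a - b|.
Proof.
apply: q_le; first by rewrite addr_ge0.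
rewrite sqrrD q_sqr real_normK ?num_real//.
have := norm_le_q b r; have := normr_ge0 (a - b).
have : b * (a - b) <= `|b| * `|a - b| by rewrite -normrM ler_norm.
move: (q b r) => Q h1 h2 h3; have := ler_wpM2r h2 h3.
by move: (e ^+ 2 * r ^+ 2) => z h4; move: h1 h4; rewrite !expr2 mulr2n; nra.
Qed.

Let qD a1 r1 a2 r2 : q (a1 + a2) (r1 + r2) <= q a1 r1 + q a2 r2.
Proof.
apply: q_le; first by rewrite addr_ge0.
have h : a1 * a2 + e ^+ 2 * (r1 * r2) <= q a1 r1 * q a2 r2.
  rewrite (le_trans (ler_norm _))// -ler_sqr ?nnegrE ?mulr_ge0// exprMn !q_sqr real_normK ?num_real//.
  rewrite -subr_ge0 [leRHS](_ : _ = e ^+ 2 * (a1 * r2 - a2 * r1) ^+ 2); last by ring.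
  by rewrite mulr_ge0 ?sqr_ge0.
by rewrite [leRHS]sqrrD !q_sqr -mulr_natl; move: h; nra.
Qed.

Lemma sposZ k a r : 0 <= k -> spos (k * a) (k * r) = k * spos a r.
Proof.
move=> k0; rewrite /spos.
have -> : (k * a) ^+ 2 + e ^+ 2 * (k * r) ^+ 2 = k ^+ 2 * (a ^+ 2 + e ^+ 2 * r ^+ 2) by ring.
by rewrite sqrtrM ?sqr_ge0// sqrtr_sqr (ger0_norm k0); field.
Qed.

(** b + spos (a - b) r is a smoothed maximum of a and b. It is nondecreasing in both and commutes
    with adding a constant to both, hence it is nonexpansive for the sup norm; iterated maxima then
    lose nothing, however many points there are. *)
Lemma spos_max_lip a a' b b' r d : `|a - a'| <= d -> `|b - b'| <= d ->
  `|b + spos (a - b) r - (b' + spos (a' - b') r)| <= d.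
Proof.
rewrite !ler_norml => /andP[a1 a2] /andP[b1 b2].
have h1 := q_lip (a - b) (a' - b') r; have := q_lip (a' - b') (a - b) r.
rewrite (distrC (a' - b')) => h2.
have [h3|h3] := ger0P ((a - b) - (a' - b')); rewrite h3 in h1 h2 || idtac.
all: rewrite ?(ger0_norm h3) ?(ltr0_norm h3) in h1 h2.
all: by rewrite /spos -/(q _ _) -/(q (a' - b') r); apply/andP; split; lra.
Qed.

Lemma spos_ge a r : a <= spos a r.
Proof.
have := norm_le_q a r; have := ler_norm a; rewrite /spos -/(q a r); lra.
Qed.

Lemma spos_ge0 a r : 0 <= spos a r.
Proof.
have := norm_le_q a r; have := ler_norm (- a); rewrite normrN /spos -/(q a r); lra.
Qed.

Lemma spos_le a r b : 0 <= r -> a <= b -> 0 <= b -> spos a r <= b + e * r.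
Proof.
move=> r0 ab b0; have er0 : 0 <= e * r by rewrite mulr_ge0// ltW.
have : q a r <= `|a| + e * r.
  apply: q_le; first by rewrite addr_ge0.
  rewrite sqrrD real_normK ?num_real// exprMn -addrA lerD2l lerDr.
  by rewrite mulrn_wge0// mulr_ge0.
rewrite /spos -/(q a r); have [a0|a0] := ger0P a; lra.
Qed.

(** (a + q) / 2 is nondecreasing in a because q is 1-Lipschitz in a, and q is the Euclidean norm of
    (a, e r), hence subadditive. *)
Lemma spos_subadd a r a1 r1 a2 r2 : 0 <= r -> 0 <= r1 -> 0 <= r2 -> a <= a1 + a2 -> r <= r1 + r2 ->
  spos a r <= spos a1 r1 + spos a2 r2.
Proof.
move=> r0 r10 r20 aa rr.
have h1 := q_lip a (a1 + a2) r.
rewrite ler0_norm ?subr_le0// in h1.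
have h2 : q (a1 + a2) r <= q (a1 + a2) (r1 + r2).
  by apply: ler_wsqrtr; rewrite lerD2l ler_wpM2l ?sqr_ge0// ler_sqr ?nnegrE ?addr_ge0.
have h3 := qD a1 r1 a2 r2.
by rewrite /spos -/(q a r) -/(q a1 r1) -/(q a2 r2); lra.
Qed.

Lemma sublinear_spos h : sublinear h -> sublinear (fun x => spos (h x) (enorm x)).
Proof.
move=> [hD hZ]; split=> [x y|r x r0].
  by apply: spos_subadd; rewrite ?enorm_ge0// enormD.
by rewrite hZ// enormZ ger0_norm// sposZ.
Qed.

Lemma regular_spos h : regular h -> regular (fun x => spos (h x) (enorm x)).
Proof.
move=> hr; apply: regularM; last exact: regular_cst.
apply: regularD => //; apply: regular_sqrt => [||x]; last exact: qin_ge0.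
  apply: regularD; first exact: regularM.
  apply: regularM; first exact: regular_cst.
  by apply: regularM; exact: regular_enorm.
move=> x x0; rewrite ltr_wpDl ?sqr_ge0// mulr_gt0 ?exprn_gt0//.
by rewrite enorm_gt0.
Qed.

(** The point [y0] is kept apart so that the maximum is never over an empty set. *)
Fixpoint smooth_hull (y0 : 'rV[R]_n) (l : seq 'rV[R]_n) : 'rV[R]_n -> R :=
  if l is y :: l' then
    fun x => dot x y + spos (smooth_hull y0 l' x - dot x y) (enorm x)
  else fun x => dot x y0.

Lemma sublinear_smooth_hull y0 l : sublinear (smooth_hull y0 l).
Proof.
elim: l => [|y l IH]; first exact: sublinear_dot.
apply: sublinearD; first exact: sublinear_dot.
apply: (@sublinear_spos (fun x => smooth_hull y0 l x - dot x y)).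
rewrite (_ : (fun x => _) = fun x => smooth_hull y0 l x + dot x (- y)).
  by apply: sublinearD => //; exact: sublinear_dot.
by apply/funext => x; rewrite dotNr.
Qed.

Lemma regular_smooth_hull y0 l : regular (smooth_hull y0 l).
Proof.
elim: l => [|y l IH]; first exact: regular_dot.
apply: regularD; first exact: regular_dot.
apply: (@regular_spos (fun x => smooth_hull y0 l x - dot x y)).
by apply: regularB => //; exact: regular_dot.
Qed.

Lemma smooth_hull_ge y0 l x y : y \in y0 :: l -> dot x y <= smooth_hull y0 l x.
Proof.
elim: l => [|z l IH]; first by rewrite inE => /eqP ->.
have h := spos_ge (smooth_hull y0 l x - dot x z) (enorm x).
have h0 := spos_ge0 (smooth_hull y0 l x - dot x z) (enorm x).
rewrite !inE orbCA => /orP[/eqP ->|yl]; first by rewrite /= lerDl.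
by apply: (le_trans (IH _)); [rewrite inE|rewrite /=; lra].
Qed.

(** Each smoothed maximum overshoots by at most e |x|, once for every point of the list. *)
Lemma smooth_hull_le y0 l x b : (forall y, y \in y0 :: l -> dot x y <= b) ->
  smooth_hull y0 l x <= b + (size l)%:R * (e * enorm x).
Proof.
elim: l => [|z l IH] lb; first by rewrite mul0r addr0; apply: lb; rewrite inE.
have zb : dot x z <= b by apply: lb; rewrite !inE eqxx orbT.
have lb' y : y \in y0 :: l -> dot x y <= b.
  by rewrite inE => yl; apply: lb; rewrite !inE orbCA yl orbT.
have h := IH lb'.
have e1 : 0 <= (size l)%:R * (e * enorm x) by rewrite !mulr_ge0 ?enorm_ge0// ltW.
have := @spos_le (smooth_hull y0 l x - dot x z) (enorm x) (b + (size l)%:R * (e * enorm x) - dot x z).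
rewrite enorm_ge0 => /(_ isT _ _) h2; rewrite /= -natr1 mulrDl mul1r.
by have := h2 ltac:(lra) ltac:(lra); lra.
Qed.

Lemma smooth_hull_lip (T : Type) (f f' : T -> 'rV[R]_n) t0 (l : seq T) x d :
  (forall t, `|dot x (f t) - dot x (f' t)| <= d) ->
  `|smooth_hull (f t0) (map f l) x - smooth_hull (f' t0) (map f' l) x| <= d.
Proof.
move=> fd; elim: l => [|t l IH]; first exact: fd.
exact: spos_max_lip.
Qed.

End SmoothPositivePart.
End Regular.
Arguments nonzero {R} n.

(** * Marking a convex body *)

Section FlatFunction.
Context {R : realType}.
Implicit Types (P : {poly R}) (s : R).

(** The functions P(1/s) exp (-1/s), extended by zero, are closed under derivation, which acts on P
    by [flat_step]. All derivatives of [theta] are thus available in closed form. *)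
Definition flat P s : R := if 0 < s then P.[s^-1] * expR (- s^-1) else 0.
Definition flat_step P : {poly R} := 'X^2 * (P - P^`()).

Lemma near_eq_gt0 (A : Type) (f g : R -> A) s : 0 < s -> (forall r, 0 < r -> f r = g r) ->
  \forall r \near s, f r = g r.
Proof. by move=> s0 fg; near=> r; apply: fg; near: r; exact: lt_nbhsr. Unshelve. all: by end_near. Qed.

Lemma near_eq_lt0 (A : Type) (f g : R -> A) s : s < 0 -> (forall r, r < 0 -> f r = g r) ->
  \forall r \near s, f r = g r.
Proof. by move=> s0 fg; near=> r; apply: fg; near: r; exact: lt_nbhsl. Unshelve. all: by end_near. Qed.

Lemma is_derive_quadratic_bound (f : R -> R) (C : R) : 0 <= C -> f 0 = 0 ->
  (forall s, `|s| <= 1 -> `|f s| <= C * s ^+ 2) -> is_derive (0 : R) 1 f 0.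
Proof.
move=> C0 f0 fC; apply/is_deriveE; apply/cvgrPdist_le => e e0.
apply/nbhs_ballP; exists (Num.min 1 (e / (C + 1))) => /=.
  by rewrite lt_min ltr01 divr_gt0// ltr_wpDl.
move=> h; rewrite -ball_normE/= sub0r normrN lt_min => /andP[h1 he] hn0.
rewrite sub0r normrN f0 subr0 addr0 [_ *: (1 : R)]mulr1 normrM normfV.
rewrite ler_pdivrMl ?normr_gt0//; apply: le_trans (fC _ (ltW h1)) _.
rewrite -real_normK ?num_real// expr2 mulrA [leRHS]mulrC ler_wpM2r//.
move: he; rewrite ltr_pdivlMr ?ltr_wpDl// => he.
by have := normr_ge0 h; lra.
Qed.

Lemma poly_le_expn P : exists (C : R) k, 0 <= C /\ forall w, 1 <= w -> `|P.[w]| <= C * w ^+ k.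
Proof.
elim/poly_ind: P => [|P c [C [k [C0 IH]]]].
  by exists 0, 0%N; split => // w _; rewrite horner0 normr0 mul0r.
exists (C + `|c|), k.+1; split; first by rewrite addr_ge0.
move=> w w1; rewrite hornerMXaddC; apply: le_trans (ler_normD _ _) _.
have w0 : 0 <= w by rewrite (le_trans ler01).
rewrite mulrDl lerD//.
  by rewrite normrM (ger0_norm w0) exprSr mulrA ler_wpM2r// IH.
by rewrite ler_peMr// exprn_ege1.
Qed.

(** With w = 1/s, growth of order w^k is set against exp w >= w^(k+2) / (k+2)!; the two spare powers
    give s^2, which forces derivative 0 at the origin. *)
Lemma flat_quadratic_bound P : exists2 C, 0 <= C & forall s, `|s| <= 1 -> `|flat P s| <= C * s ^+ 2.
Proof.
have [C [k [C0 hC]]] := poly_le_expn P.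
exists (C * (k.+2)`!%:R); first by rewrite mulr_ge0.
move=> s s1; rewrite /flat; case: ifPn => [s0|_]; last first.
  by rewrite normr0 mulr_ge0 ?sqr_ge0 ?mulr_ge0.
rewrite gtr0_norm// in s1.
have w1 : 1 <= s^-1 by rewrite invf_ge1.
have w0 : 0 < s^-1 by rewrite invr_gt0.
rewrite normrM (gtr0_norm (expR_gt0 _)).
apply: (@le_trans _ _ (C * s^-1 ^+ k * ((k.+2)`!%:R / s^-1 ^+ k.+2))).
  apply: ler_pM; rewrite ?expR_ge0//; first exact: hC.
  rewrite expRN -[leRHS]invf_div lef_pV2 ?posrE ?expR_gt0// ?divr_gt0 ?exprn_gt0 ?ltr0n ?fact_gt0//.
  by apply: le_trans (expR_ge1Dxn k.+1 (ltW w0)); rewrite lerDr.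
rewrite le_eqVlt; apply/orP; left; apply/eqP.
rewrite -addn2 exprD !exprVn; field.
by rewrite gt_eqF//= expf_neq0// gt_eqF.
Qed.

Lemma is_derive_flat P s : is_derive s 1 (flat P) (flat (flat_step P) s).
Proof.
have [s0|s0|->] := ltgtP s 0.
- rewrite [X in is_derive _ _ _ X]/flat ltNge (ltW s0)/=.
  have h0 : is_derive s (1 : R) (cst (0 : R)) 0 by exact: is_derive_cst.
  apply: near_eq_is_derive h0.
  by apply: near_eq_lt0 => // r r0; rewrite /flat ltNge (ltW r0).
- rewrite [X in is_derive _ _ _ X]/flat s0.
  have sn0 : s != 0 by rewrite gt_eqF.
  have dV : is_derive s (1 : R) (fun r => r^-1) (- s ^- 2).
    by have := @is_deriveV R id s 1 1 sn0 (is_derive_id _ _); rewrite [_ *: _]mulr1.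
  have dP := @is_derive1_comp R (horner P) (fun r => r^-1) s _ _ (is_derive_poly P s^-1) dV.
  have dE := @is_derive1_comp R expR (fun r => - r^-1) s _ _ (is_derive_expR (- s^-1)) (is_deriveN dV).
  have hd : is_derive s (1 : R) (fun r : R => P.[r^-1] * expR (- r^-1))
      ((flat_step P).[s^-1] * expR (- s^-1)); last first.
    apply: near_eq_is_derive hd.
    by apply: near_eq_gt0 => // r r0; rewrite /flat r0.
  apply: is_derive_eq (is_deriveM dP dE) _.
  rewrite /flat_step hornerM hornerXn hornerD hornerN /= /GRing.scale/= !exprVn.
  by ring.
- rewrite [X in is_derive _ _ _ X]/flat ltxx.
  have [C C0 hC] := flat_quadratic_bound P.
  by apply: is_derive_quadratic_bound C0 _ hC; rewrite /flat ltxx.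
Qed.

(** The factor s makes the function convex on the whole line, with slopes in [0, 1]; exp (-1/s)
    alone is bounded and cannot be convex. *)
Definition theta s : R := s * flat 1 s.

Lemma thetaE s : theta s = if 0 < s then s * expR (- s^-1) else 0.
Proof. by rewrite /theta /flat; case: ifP => _; rewrite ?mulr0// hornerC mul1r. Qed.

Lemma is_derive_theta s : is_derive s 1 theta (flat (1 + 'X) s).
Proof.
apply: is_derive_eq (is_deriveM (is_derive_id s (1 : R)) (is_derive_flat 1 s)) _.
rewrite /flat_step derivC subr0 mulr1 /flat /= /GRing.scale/= mulr1.
case: ifPn => [s0|_]; last by rewrite !mulr0 addr0.
rewrite hornerXn hornerD hornerX !hornerC expr2; field.
by rewrite gt_eqF.
Qed.

(** [theta] is not of the form [flat P], but all its derivatives from the first one on are. *)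
Definition theta_deriv (j : nat) : R -> R :=
  if j is i.+1 then flat (iter i flat_step (1 + 'X)) else theta.

Lemma is_derive_theta_deriv j s : is_derive s 1 (theta_deriv j) (theta_deriv j.+1 s).
Proof. by case: j => [|j]; [exact: is_derive_theta|exact: is_derive_flat]. Qed.

Lemma theta_le0 s : s <= 0 -> theta s = 0.
Proof. by rewrite thetaE ltNge => ->. Qed.

Lemma theta_ge0 s : 0 <= theta s.
Proof. by rewrite thetaE; case: ifP => // s0; rewrite mulr_ge0 ?expR_ge0// ltW. Qed.

Lemma theta_gt0 s : 0 < s -> 0 < theta s.
Proof. by move=> s0; rewrite thetaE s0 mulr_gt0 ?expR_gt0. Qed.

Lemma theta_lt s s' : 0 < s -> s < s' -> theta s < theta s'.
Proof.
move=> s0 ss'; have s'0 := lt_trans s0 ss'; rewrite !thetaE s0 s'0.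
apply: ltr_pM => //; rewrite ?expR_ge0 ?(ltW s0)// ltr_expR ltrN2.
by rewrite ltf_pV2.
Qed.

Lemma theta_inj s s' : 0 < s -> theta s' = theta s -> s' = s.
Proof.
move=> s0 E; have s'0 : 0 < s'.
  by rewrite ltNge; apply/negP => /theta_le0; rewrite E => h; have := theta_gt0 s0; rewrite h ltxx.
by have [/(theta_lt s'0)|/(theta_lt s0)|//] := ltgtP s' s; rewrite E ltxx.
Qed.

(** Convexity in the form used for sublinearity, with control of the slope and of the intercept. For
    positive s and s0, dividing the tangent inequality by s turns it into 1 + x <= exp x at x = 1/s0
    - 1/s. *)
Lemma theta_tangent s0 : exists A, [/\ 0 <= A <= 1, 0 <= s0 * A - theta s0 <= 1 &
  forall s, theta s0 + A * (s - s0) <= theta s].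
Proof.
have [s00|s00] := leP s0 0.
  exists 0; split; rewrite ?lexx ?ler01// ?mulr0 theta_le0 ?subr0 ?lexx ?ler01//.
  by move=> s; rewrite mul0r addr0 theta_ge0.
have w0 : 0 < s0^-1 by rewrite invr_gt0.
have E0 := expR_gt0 (- s0^-1).
have E1 : expR (- s0^-1) * (1 + s0^-1) <= 1.
  by rewrite expRN -ler_pdivlMl ?invr_gt0 ?expR_gt0// invrK mulr1 expR_ge1Dx.
have sA : s0 * (expR (- s0^-1) * (1 + s0^-1)) - theta s0 = expR (- s0^-1).
  by rewrite thetaE s00; field; rewrite gt_eqF.
exists (expR (- s0^-1) * (1 + s0^-1)); split.
- by rewrite E1 andbT mulr_ge0 ?(ltW E0)// addr_ge0 ?ltW.
- by rewrite sA ltW//= (le_trans _ E1)// ler_peMr ?(ltW E0)// lerDl ltW.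
move=> s; set A := expR _ * _ in sA E1 *.
have A0 : 0 <= A by rewrite mulr_ge0 ?(ltW E0)// addr_ge0 ?ltW.
have -> : theta s0 + A * (s - s0) = A * s - expR (- s0^-1) by rewrite -sA; ring.
have [sn|sp] := leP s 0.
  rewrite theta_le0//; have := mulr_ge0_le0 A0 sn; lra.
have v0 : 0 < s^-1 by rewrite invr_gt0.
rewrite thetaE sp.
have -> : A * s - expR (- s0^-1) = s * (expR (- s0^-1) * (1 + (s0^-1 - s^-1))).
  by rewrite /A; field; rewrite !gt_eqF.
rewrite ler_pM2l//; have E : - s^-1 = - s0^-1 + (s0^-1 - s^-1) by ring.
by rewrite [in leRHS]E expRD ler_pM2l// expR_ge1Dx.
Qed.

End FlatFunction.

(** * The marker and the ellipsoid without symmetries *)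

Section Marking.
Context {R : realType} {n : nat}.
Implicit Types (h : 'rV[R]_n -> R) (x y : 'rV[R]_n).

Definition marking (c : R) h x : R := enorm x * theta (h x / enorm x - c).

(** The marking is the perspective of a convex function, composed with h. The tangent line of
    [theta] at the slope of x + y yields a minorant A h + B |.| of the whole sum, with equality at x
    + y; as A and B are nonnegative, the minorant is subadditive. *)
Lemma sublinear_marking c h : 0 <= c -> sublinear h ->
  sublinear (fun x => (1 + c) * enorm x + marking c h x).
Proof.
move=> c0 hs; have [hD hZ] := hs; split; last first.
  move=> r x; rewrite le_eqVlt => /orP[/eqP <-|r0].
    by rewrite scale0r mul0r /marking enorm0 mul0r mulr0 addr0.
  rewrite /marking hZ ?ltW// enormZ gtr0_norm//.
  have -> : r * h x / (r * enorm x) = h x / enorm x.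
    by rewrite invfM mulrACA divff ?gt_eqF// mul1r.
  by ring.
have nonneg x : 0 <= (1 + c) * enorm x + marking c h x.
  by rewrite /marking addr_ge0// mulr_ge0 ?enorm_ge0 ?theta_ge0// addr_ge0.
move=> x y; have [xy0|xy0] := eqVneq (enorm (x + y)) 0.
  by rewrite /marking xy0 mulr0 mul0r addr0 addr_ge0.
have r0 : 0 < enorm (x + y) by rewrite lt_neqAle eq_sym xy0 enorm_ge0.
set s0 := h (x + y) / enorm (x + y) - c.
have [A [/andP[A0 A1] /andP[B0 B1] hA]] := theta_tangent s0.
(* The coefficient of |.| after homogenising the tangent line. It is nonnegative since s0 A - theta
   s0 <= 1 and c A <= c; this is what the summand (1 + c) |x| is for. *)
pose B := 1 + c + theta s0 - (c + s0) * A.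
have cA : c * A <= c by rewrite ler_piMr.
have BB : 0 <= B by rewrite /B mulrDl; lra.
have tang z : A * h z + B * enorm z <= (1 + c) * enorm z + marking c h z.
  have [->|z0] := eqVneq z 0.
    by rewrite (sublinear0 hs) /marking enorm0 !mulr0 mul0r addr0.
  have z0' : 0 < enorm z by rewrite enorm_gt0.
  have := ler_wpM2l (ltW z0') (hA (h z / enorm z - c)); rewrite -/(marking c h z).
  have -> : enorm z * (theta s0 + A * (h z / enorm z - c - s0)) =
      A * h z + B * enorm z - (1 + c) * enorm z.
    by rewrite /B; field; rewrite gt_eqF.
  by lra.
have -> : (1 + c) * enorm (x + y) + marking c h (x + y) = A * h (x + y) + B * enorm (x + y).
  rewrite /marking -/s0 /B.
  have -> : h (x + y) = (s0 + c) * enorm (x + y) by rewrite /s0 subrK divfK.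
  by ring.
have := tang x; have := tang y.
have := ler_wpM2l A0 (hD x y); have := ler_wpM2l BB (enormD x y); lra.
Qed.

Lemma Ckle_marking c h k : (forall k, Ckle k (nonzero n) h) -> Ckle k (nonzero n) (marking c h).
Proof.
move=> hs; have oN := @open_nonzero R n.
have [es _] := @regular_enorm R n.
apply: CkleM => //.
apply: (@Ckle_comp1 _ _ k (nonzero n) (fun x => h x / enorm x - c) theta_deriv setT 0 oN).
- by move=> j s _; exact: is_derive_theta_deriv.
- by [].
apply: CkleB => //; last exact: Ckle_cst.
apply: CkleM => //; apply: CkleV => // x x0; by rewrite gt_eqF// enorm_gt0.
Qed.

(* The support function of an ellipsoid with pairwise distinct semi-axes,
   translated off all its planes of symmetry. *)
Definition ell x : R := Num.sqrt (\sum_(i < n) i.+1%:R * x 0 i ^+ 2) + \sum_(i < n) x 0 i.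

Let ell_quad_ge0 x : 0 <= \sum_(i < n) i.+1%:R * x 0 i ^+ 2.
Proof. by apply: sumr_ge0 => i _; rewrite mulr_ge0 ?sqr_ge0. Qed.

Let sum_dot1 x : \sum_(i < n) x 0 i = dot x (const_mx 1).
Proof. by apply: eq_bigr => i _; rewrite mxE mulr1. Qed.

Lemma regular_ell : regular ell.
Proof.
apply: regularD; last by apply: regular_sum => i _; exact: regular_coord.
apply: regular_sqrt => //.
  apply: regular_sum => i _; apply: regularM; first exact: regular_cst.
  by apply: regularM; exact: regular_coord.
move=> x x0; apply: lt_le_trans (dotxx_gt0 x0) _; apply: ler_sum => i _.
by rewrite -expr2 ler_peMl ?sqr_ge0// ler1n.
Qed.

Lemma sublinear_ell : sublinear ell.
Proof.
apply: sublinearD; last first.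
  rewrite (_ : (fun x => _) = fun x => dot x (const_mx 1)); first exact: sublinear_dot.
  by apply/funext => x; rewrite sum_dot1.
pose D : 'M[R]_n := diag_mx (\row_i Num.sqrt i.+1%:R).
have E x : Num.sqrt (\sum_(i < n) i.+1%:R * x 0 i ^+ 2) = enorm (x *m D).
  congr Num.sqrt; apply: eq_bigr => i _; rewrite mul_mx_diag !mxE.
  by rewrite -expr2 exprMn sqr_sqrtr ?ler0n// mulrC.
split=> [x y|r x r0]; rewrite !E; first by rewrite mulmxDl enormD.
by rewrite -scalemxAl enormZ ger0_norm.
Qed.

(** Together with [ell_last] this leaves room for a threshold: half of the directions lie strictly
    below sqrt n + 1/2, and some direction lies strictly above. *)
Lemma ell_le x : \sum_(i < n) x 0 i <= 0 -> ell x <= Num.sqrt n%:R * enorm x.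
Proof.
move=> x0; apply: (@le_trans _ _ (Num.sqrt (\sum_(i < n) i.+1%:R * x 0 i ^+ 2))).
  by rewrite /ell gerDl.
rewrite -sqrtrM ?ler0n//; apply: ler_wsqrtr; rewrite /dot mulr_sumr.
by apply: ler_sum => i _; rewrite -expr2 ler_wpM2r ?sqr_ge0// ler_nat.
Qed.

Lemma ell_last (i : 'I_n) : i.+1 = n -> ell (delta_mx 0 i) = Num.sqrt n%:R + 1.
Proof.
move=> ni; rewrite /ell (bigD1 i)//= [X in _ + X](bigD1 i)//= !mxE !eqxx expr1n mulr1.
rewrite big1 ?addr0 1?big1 ?addr0 ?ni// => j /negbTE ji.
- by rewrite mxE ji andbF.
- by rewrite mxE ji andbF expr0n mulr0.
Qed.

(** Preserving the quadratic part makes [g] diagonal, and preserving the linear part then makes its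
    diagonal entries 1. *)
Lemma ell_isotropy (g : 'M[R]_n) : g *m g^T = 1%:M ->
  (forall v, ell (v *m g) = ell v) -> g = 1%:M.
Proof.
move=> gO gell.
(* The square root is even and the sum is odd, so comparing [v] with [- v] separates them. *)
have gl (v : 'rV[R]_n) : \sum_(i < n) (v *m g) 0 i = \sum_(i < n) v 0 i.
  have := gell (- v); have := gell v; rewrite /ell mulNmx.
  have S (w : 'rV[R]_n) : \sum_(i < n) (- w) 0 i = - \sum_(i < n) w 0 i.
    by rewrite -sumrN; apply: eq_bigr => i _; rewrite mxE.
  have Q (w : 'rV[R]_n) : \sum_(i < n) i.+1%:R * (- w) 0 i ^+ 2 = \sum_(i < n) i.+1%:R * w 0 i ^+ 2.
    by apply: eq_bigr => i _; rewrite mxE sqrrN.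
  by rewrite !S !Q; lra.
have gq (v : 'rV[R]_n) : \sum_(i < n) i.+1%:R * (v *m g) 0 i ^+ 2 = \sum_(i < n) i.+1%:R * v 0 i ^+ 2.
  by have := gell v; rewrite /ell gl => /addIr/eqP; rewrite eqr_sqrt// => /eqP.
pose W : 'M[R]_n := diag_mx (\row_i i.+1%:R).
have qE (v : 'rV[R]_n) : \sum_(i < n) i.+1%:R * v 0 i ^+ 2 = dot (v *m W) v.
  by apply: eq_bigr => i _; rewrite mul_mx_diag !mxE expr2 mulrCA mulrA mulrC mulrA.
have WT : W^T = W by rewrite tr_diag_mx.
pose M := g *m W *m g^T - W.
have MT : M^T = M by rewrite /M linearB/= !trmx_mul trmxK WT mulmxA.
have MQ (v : 'rV[R]_n) : dot (v *m M) v = 0.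
  rewrite /M mulmxBr dotBl -qE -gq qE !mulmxA [X in X - _]dot_mulmx trmxK subrr//.
have M0 : M = 0.
  have bil (u v : 'rV[R]_n) : dot (u *m M) v = 0.
    have := MQ (u + v); rewrite mulmxDl !dotDl !dotDr !MQ.
    by rewrite [dot (v *m M) u]dot_mulmx MT [dot v _]dotC; lra.
  by apply/row_matrixP => i; rewrite rowE; apply: dot_ext => v; rewrite bil row0 dot0l.
have gW : g *m W = W *m g.
  have WE : W = g *m W *m g^T by move/eqP: M0; rewrite subr_eq0 => /eqP.
  by rewrite [in RHS]WE -mulmxA (mulmx1C gO) mulmx1.
(* The diagonal entries of [W] are distinct, so a matrix commuting with it is diagonal. *)
have goff i j : i != j -> g i j = 0.
  move=> ij; have := congr1 (fun A : 'M[R]_n => A i j) gW.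
  rewrite mul_mx_diag mul_diag_mx !mxE => /eqP.
  rewrite mulrC -subr_eq0 -mulrBl mulf_eq0 subr_eq0 eqr_nat eqSS eq_sym => /orP[|/eqP//].
  by rewrite -[_ == _ :> nat]/(i == j) (negbTE ij).
apply/matrixP => i j; rewrite mxE; have [->|/goff//] := eqVneq i j.
have := gl (delta_mx 0 j); rewrite (bigD1 j)//= big1 => [|k kj]; last first.
  by rewrite -rowE mxE goff// eq_sym.
rewrite addr0 -rowE mxE => ->; rewrite (bigD1 j)//= big1 ?addr0 ?mxE ?eqxx// => k kj.
by rewrite mxE (negbTE kj) andbF.
Qed.

End Marking.

(** * Bodies with a smooth support function *)

Section OneSided.
Context {R : realType} {V : normedModType R}.

(** Sublinearity controls only increments with s > 0; these already determine the bound on a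
    two-sided derivative. *)
Lemma is_derive_le (f : V -> R) (x w : V) (d c delta : R) : 0 < delta ->
  (forall s, 0 < s < delta -> f (x + s *: w) <= f x + s * c) -> is_derive x w f d -> d <= c.
Proof.
move=> delta0 fc /is_deriveE/cvgrPdist_lt fd; rewrite leNgt; apply/negP => cd.
have /fd/nbhs_ballP[e /= e0 he] : 0 < d - c by rewrite subr_gt0.
pose s := Num.min e delta / 2.
have m0 : 0 < Num.min e delta by rewrite lt_min e0.
have s0 : 0 < s by rewrite divr_gt0.
have sm : s < Num.min e delta by rewrite ltr_pdivrMr// ltr_pMr// ltr1n.
have := he s; rewrite -ball_normE/= sub0r normrN gtr0_norm// gt_eqF//=.
have -> : s < e by rewrite (lt_le_trans sm)// ge_min lexx.
move=> /(_ isT isT) /(le_lt_trans (ler_norm _)); rewrite [s *: w + x]addrC => dq.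
have := fc s; rewrite s0 (lt_le_trans sm) ?ge_min ?lexx ?orbT// => /(_ isT).
rewrite -lerBlDl -ler_pdivrMl// => h1.
by move: dq; rewrite -[_ *: _]/(s^-1 * (f (x + s *: w) - f x)); lra.
Qed.

Lemma is_derive_ge (f : V -> R) (x w : V) (d c delta : R) : 0 < delta ->
  (forall s, 0 < s < delta -> f x + s * c <= f (x + s *: w)) -> is_derive x w f d -> c <= d.
Proof.
move=> delta0 fc fd; rewrite -lerN2.
apply: (@is_derive_le (- f) x w _ _ delta delta0 _ (is_deriveN fd)) => s /fc h1.
by rewrite -[(- f) (_ + _)]/(- f _) -[(- f) x]/(- f x) mulrN; lra.
Qed.
End OneSided.

Section Lipschitz.
Context {R : realType} {n : nat}.

Lemma cvg_norm_lipschitz (V W : normedModType R) (f : V -> W) (C : R) :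
  (forall x y, `|f x - f y| <= C * `|x - y|) -> continuous f.
Proof.
move=> fC x; apply/cvgrPdist_le => e e0; apply/nbhs_ballP.
have C1 : 0 < `|C| + 1 by rewrite ltr_wpDl.
exists (e / (`|C| + 1)); first by rewrite /= divr_gt0.
move=> y; rewrite -ball_normE/= ltr_pdivlMr// => xy.
apply: le_trans (fC _ _) _; apply: le_trans (ltW xy).
by rewrite mulrC ler_wpM2l// ler_wpDr// ler_norm.
Qed.

Lemma enorm_lipschitz_continuous (f : 'rV[R]_n -> 'rV[R]_n) :
  (forall x y, enorm (f x - f y) <= enorm (x - y)) -> continuous f.
Proof.
move=> fC; apply: (@cvg_norm_lipschitz _ _ _ (Num.sqrt n%:R)) => x y.
apply: le_trans (norm_le_enorm _) _; apply: le_trans (fC _ _) _.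
exact: enorm_le_norm.
Qed.
End Lipschitz.

(** * The convex set cut out by a smooth sublinear function, and its inverse Gauss map *)

Section Body.
Context {R : realType} {n : nat}.
Implicit Types (h : 'rV[R]_n -> R) (x y z v w p q : 'rV[R]_n).
Notation e_ i := (delta_mx 0 i : 'rV[R]_n).

Definition body h : set 'rV[R]_n := [set x | forall v, dot x v <= h v].
Definition grad h x : 'rV[R]_n := \row_i 'D_(e_ i) h x.

Lemma convex_body_of h : convex (body h).
Proof.
apply/convexP => x y t Kx Ky /andP[t0 t1] v; rewrite dotDl !dotZl.
have := ler_wpM2l t0 (Kx v).
have t1' : 0 <= 1 - t by rewrite subr_ge0.
by have := ler_wpM2l t1' (Ky v); lra.
Qed.

Lemma closed_body h : closed (body h).
Proof.
rewrite (_ : body h = \bigcap_v (fun x => dot x v) @^-1` [set r | r <= h v]).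
  apply: closed_bigI => v _; apply: closed_comp; last exact: closed_le.
  by move=> x _; exact: continuous_dot.
by apply/seteqP; split => [x Kx v _|x Kx v]; [exact: Kx|exact: (Kx v I)].
Qed.

(** For any function h, the inequalities for the basis vectors and their opposites already bound
    every coordinate. *)
Lemma compact_body h : compact (body h).
Proof.
apply: bounded_closed_compact; last exact: closed_body.
pose M := \sum_(i < n) (`|h (e_ i)| + `|h (- e_ i)|).
exists M; split; first by rewrite num_real.
move=> r Mr x Kx; apply: le_trans (ltW Mr).
apply: norm_le_coord; first by apply: sumr_ge0 => i _; rewrite addr_ge0.
move=> i; rewrite /M (bigD1 i)//=.
have S0 : 0 <= \sum_(j < n | j != i) (`|h (e_ j)| + `|h (- e_ j)|).
  by apply: sumr_ge0 => j _; rewrite addr_ge0.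
have := Kx (e_ i); have := Kx (- e_ i); rewrite dotNr dot_delta => h1 h2.
have := ler_norm (h (e_ i)); have := ler_norm (h (- e_ i)).
have := normr_ge0 (h (e_ i)); have := normr_ge0 (h (- e_ i)).
by rewrite ler_norml => *; apply/andP; split; lra.
Qed.

Variable h : 'rV[R]_n -> R.
Hypothesis hsub : sublinear h.
Hypothesis hs : forall k, Ckle k (nonzero n) h.
Hypothesis n0 : (0 < n)%N.
Let oN := @open_nonzero R n.
Let K := body h.

Let hder x w : x != 0 -> is_derive x w h ('D_w h x).
Proof. by move=> x0; exact: (Ckle_is_derive w oN (@hs 1%N) x0). Qed.

Lemma dot_grad x w : x != 0 -> dot (grad h x) w = 'D_w h x.
Proof.
move=> x0; rewrite (Ckle_deriveE w oN (@hs 1%N) x0).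
by apply: eq_bigr => i _; rewrite mxE mulrC.
Qed.

Lemma grad_body x : x != 0 -> K (grad h x).
Proof.
move=> x0 w; rewrite dot_grad//; have [hD hZ] := hsub.
apply: (@is_derive_le _ _ _ _ _ _ _ 1 ltr01 _ (hder w x0)) => s /andP[s0 _].
by rewrite -hZ ?hD// ltW.
Qed.

(** The subgradient inequalities along w and - w determine p: differentiability of h off the origin
    means that each face of the body is a single point. *)
Lemma grad_unique x p : x != 0 -> K p -> dot p x = h x -> p = grad h x.
Proof.
move=> x0 Kp px; have H w : dot p w <= 'D_w h x.
  apply: (@is_derive_ge _ _ _ _ _ _ _ 1 ltr01 _ (hder w x0)) => s _.
  by rewrite -px -dotZr -dotDr.
apply: dot_ext => w; rewrite dot_grad//; apply/eqP; rewrite eq_le H/=.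
by have := H (- w); rewrite -!dot_grad// !dotNr lerN2.
Qed.

Lemma dot_grad_self x : x != 0 -> dot (grad h x) x = h x.
Proof.
move=> x0; rewrite dot_grad//; have [hD hZ] := hsub.
have E s : 0 < s < 1 -> h (x + s *: x) = h x + s * h x.
  by move=> /andP[s0 _]; rewrite -{1}(scale1r x) -scalerDl hZ ?addr_ge0 ?ltW// mulrDl mul1r.
apply/eqP; rewrite eq_le; apply/andP; split.
  by apply: (@is_derive_le _ _ _ _ _ _ _ 1 ltr01 _ (hder x x0)) => s /E ->.
by apply: (@is_derive_ge _ _ _ _ _ _ _ 1 ltr01 _ (hder x x0)) => s /E ->.
Qed.

Lemma exists_nonzero : exists x : 'rV[R]_n, x != 0.
Proof.
exists (e_ (Ordinal n0)); apply/eqP => /rowP/(_ (Ordinal n0)).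
by rewrite !mxE !eqxx => /eqP; rewrite oner_eq0.
Qed.

Lemma body_nonempty : K !=set0.
Proof. by have [x x0] := exists_nonzero; exists (grad h x); exact: grad_body. Qed.

Let cK : compact K := @compact_body h.
Let vK : convex K := @convex_body_of h.
Let K0 : K !=set0 := body_nonempty.

Lemma support_fun_body v : support_fun K v = h v.
Proof.
have [->|v0] := eqVneq v 0.
  have [x Kx] := K0; rewrite (support_fun_eq cK Kx) ?dot0r ?(sublinear0 hsub)//.
  by move=> y _; rewrite !dot0r.
by rewrite (support_fun_eq cK (grad_body v0)) ?dot_grad_self.
Qed.

(** The boundary point with outer normal z, pushed outwards by z. It is a bijection from the nonzero
    vectors to the complement of the body, with inverse [offset]. *)
Definition gauss_inv z := grad h z + z.
Notation Psi := gauss_inv.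

Lemma offset_gauss_inv z : z != 0 -> offset K (Psi z) = z.
Proof.
move=> z0; rewrite /offset (@proj_eq _ _ K _ (grad h z))// /Psi ?(addrC (grad _ _)) ?addrK//.
split; first exact: grad_body.
by move=> q Kq; rewrite addrK dotBr !(dotC z) dot_grad_self// subr_le0; exact: Kq.
Qed.

Lemma gauss_inv_offset y : offset K y != 0 -> Psi (offset K y) = y.
Proof.
move=> N0; rewrite /Psi -(@grad_unique (offset K y) (proj K y))//.
- by rewrite addrC subrK.
- by have [] := projP y K0 cK vK.
- by rewrite -support_fun_offset// support_fun_body.
Qed.

Lemma grad_monotone x y : x != 0 -> y != 0 -> 0 <= dot (grad h y - grad h x) (y - x).
Proof.
move=> x0 y0; rewrite dotBl !dotBr !dot_grad_self//.
by have := grad_body x0 y; have := grad_body y0 x; lra.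
Qed.

Lemma Ckle_gauss_inv k j : Ckle k (nonzero n) (fun z => Psi z 0 j).
Proof.
apply: (@Ckle_ext _ _ k _ (fun z => 'D_(e_ j) h z + z 0 j) _ oN); last by move=> x _; rewrite !mxE.
by apply: CkleD => //; [exact: Ckle_derive|exact: Ckle_coord].
Qed.

Definition gauss_jac z : 'M[R]_n := \matrix_(i, j) 'D_(e_ i) (fun y => Psi y 0 j) z.
Notation J := gauss_jac.

Lemma mul_gauss_jac w z j : z != 0 -> (w *m J z) 0 j = 'D_w (fun y => Psi y 0 j) z.
Proof.
move=> z0; rewrite (Ckle_deriveE w oN (@Ckle_gauss_inv 1%N j) z0) mxE.
by apply: eq_bigr => i _; rewrite mxE.
Qed.

(** Convexity enters as monotonicity of the gradient: the increment of [Psi] along s w, paired with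
    w, is at least s <w, w>. *)
Lemma gauss_jac_pos w z : z != 0 -> dot w w <= dot (w *m J z) w.
Proof.
move=> z0.
have [d d0 zd] : exists2 d : R, 0 < d & forall s, 0 < s < d -> z + s *: w != 0.
  have : nbhs z (nonzero n) by apply: open_nbhs_nbhs; split.
  move=> /nbhs_ballP[e /= e0 he]; exists (e / (1 + `|w|)); first by rewrite divr_gt0// ltr_pwDl.
  move=> s /andP[s0]; rewrite ltr_pdivlMr ?ltr_pwDl// => se; apply: he.
  rewrite -ball_normE/= opprD addrA subrr sub0r normrN normrZ gtr0_norm//.
  by apply: le_lt_trans se; rewrite ler_pM2l// lerDr.
apply: (@is_derive_ge _ _ (fun y => dot (Psi y) w) z w _ _ d d0).
  move=> s sd; rewrite -lerBrDl -dotBl; have /andP[s0 _] := sd.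
  have -> : Psi (z + s *: w) - Psi z = grad h (z + s *: w) - grad h z + s *: w.
    by rewrite /Psi; apply/rowP => i; rewrite !mxE; ring.
  have := grad_monotone z0 (zd s sd); rewrite [z + _ - z]addrC addKr dotZr pmulr_rge0// => hm.
  by rewrite dotDl dotZl lerDr.
apply: (@is_derive_eq _ _ _ _ _ _ (\sum_(j < n) (w *m J z) 0 j *: w 0 j)) => //.
have -> : (fun y => dot (Psi y) w) = \sum_(j < n) (fun y => Psi y 0 j * w 0 j).
  by apply/funext => y; rewrite fct_sumE.
apply: is_derive_sum => j.
rewrite mul_gauss_jac//.
have H := Ckle_is_derive w oN (@Ckle_gauss_inv 1%N j) z0.
have H2 : is_derive z w (fun y => Psi y 0 j * w 0 j) _ :=
  @is_deriveM _ _ _ _ z w _ _ H (is_derive_cst (w 0 j) z w).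
by apply: is_derive_eq H2 _; rewrite scaler0 add0r [RHS]mulrC.
Qed.

Lemma unitmx_of_ker (A : 'M[R]_n) : (forall w, w *m A = 0 -> w = 0) -> A \in unitmx.
Proof.
move=> A0; rewrite -row_free_unit -kermx_eq0; apply/eqP/row_matrixP => i.
rewrite row0; apply: A0; rewrite -row_mul.
by have /sub_kermxP -> := submx_refl (kermx A); rewrite row0.
Qed.

Lemma gauss_jac_unit z : z != 0 -> J z \in unitmx.
Proof.
move=> z0; apply: unitmx_of_ker => w wJ.
have := gauss_jac_pos w z0; rewrite wJ dot0l => w0.
by apply/eqP; rewrite -enorm_eq0 -sqrf_eq0 enorm_sqr eq_le w0 dotxx_ge0.
Qed.

Definition outside : set 'rV[R]_n := [set y | offset K y != 0].

Lemma continuous_offset : continuous (offset K).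
Proof.
by apply: enorm_lipschitz_continuous => x y; rewrite offset_lipschitz.
Qed.

Lemma open_outside : open outside.
Proof.
rewrite (_ : outside = offset K @^-1` nonzero n)//; apply: open_comp => //.
by move=> x _; exact: continuous_offset.
Qed.

(** The inverse function theorem in the easy case: the inverse exists globally and is 1-Lipschitz,
    so its increment D is O(s), and the expansion of [Psi] at [z] can be solved for D. *)
Lemma is_derive_offset y v j : outside y ->
  is_derive y v (fun x => offset K x 0 j) ((v *m invmx (J (offset K y))) 0 j).
Proof.
move=> y0; set z := offset K y in y0 *; have z0 : z != 0 by exact: y0.
set Ji := invmx (J z).
apply/is_deriveE/cvgrPdist_le => e e0.
(* The absolute column sum of J^-1, by which the remainder is multiplied at the end; [e'] is chosen
   so that the final error is at most e |s|. *)
pose M := \sum_(i < n) `|Ji i j|.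
have M0 : 0 <= M by apply: sumr_ge0.
have c0 : 0 < enorm v * M + 1 by rewrite ltr_wpDl// mulr_ge0// enorm_ge0.
pose e' := e / (enorm v * M + 1).
have e'0 : 0 < e' by rewrite divr_gt0.
have : \forall D \near (0 : 'rV[R]_n), forall i,
    `|Psi (D + z) 0 i - (Psi z 0 i + (D *m J z) 0 i)| <= e' * `|D|.
  apply: (@filter_forall _ 'I_n (fun i D =>
    `|Psi (D + z) 0 i - (Psi z 0 i + (D *m J z) 0 i)| <= e' * `|D|) (nbhs (0 : 'rV[R]_n)) _) => i.
  have := @diff_row_lin_of_partials R n (nonzero n) (fun y => Psi y 0 i) z oN z0.
  move=> /(_ (fun k x Hx => Ckle_derivable (@Ckle_gauss_inv 1%N i) Hx)).
  move=> /(_ (fun k => Ckle_continuous (Ckle_derive k (@Ckle_gauss_inv 1%N i)) z0)).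
  move=> /eqaddoP /(_ e' e'0); apply: filterS => D.
  rewrite (mul_gauss_jac D i z0) (Ckle_deriveE D oN (@Ckle_gauss_inv 1%N i) z0).
  exact.
move=> /nbhs_ballP[d /= d0 hd].
have : nbhs y outside by apply: open_nbhs_nbhs; split => //; exact: open_outside.
move=> /nbhs_ballP[d' /= d'0 hd'].
have v1 : 0 < enorm v + 1 by rewrite ltr_wpDl ?enorm_ge0.
apply/nbhs_ballP; exists (Num.min (d / (enorm v + 1)) (d' / (enorm v + 1))) => /=.
  by rewrite lt_min !divr_gt0.
move=> s; rewrite -ball_normE/= sub0r normrN lt_min !ltr_pdivlMr// => /andP[sd sd'] sn0.
have sv : `|s| * enorm v <= `|s| * (enorm v + 1) by rewrite ler_wpM2l// lerDl.
have out : outside (s *: v + y).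
  apply: hd'; rewrite -ball_normE/= opprD addrCA subrr addr0 normrN.
  apply: le_lt_trans (norm_le_enorm _) _; rewrite enormZ.
  exact: le_lt_trans sd'.
pose D := offset K (s *: v + y) - z.
have De : enorm D <= `|s| * enorm v.
  apply: le_trans (offset_lipschitz _ _ K0 cK vK) _.
  by rewrite addrK enormZ.
have Dn : `|D| <= `|s| * enorm v by apply: le_trans (norm_le_enorm _) De.
(* As [Psi] inverts the offset at both points, [r] is the remainder in the expansion of [Psi] at
   [z]. *)
pose r := s *: v - D *m J z.
have rb i : `|r 0 i| <= e' * (`|s| * enorm v).
  have := hd D; rewrite -ball_normE/= sub0r normrN => /(_ _ i).
  rewrite (le_lt_trans Dn (le_lt_trans sv sd)) => /(_ isT).
  rewrite /D subrK gauss_inv_offset// (gauss_inv_offset z0) -/D => h1.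
  apply: (le_trans (le_trans _ h1)); last by rewrite ler_wpM2l// ltW.
  by rewrite le_eqVlt; apply/orP; left; apply/eqP; congr Num.norm; rewrite !mxE; ring.
have rE : (s *: v) *m Ji - D = r *m Ji.
  by rewrite /r mulmxBl -mulmxA mulmxV ?mulmx1// gauss_jac_unit.
have -> : (v *m Ji) 0 j - s^-1 *: (offset K (s *: v + y) 0 j - offset K y 0 j) =
    s^-1 * (r *m Ji) 0 j.
  rewrite -rE -scalemxAl -[offset K y]/z [_ *: _]/(_ * _) !mxE mulrBr mulKf//.
rewrite normrM normfV ler_pdivrMl ?normr_gt0//.
rewrite mxE; apply: le_trans (ler_norm_sum _ _ _) _.
apply: (@le_trans _ _ (\sum_(i < n) e' * (`|s| * enorm v) * `|Ji i j|)).
  by apply: ler_sum => i _; rewrite normrM ler_wpM2r.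
rewrite -mulr_sumr -/M.
have -> : e' * (`|s| * enorm v) * M = `|s| * (e' * (enorm v * M)) by ring.
by rewrite ler_wpM2l// /e' mulrAC ler_pdivrMr// (ler_wpM2l (ltW e0))// lerDl.
Qed.

Lemma Ckle_det k m (U : set 'rV[R]_n) (A : 'rV[R]_n -> 'M[R]_m) : open U ->
  (forall i j, Ckle k U (fun z => A z i j)) -> Ckle k U (fun z => \det (A z)).
Proof.
move=> oU Ak; apply: Ckle_sum => // s _; apply: CkleM => //; first exact: Ckle_cst.
by apply: Ckle_prod.
Qed.

Lemma Ckle_gauss_jac k i j : Ckle k (nonzero n) (fun z => J z i j).
Proof.
apply: (@Ckle_ext _ _ k _ (fun z => 'D_(e_ i) (fun y => Psi y 0 j) z) _ oN).
  exact: Ckle_derive (@Ckle_gauss_inv k.+1 j).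
by move=> z _; rewrite mxE.
Qed.

(** By Cramer's formula, every entry of the inverse is a quotient of determinants. *)
Lemma Ckle_gauss_jac_inv k i j : Ckle k (nonzero n) (fun z => invmx (J z) i j).
Proof.
apply: (@Ckle_ext _ _ k _ (fun z => (\det (J z))^-1 * ((-1) ^+ (j + i) * \det (row' j (col' i (J z)))))) => //.
  apply: CkleM => //.
    apply: CkleV => //; last by apply: Ckle_det => // a b; exact: Ckle_gauss_jac.
    by move=> z z0; rewrite -unitfE -unitmxE gauss_jac_unit.
  apply: CkleM => //; first exact: Ckle_cst.
  apply: Ckle_det => // a b.
  apply: (@Ckle_ext _ _ k _ (fun z => J z (lift j a) (lift i b))) => //.
    exact: Ckle_gauss_jac.
  by move=> z _; rewrite !mxE.
by move=> z z0; rewrite /invmx gauss_jac_unit// !mxE.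
Qed.

(** The derivative of the offset is J^-1 evaluated at the offset, so each order of smoothness of the
    offset yields the next. *)
Lemma Ckle_offset k j : Ckle k outside (fun y => offset K y 0 j).
Proof.
have oO := open_outside.
elim: k j => [|k IH] j.
  apply/Ckle0 => x _.
  have cj : continuous (fun M : 'rV[R]_n => M 0 j) by exact: coord_continuous.
  exact: (@continuous_comp _ _ _ (offset K) (fun M : 'rV[R]_n => M 0 j) x (@continuous_offset x) (cj _)).
apply/CkleS; split; first by move=> x Ox; exact: (Ckle_continuous (IH j) Ox).
move=> i; split.
  by move=> x Ox; exact: (@ex_derive _ _ _ _ _ _ _ (is_derive_offset (e_ i) j Ox)).
apply: (@Ckle_ext _ _ k _ (fun y => invmx (J (offset K y)) i j)) => //.
  by apply: (@Ckle_comp R n n k outside (nonzero n) (offset K)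
    (fun z => invmx (J z) i j) oO oN _ IH (@Ckle_gauss_jac_inv k i j)).
move=> x Ox; rewrite (@derive_val _ _ _ _ _ _ _ (is_derive_offset (e_ i) j Ox)).
by rewrite -rowE mxE.
Qed.

End Body.

(** * Boundaries of thickened bodies *)

Section Determinant.
Context {R : realType}.

Lemma continuous_det m (A : R -> 'M[R]_m) : (forall i j, continuous (fun s => A s i j)) ->
  continuous (fun s => \det (A s)).
Proof.
move=> Ac s; apply: continuous_sum_at => u _.
have c1 : {for s, continuous (fun r : R => \prod_i A r i (u i))}.
  by apply: cvg_big => [|i _]; [exact: mul_continuous|exact: Ac].
by apply: (@continuousM _ _ (fun=> (-1) ^+ u) (fun r => \prod_i A r i (u i)) s) => //; exact: cst_continuous.
Qed.

(** On the segment from the identity to [A] the quadratic form stays positive, so the matrices stay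
    invertible; by the intermediate value theorem the determinant keeps the sign it has at the
    identity. *)
Lemma det_gt0 m (A : 'M[R]_m) : (forall w, w != 0 -> 0 < dot (w *m A) w) -> 0 < \det A.
Proof.
move=> Apos; pose B (s : R) : 'M[R]_m := s *: A + (1 - s) *: 1%:M.
have Bdet s : 0 <= s <= 1 -> \det (B s) != 0.
  move=> /andP[s0 s1]; rewrite -unitfE -unitmxE; apply: unitmx_of_ker => w wB.
  apply/eqP; apply: contraT => w0.
  have : dot (w *m B s) w = s * dot (w *m A) w + (1 - s) * dot w w.
    by rewrite mulmxDr -!scalemxAr mulmx1 dotDl !dotZl.
  rewrite wB dot0l; have := Apos _ w0; have := dotxx_gt0 w0; nra.
have B0 : B 0 = 1%:M by rewrite /B scale0r add0r subr0 scale1r.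
have B1 : B 1 = A by rewrite /B scale1r subrr scale0r addr0.
have Bc : continuous (fun s => \det (B s)).
  apply: continuous_det => i j s.
  rewrite (_ : (fun s : R => _) = fun s : R => s * A i j + (1 - s) * (1%:M : 'M[R]_m) i j); last first.
    by apply/funext => r; rewrite !mxE.
  have ci : {for s, continuous (@id R)} by exact: cvg_id.
  have c1 := continuousM ci (@cst_continuous _ _ (A i j) s).
  have c2 := continuousM (continuousB (@cst_continuous _ _ (1 : R) s) ci) (@cst_continuous _ _ ((1%:M : 'M[R]_m) i j) s).
  exact: continuousD c1 c2.
rewrite ltNge; apply/negP => dA.
have := @IVT R (fun s => \det (B s)) 0 1 0 ler01 (continuous_subspaceT Bc).
rewrite B0 B1 det1 => /(_ _)/wrap[].
  by rewrite ge_min le_max dA ler01 orbT.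
move=> [c]; rewrite in_itv => /Bdet /eqP; exact.
Qed.

(** The Householder reflection exchanging [u] with the last basis vector has [u] as its last row;
    the other rows are the basis. If [u] is that vector, the reflection degenerates and the identity
    matrix is used. *)
Lemma exists_tangent_basis m (u : 'rV[R]_m.+1) : enorm u = 1 ->
  exists e : 'M[R]_(m, m.+1), e *m e^T = 1%:M /\ forall i, dot (row i e) u = 0.
Proof.
move=> u1.
suff [H [HH Hu]] : exists H : 'M[R]_m.+1, H *m H^T = 1%:M /\ row ord_max H = u.
  have Hij i j : dot (row i H) (row j H) = (i == j)%:R.
    have := congr1 (fun A : 'M[R]_m.+1 => A i j) HH.
    rewrite !mxE => <-; by apply: eq_bigr => k _; rewrite !mxE.
  exists (row' ord_max H); split.
    apply/matrixP => i j; rewrite !mxE.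
    have := Hij (lift ord_max i) (lift ord_max j).
    rewrite (inj_eq lift_inj) => <-; by apply: eq_bigr => k _; rewrite !mxE.
  move=> i; rewrite -Hu; have := Hij (lift ord_max i) ord_max.
  rewrite [_ == ord_max]eq_sym (negbTE (neq_lift _ _)) => E; rewrite -[RHS](mulr0n 1) -E; by apply: eq_bigr => k _; rewrite !mxE.
pose d : 'rV[R]_m.+1 := delta_mx 0 ord_max.
have uu : dot u u = 1 by rewrite -enorm_sqr u1 expr1n.
have dd : dot d d = 1 by rewrite /d dot_delta mxE !eqxx.
have [->|ud] := eqVneq u d.
  by exists 1%:M; rewrite trmx1 mulmx1 rowE mulmx1.
have [w wE] : exists w : 'rV[R]_m.+1, w = u - d by exists (u - d).
have w0 : 0 < dot w w by rewrite dotxx_gt0// wE subr_eq0.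
have ww : dot w w = 2 - 2 * dot u d.
  by rewrite wE dotBl !dotBr uu dd (dotC d u); ring.
pose H : 'M[R]_m.+1 := 1%:M - (2 / dot w w) *: (w^T *m w).
have HT : H^T = H by rewrite /H linearB/= trmx1 linearZ/= trmx_mul trmxK.
have vH (v : 'rV[R]_m.+1) : v *m H = v - (2 * dot v w / dot w w) *: w.
  rewrite /H mulmxBr mulmx1 -scalemxAr mulmxA; congr (_ - _).
  rewrite [v *m w^T]mx11_scalar -dotE mul_scalar_mx scalerA.
  by congr (_ *: _); rewrite mulrAC.
exists H; split.
  rewrite HT; apply/row_matrixP => i; rewrite !rowE mulmxA mulmx1.
  move: (delta_mx 0 i) => v; rewrite !vH dotBl dotZl.
  rewrite divfK ?gt_eqF// -addrA -opprD -scalerDl.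
  have -> : 2 * dot v w / dot w w + 2 * (dot v w - 2 * dot v w) / dot w w = 0 by field; rewrite gt_eqF.
  by rewrite scale0r subr0.
rewrite rowE -/d vH.
have -> : 2 * dot d w / dot w w = -1.
  have -> : dot d w = - (dot w w / 2) by rewrite ww wE dotBr dd (dotC d u); field.
  by field; rewrite gt_eqF.
by rewrite scaleN1r opprK wE addrC subrK.
Qed.

End Determinant.

Section SmoothMaps.
Context {R : realType} {n m : nat}.

Lemma smooth_on_rV (U : set 'rV[R]_n) (f : 'rV[R]_n -> 'rV[R]_m) : open U ->
  (forall k j, Ckle k U (fun x => f x 0 j)) -> smooth_on U f.
Proof.
move=> oU fs k; have {fs} : forall j, Ckle k U (fun x => f x 0 j) by [].
elim: k f => [|k IH] f fk.
  move=> x /set_mem Ux; apply: continuous_rV_at => j.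
  exact: (Ckle_continuous (fk j) Ux).
move=> i; have df x : U x -> derivable f x (delta_mx 0 i).
  by move=> Ux; apply/derivable_mxP => a b; rewrite ord1; exact: (Ckle_derivable (fk b) Ux).
split => //; apply: IH => j.
apply: (Ckle_ext oU (Ckle_derive i (fk j))) => x Ux.
by rewrite (derive_mx (df x Ux)) mxE.
Qed.

End SmoothMaps.

(** * Smoothness and positive curvature of the parallel body *)

Section SmoothBody.
Context {R : realType} {m : nat}.
Notation n := m.+1.
Implicit Types (x y z v w p q : 'rV[R]_n).
Variables (h : 'rV[R]_n -> R) (t : R).
Hypothesis hsub : sublinear h.
Hypothesis hs : forall k, Ckle k (nonzero n) h.
Hypothesis t0 : 0 < t.

Definition thicken v := h v + t * enorm v.
Let K := body h.
Let C := body thicken.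
Let N := offset K.
Let oN := @open_nonzero R n.
Let n0 : (0 < n)%N := isT.
Let cK : compact K := @compact_body _ _ h.
Let vK : convex K := @convex_body_of _ _ h.
Let K0 : K !=set0 := body_nonempty hsub hs n0.
Let dproj x : dot x (N x) = h (N x) + enorm (N x) ^+ 2.
Proof.
rewrite enorm_sqr -(support_fun_body hsub hs n0) (support_fun_offset _ K0 cK vK).
by rewrite -dotDl /N /offset [proj K x + _]addrC subrK.
Qed.
Let cN : continuous N := @continuous_offset _ _ h hsub hs n0.
Let cnN : continuous (fun x => enorm (N x)).
Proof. by move=> x; apply: continuous_comp; [exact: cN|exact: continuous_enorm]. Qed.

Lemma sublinear_thicken : sublinear thicken.
Proof.
by apply: sublinearD => //; apply: sublinearZ (ltW t0) _; exact: sublinear_enorm.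
Qed.

(** The single direction N x detects the distance, since <x, N x> = h (N x) + |N x|^2. Conversely, x
    is a point of K plus N x. *)
Lemma mem_thicken x : C x <-> enorm (N x) <= t.
Proof.
split=> [/(_ (N x))|Nx v].
  rewrite dproj /thicken lerD2l expr2.
  have : 0 <= enorm (N x) by exact: enorm_ge0.
  rewrite le_eqVlt => /orP[/eqP <- _|e0]; first exact: ltW.
  by rewrite ler_pM2r.
have [Kp _] := projP x K0 cK vK.
have -> : x = proj K x + N x by rewrite /N /offset addrC subrK.
rewrite dotDl; apply: lerD; first exact: Kp.
apply: le_trans (dot_CauchySchwarz _ _) _.
by rewrite ler_wpM2r// enorm_ge0.
Qed.

Let open_inner : open [set x | enorm (N x) < t].
Proof.
rewrite (_ : [set x | _] = (fun x => enorm (N x)) @^-1` [set r | r < t])//.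
by apply: open_comp => // x _; exact: cnN.
Qed.

Lemma boundary_thicken x : boundary C x <-> enorm (N x) = t.
Proof.
have clC : closure C = C by apply/esym/closure_id; exact: closed_body.
rewrite /boundary /setD/= clC; split=> [[/mem_thicken Nx Cx]|Nx].
  apply/eqP; rewrite eq_le Nx/= leNgt; apply/negP => Nxt; apply: Cx.
  rewrite /interior; apply: (@filterS _ _ _ [set y | enorm (N y) < t]).
    by move=> y /ltW ?; exact/mem_thicken.
  by apply: open_nbhs_nbhs; split => //; exact: open_inner.
split; first by apply/mem_thicken; rewrite Nx.
rewrite /interior => /nbhs_ballP[e /= e0 he].
have c0 : 0 < `|N x| + 1 by rewrite ltr_wpDl.
(* Small enough for x + s N x to stay in the ball of radius [e], although it violates the inequality
   of [C] in the direction N x. *)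
pose s := e / 2 / (`|N x| + 1).
have s0 : 0 < s by rewrite !divr_gt0.
have : C (x + s *: N x).
  apply: he; rewrite -ball_normE/= opprD addrA subrr sub0r normrN normrZ gtr0_norm//.
  apply: (@le_lt_trans _ _ (s * (`|N x| + 1))); first by rewrite ler_wpM2l ?ltW// ltrDl.
  by rewrite /s divfK ?gt_eqF// ltr_pdivrMr// ltr_pMr// ltr1n.
move=> /(_ (N x)); rewrite dotDl dproj dotZl -enorm_sqr /thicken Nx -addrA lerD2l -expr2 gerDl.
by rewrite leNgt mulr_gt0// exprn_gt0.
Qed.

Let outU : open [set x | N x != 0] := @open_outside _ _ h hsub hs n0.
Let CkN k j : Ckle k [set x | N x != 0] (fun x => N x 0 j) := @Ckle_offset _ _ h hsub hs n0 k j.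
Notation Psi := (gauss_inv h).
Let NPsi z : z != 0 -> N (Psi z) = z := @offset_gauss_inv _ _ h hsub hs n0 z.
Let PsiN x : N x != 0 -> Psi (N x) = x := @gauss_inv_offset _ _ h hsub hs n0 x.

Lemma convex_body_thicken : convex_body C.
Proof.
split; [exact: compact_body|exact: convex_body_of|].
have [p Kp] := K0; exists p; rewrite /interior; apply: (@filterS _ _ _ [set y | enorm (N y) < t]).
  by move=> y /ltW ?; exact/mem_thicken.
apply: open_nbhs_nbhs; split => /=; first exact: open_inner.
have -> : N p = 0 by apply/eqP; rewrite /N offset_eq0//; exact/asboolP.
by rewrite enorm0.
Qed.

Let Ck_sqr_sum k (U : set 'rV[R]_n) (P : pred 'I_n) (f : 'I_n -> 'rV[R]_n -> R) : open U ->
  (forall i, Ckle k U (f i)) -> Ckle k U (fun x => \sum_(i < n | P i) f i x ^+ 2).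
Proof. by move=> oU fk; apply: Ckle_sum => // i _; apply: CkleM. Qed.

(** Near p some coordinate i0 of N is nonzero. The chart keeps the other coordinates of N and
    replaces this one by |N|^2 - t^2; the transposition [tau] moves it to the last slot, the only
    one that has to vanish. The inverse chart recovers N and applies the inverse Gauss map. *)
Lemma submanifold_thicken : smooth_submanifold m (boundary C).
Proof.
move=> p /boundary_thicken Np.
have Np0 : N p != 0 by rewrite -enorm_gt0 Np.
have [i0 pi0] : exists i0, N p 0 i0 != 0.
  apply/existsP; apply: contraT; rewrite negb_exists => /forallP Nz.
  move: Np0; rewrite (_ : N p = 0) ?eqxx//; apply/rowP => i; rewrite [RHS]mxE.
  by apply/eqP; have := Nz i; rewrite negbK.
pose sg := Num.sg (N p 0 i0).
have sg2 : sg * sg = 1 by rewrite -expr2 sqr_sg pi0.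
pose tau := tperm i0 ord_max.
have tau0 : tau i0 = ord_max by rewrite tpermL.
have tau1 : tau ord_max = i0 by rewrite tpermR.
have tauK i : tau (tau i) = i by rewrite tpermK.
pose U := [set x | 0 < sg * N x 0 i0].
(* In the chart, the square of the coordinate i0 of N, recovered from |N|^2 and the other
   coordinates; [sg] fixes the sign of its root. *)
pose rad (y : 'rV[R]_n) := y 0 ord_max + t ^+ 2 - \sum_(i < n | i != ord_max) y 0 i ^+ 2.
pose V := [set y | 0 < rad y].
pose phi x : 'rV[R]_n := \row_i if i == ord_max then enorm (N x) ^+ 2 - t ^+ 2 else N x 0 (tau i).
pose zeta y : 'rV[R]_n := \row_j if j == i0 then sg * Num.sqrt (rad y) else y 0 (tau j).
pose psi y := Psi (zeta y).
have phiE x i : phi x 0 i = if i == ord_max then enorm (N x) ^+ 2 - t ^+ 2 else N x 0 (tau i).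
  by rewrite /phi [LHS]mxE.
have zetaE y j : zeta y 0 j = if j == i0 then sg * Num.sqrt (rad y) else y 0 (tau j).
  by rewrite /zeta [LHS]mxE.
have cj j : continuous (fun M : 'rV[R]_n => M 0 j) by exact: coord_continuous.
have oU : open U.
  rewrite (_ : U = (fun x => sg * N x 0 i0) @^-1` [set r | 0 < r])//.
  apply: open_comp; last exact: open_gt.
  move=> x _; apply: (continuousM (@cst_continuous _ _ sg x)).
  exact: (@continuous_comp _ _ _ N (fun M : 'rV[R]_n => M 0 i0) x (@cN x) (cj _ _)).
have radk k W : open W -> Ckle k W rad.
  move=> oW; apply: CkleB => //; last by apply: Ck_sqr_sum => // i; exact: Ckle_coord.
  by apply: CkleD => //; [exact: Ckle_coord|exact: Ckle_cst].
have oV : open V.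
  rewrite (_ : V = rad @^-1` [set r | 0 < r])//.
  apply: open_comp; last exact: open_gt.
  by move=> x _; exact: (Ckle_continuous (radk 0%N setT openT) I).
have UN x : U x -> N x != 0.
  by rewrite /U/= => Ux; apply: contraTneq Ux => ->; rewrite [X in _ * X]mxE mulr0 ltxx.
have zeta0 y : V y -> zeta y != 0.
  move=> Vy; apply/eqP => /rowP/(_ i0)/eqP; rewrite zetaE [X in _ == X]mxE eqxx mulf_eq0 sgr_eq0 (negbTE pi0)/=.
  by rewrite sqrtr_eq0 leNgt Vy.
have enorm_tau z : enorm z ^+ 2 = z 0 i0 ^+ 2 + \sum_(i < n | i != ord_max) z 0 (tau i) ^+ 2.
  rewrite enorm_sqr /dot (reindex_inj (@perm_inj _ tau))/= (bigD1 ord_max)//= tau1 -expr2.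
  by congr (_ + _); apply: eq_bigr => i _; rewrite expr2.
have radphi x : rad (phi x) = N x 0 i0 ^+ 2.
  rewrite /rad phiE eqxx subrK enorm_tau -addrA [X in _ + X](_ : _ = 0) ?addr0//.
  apply/eqP; rewrite subr_eq0; apply/eqP; apply: eq_bigr => i /negbTE il.
  by rewrite phiE il.
have tau_eq i : (tau i == ord_max) = (i == i0).
  by rewrite -tau0 (inj_eq (@perm_inj _ _)).
have tau_eq0 i : (tau i == i0) = (i == ord_max).
  by rewrite -tau1 (inj_eq (@perm_inj _ _)).
have zetaphi x : U x -> zeta (phi x) = N x.
  move=> Ux; apply/rowP => j; rewrite zetaE radphi; have [->|ji] := eqVneq j i0; last first.
    by rewrite phiE tau_eq (negbTE ji) tauK.
  rewrite sqrtr_sqr -[X in `|X|]mul1r -sg2 -mulrA normrM.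
  rewrite (gtr0_norm Ux) (_ : `|sg| = 1) ?mul1r ?mulrA ?sg2 ?mul1r//.
  by rewrite normr_sg pi0.
have enzeta y : V y -> enorm (zeta y) ^+ 2 = y 0 ord_max + t ^+ 2.
  move=> Vy; rewrite enorm_tau zetaE eqxx exprMn expr2 sg2 mul1r sqr_sqrtr ?(ltW Vy)//.
  rewrite /rad -addrA [X in _ + X](_ : _ = 0) ?addr0//.
  rewrite addrC; apply/eqP; rewrite subr_eq0; apply/eqP; apply: eq_bigr => i /negbTE il.
  by rewrite zetaE tau_eq0 il tauK.
exists U, V, phi, psi; split; [|split; [split|]].
- split => //; by rewrite /U/= /sg -normrEsg normr_gt0.
- apply: smooth_on_rV => // k j; rewrite /phi.
  have CkU i : Ckle k U (fun x => N x 0 i) by exact: (Ckle_sub UN (@CkN k i)).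
  have [jm|jm] := eqVneq j ord_max.
    apply: (@Ckle_ext _ _ k U (fun x => \sum_(i < n) N x 0 i ^+ 2 - t ^+ 2)) => //.
      by apply: CkleB => //; [exact: Ck_sqr_sum|exact: Ckle_cst].
    by move=> x _; rewrite phiE jm eqxx enorm_sqr; congr (_ - _); apply: eq_bigr => i _; rewrite expr2.
  apply: (Ckle_ext oU (CkU (tau j))) => x _.
  by rewrite phiE (negbTE jm).
- apply: smooth_on_rV => // k j.
  apply: (@Ckle_comp R n n k V (nonzero n) zeta (fun z => Psi z 0 j) oV oN) => //; last first.
    exact: (Ckle_gauss_inv hs).
  move=> i; have [ii|ii] := eqVneq i i0.
    apply: (@Ckle_ext _ _ k V (fun y => sg * Num.sqrt (rad y))) => //.
      by apply: CkleM => //; [exact: Ckle_cst|exact: (Ckle_sqrt oV (fun x Vx => Vx) (radk k V oV))].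
    by move=> x _; rewrite zetaE ii eqxx.
  apply: (Ckle_ext oV (@Ckle_coord R n k V (tau i))) => x _.
  by rewrite zetaE (negbTE ii).
- move=> x Ux; rewrite /V/= radphi /psi zetaphi// PsiN ?UN//; split => //.
  by rewrite exprn_even_gt0//=; apply: contraTneq Ux => E; rewrite /U/= E mulr0 ltxx.
- move=> y Vy; have z0 := zeta0 _ Vy.
  split; first by rewrite /U/= /psi NPsi// zetaE eqxx mulrA sg2 mul1r sqrtr_gt0.
  apply/rowP => i; rewrite phiE /psi NPsi//; case: eqVneq => [->|im].
    by rewrite enzeta// addrK.
  by rewrite zetaE tau_eq0 (negbTE im) tauK.
- move=> x Ux; split=> [/boundary_thicken Nx i mi|phi0].
    have -> : i = ord_max by apply/val_inj/eqP; rewrite /= eqn_leq mi -ltnS ltn_ord.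
    by rewrite phiE eqxx Nx subrr.
  apply/boundary_thicken; have := phi0 ord_max (leqnn _); rewrite phiE eqxx => /eqP.
  rewrite subr_eq0 => /eqP E; apply/eqP.
  by rewrite -(@eqrXn2 _ 2) ?enorm_ge0 ?(ltW t0)//; exact/eqP.
Qed.

(** The Gauss map is N / t, with derivative J^-1 / t. Its compression to the tangent space has a
    positive quadratic form, from which [det_gt0] gives the sign of the determinant. *)
Lemma positively_curved_thicken : positively_curved C.
Proof.
move=> p /boundary_thicken Np.
have Np0 : N p != 0 by rewrite -enorm_gt0 Np.
have tn0 : t != 0 by rewrite gt_eqF.
pose nu x := t^-1 *: N x.
have [e [eeT eu]] : exists e : 'M[R]_(m, n), e *m e^T = 1%:M /\ forall i, dot (row i e) (nu p) = 0.
  by apply: exists_tangent_basis; rewrite /nu enormZ Np gtr0_norm ?invr_gt0// mulVf.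
set J := gauss_jac h (N p).
have Dnu v : 'D_v nu p = t^-1 *: (v *m invmx J).
  have dN j := @is_derive_offset _ _ h hsub hs n0 p v j Np0.
  have dnu j : is_derive p v (fun x => nu x 0 j) (t^-1 * (v *m invmx J) 0 j).
    have H : is_derive p v (fun x => t^-1 * N x 0 j) _ := is_deriveZ t^-1 (dN j).
    apply: near_eq_is_derive H; apply: (near_eq_open openT) => // x _; by rewrite [RHS]mxE.
  rewrite derive_mx; last first.
    by apply/derivable_mxP => i j; rewrite ord1; exact: (@ex_derive _ _ _ _ _ _ _ (dnu j)).
  by apply/rowP => j; rewrite mxE (@derive_val _ _ _ _ _ _ _ (dnu j)) !mxE.
pose A : 'M[R]_m := \matrix_(i, j) dot ('D_(row i e) nu p) (row j e).
exists (\det A).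
  exists [set x | N x != 0], nu, e; split; last by split.
  split => //.
    apply: smooth_on_rV => // k j.
    apply: (@Ckle_ext _ _ k _ (fun x => t^-1 * N x 0 j)) => //; last by move=> x _; rewrite [RHS]mxE.
    by apply: CkleM => //; exact: Ckle_cst.
  move=> x Nx0 /boundary_thicken Nx; split.
    by rewrite /nu enormZ Nx gtr0_norm ?invr_gt0// mulVf.
  move=> y /(_ (N x)) Cy; rewrite /nu !dotZr ler_pM2l ?invr_gt0// dproj.
  by apply: le_trans Cy _; rewrite /thicken Nx expr2.
apply: det_gt0 => w w0.
have JU : J \in unitmx by exact: gauss_jac_unit.
(* With u = v J^-1 the form <v J^-1, v> becomes <u J, u>, to which [gauss_jac_pos] applies. *)
pose v := w *m e; pose u := v *m invmx J.
have AE : A = t^-1 *: (e *m invmx J *m e^T).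
  apply/matrixP => i j; rewrite !mxE Dnu dotZl; congr (_ * _).
  rewrite -row_mul; apply: eq_bigr => k _; by rewrite !mxE.
have u0 : u != 0.
  apply: contra w0 => /eqP u0; apply/eqP.
  have v0 : v = 0 by rewrite -[v](mulmxKV JU) -/u u0 mul0mx.
  by rewrite -[w]mulmx1 -eeT mulmxA -/v v0 mul0mx.
rewrite AE -scalemxAr dotZl mulr_gt0 ?invr_gt0//.
have -> : dot (w *m (e *m invmx J *m e^T)) w = dot u v.
  by rewrite !mulmxA [LHS]dot_mulmx trmxK.
have vE : v = u *m J by rewrite /u mulmxKV.
have -> : dot u v = dot (u *m J) u by rewrite -vE dotC.
exact: lt_le_trans (dotxx_gt0 u0) (gauss_jac_pos hsub hs u Np0).
Qed.

End SmoothBody.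

(** * Integration on the sphere *)

Section Boxes.
Context {R : realType}.

Definition box n (c : 'rV[R]_n) (r : R) : set 'rV[R]_n :=
  [set x | forall i, `|x 0 i - c 0 i| < r].

Lemma measurable_box n (c : 'rV[R]_n) r : measurable (box c r).
Proof.
have -> : box c r = \big[setI/setT]_(i < n) [set x : 'rV[R]_n | `|x 0 i - c 0 i| < r].
  rewrite -bigcap_seq; apply/seteqP; split=> x h i; first by move=> _; exact: h.
  by apply: h; rewrite /= mem_index_enum.
apply: bigsetI_measurable => i _.
rewrite (_ : [set x | _] = (fun x : 'rV[R]_n => x 0 i : measurableTypeR R) @^-1` `]c 0 i - r, c 0 i + r[).
  by rewrite -[X in measurable X]setTI; apply: measurable_coord.
by apply/seteqP; split => x /=; rewrite in_itv/= ltr_distl.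
Qed.

(** The sigma-algebra is generated by the coordinates, so an open set is exhibited as a countable
    union of boxes with rational centres and radii 1 / (m + 1), enumerated through [pickle]. *)
Lemma open_measurable_rV n (U : set 'rV[R]_n) : open U -> measurable U.
Proof.
move=> oU; pose B (k : nat) : set 'rV[R]_n := if unpickle k is Some (q, m)
  then if `[< box (map_mx ratr q) m.+1%:R^-1 `<=` U >] then box (map_mx ratr q) m.+1%:R^-1 else set0
  else set0 (T := 'rV[R]_n).
have -> : U = \bigcup_k B k.
  apply/seteqP; split => [x Ux|x [k _]]; last first.
    rewrite /B; case: unpickle => [[q m]|//]; case: asboolP => // qU.
    exact: qU.
  have /nbhs_ballP[e /= e0 xe] : nbhs x U by exact: open_nbhs_nbhs.
  have [m] : exists m : nat, m.+1%:R^-1 < e / 2.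
    have e20 : 0 < e / 2 by rewrite divr_gt0.
    exists (Num.trunc (e / 2)^-1); rewrite invf_plt ?posrE ?ltr0n//.
    exact: truncnS_gt.
  move=> me.
  have m0 : 0 < m.+1%:R^-1 :> R by rewrite invr_gt0.
  have qP i : exists q : rat, `|x 0 i - ratr q| < m.+1%:R^-1.
    have [q qI] : exists q : rat, ratr q \in `]x 0 i - m.+1%:R^-1, x 0 i + m.+1%:R^-1[.
      by apply: rat_in_itvoo; rewrite ltrBlDr -addrA ltrDl addr_gt0.
    by exists q; rewrite distrC ltr_distl; move: qI; rewrite in_itv.
  pose q : 'rV[rat]_n := \row_i xchoose (qP i).
  have xq : box (map_mx ratr q) m.+1%:R^-1 x.
    by move=> i; rewrite !mxE; exact: (xchooseP (qP i)).
  exists (pickle (q, m)) => //; rewrite /B pickleK; case: asboolP => // -[].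
  move=> y yq; apply: xe; rewrite -ball_normE/=.
  apply: (@le_lt_trans _ _ (m.+1%:R^-1 + m.+1%:R^-1)); last by rewrite [ltRHS]splitr ltrD.
  apply: norm_le_coord; first by rewrite addr_ge0// ltW.
  move=> i; rewrite !mxE -(subrK (ratr (q 0 i)) (x 0 i)) -addrA.
  apply: le_trans (ler_normD _ _) _; apply: lerD; apply: ltW.
    by have := xq i; rewrite mxE.
  by have := yq i; rewrite mxE distrC.
apply: bigcupT_measurable => k; rewrite /B; case: unpickle => [[q m]|//].
by case: ifP => _ //; exact: measurable_box.
Qed.

Lemma continuous_measurable_rV n (f : 'rV[R]_n -> R) : continuous f ->
  measurable_fun setT (f : 'rV[R]_n -> measurableTypeR R).
Proof.
move=> cf; apply: (measurability _ (RGenOpens.measurableE R)) => //= _ [_ [a [b ->] <-]].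
rewrite setTI; apply: open_measurable_rV; apply: open_comp; last exact: interval_open.
by move=> x _; exact: cf.
Qed.

Lemma rV_lebesgue_box n (c : 'rV[R]_n) r : 0 < r -> rV_lebesgue n (box c r) = ((r *+ 2) ^+ n)%:E.
Proof.
move=> r0; elim: n c => [|n IH] c.
  rewrite /= (_ : box c r = setT); first by rewrite diracE mem_set.
  by apply/seteqP; split => // x _ [].
rewrite /= /rV_cons_measure /pushforward.
have -> : @rV_cons R n @^-1` (box c r) =
    `]c 0 0 - r, c 0 0 + r[%classic `*` box (\row_i c 0 (lift 0 i)) r.
  apply/seteqP; split => -[a v] /=.
    move=> h; split => /=; first by have := h 0; rewrite rV_cons0 /= ltr_distl in_itv.
    by move=> i; have := h (lift 0 i); rewrite rV_cons_lift mxE.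
  move=> [/= ha hv] i; case: (unliftP 0 i) => [j|] ->.
    by rewrite rV_cons_lift; have := hv j; rewrite mxE.
  by rewrite rV_cons0 /= ltr_distl; move: ha; rewrite in_itv.
rewrite product_measure1E//; last exact: measurable_box.
rewrite IH [X in (X * _)%E](lebesgue_measure_itv `]c 0 0 - r, c 0 0 + r[)/= lte_fin ltrBlDr -addrA ltrDl addr_gt0//.
rewrite -EFinB -EFinM exprS; congr (_ * _)%:E; ring.
Qed.

End Boxes.

(** * Moments of functions on the sphere and recentring *)

Section SphereIntegral.
Context {R : realType} {m : nat}.
Notation n := m.+1.
Implicit Types (phi psi : 'rV[R]_n -> R) (u v a x : 'rV[R]_n).

Lemma rV_lebesgue_eball_fin : (rV_lebesgue n (eball n : set 'rV[R]_n) < +oo)%E.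
Proof.
apply: (@le_lt_trans _ _ (rV_lebesgue n (box (0 : 'rV[R]_n) 2))).
  apply: le_measure; rewrite ?inE; [exact: measurable_eball|exact: measurable_box|].
  move=> x /= x1 i; rewrite mxE subr0; apply: le_lt_trans (coord_le_enorm _ _) _.
  by apply: le_lt_trans x1 _; rewrite ltr1n.
by rewrite rV_lebesgue_box// ltry.
Qed.

Lemma box_eball (c : 'rV[R]_n) r : 0 <= r -> enorm c + Num.sqrt n%:R * r <= 1 -> box c r `<=` eball n.
Proof.
move=> r0 cr x xb; apply: le_trans cr; rewrite -{1}(subrK c x) addrC.
apply: le_trans (enormD _ _) _; rewrite [leLHS]/= lerD2l.
apply: le_trans (enorm_le_norm _) _; rewrite ler_wpM2l ?sqrtr_ge0//.
by apply: norm_le_coord => // i; rewrite !mxE ltW.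
Qed.

Let sn0 : 0 < Num.sqrt n%:R :> R. Proof. by rewrite sqrtr_gt0 ltr0n. Qed.

Lemma rV_lebesgue_eball_gt0 : 0 < fine (rV_lebesgue n (eball n : set 'rV[R]_n)).
Proof.
apply: fine_gt0; rewrite rV_lebesgue_eball_fin andbT.
pose r : R := (Num.sqrt n%:R)^-1; have r0 : 0 < r by rewrite invr_gt0.
apply: (@lt_le_trans _ _ (rV_lebesgue n (box (0 : 'rV[R]_n) r))).
  by rewrite rV_lebesgue_box// lte_fin exprn_gt0// pmulrn_lgt0.
apply: le_measure; rewrite ?inE; [exact: measurable_box|exact: measurable_eball|].
by apply: box_eball; [exact: ltW|rewrite enorm0 add0r divff// gt_eqF].
Qed.

Notation S := (esphere n : set 'rV[R]_n).
Notation sigma := (@sphere_measure R n).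

Lemma measurable_esphere : measurable S.
Proof.
rewrite (_ : S = setT `&` @enorm R n @^-1` [set 1]); last by rewrite setTI.
exact: measurable_enorm.
Qed.

Lemma sphere_measure_le (E : set 'rV[R]_n) : measurable E -> (sigma E < +oo)%E.
Proof.
move=> mE; rewrite /sphere_measure /mscale/= lte_mul_pinfty// /cone_measure /pushforward /mrestr.
apply: le_lt_trans rV_lebesgue_eball_fin; apply: le_measure; rewrite ?inE.
- apply: measurableI; last exact: measurable_eball.
  by rewrite -[X in measurable X]setTI; exact: measurable_normalize.
- exact: measurable_eball.
- by move=> x [].
Qed.

Lemma compact_esphere : compact S.
Proof.
apply: bounded_closed_compact.
  exists 1; split; first by rewrite num_real.
  move=> r r1 x /= x1; apply: le_trans (norm_le_enorm _) _; by rewrite x1 ltW.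
rewrite (_ : S = @enorm R n @^-1` [set 1])//; apply: closed_comp; last exact: closed_eq.
by move=> x _; exact: continuous_enorm.
Qed.

Lemma esphere_nonempty : S !=set0.
Proof.
exists (delta_mx 0 0); rewrite /esphere/= /enorm dot_delta mxE !eqxx.
by rewrite sqrtr1.
Qed.

Lemma integrable_esphere phi : continuous phi -> sigma.-integrable S (EFin \o phi).
Proof.
move=> cphi; apply: measurable_bounded_integrable; first exact: measurable_esphere.
- exact: (sphere_measure_le measurable_esphere).
- by apply: measurable_funS (continuous_measurable_rV cphi).
- have cn : continuous (fun x => `|phi x|).
    by move=> x; apply: continuous_comp; [exact: cphi|exact: norm_continuous].
  have [c _ cmax] := EVT_max_rV esphere_nonempty compact_esphere (continuous_subspaceT cn).
  exists `|phi c|; split; first by rewrite num_real.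
  by move=> r cr x Sx; apply: le_trans (ltW cr); apply: cmax; exact: mem_set.
Qed.

(** For a support function, the coordinate i of the Steiner point times the volume of the ball. *)
Definition sphere_moment (i : 'I_n) phi : R := \int[sigma]_(u in S) (u 0 i * phi u).

Let continuous_coordM i phi : continuous phi -> continuous (fun u : 'rV[R]_n => u 0 i * phi u).
Proof.
move=> cphi x; have ci : continuous (fun M : 'rV[R]_n => M 0 i) by exact: coord_continuous.
exact: (continuousM (ci x) (cphi x)).
Qed.

Lemma sphere_momentB i phi psi : continuous phi -> continuous psi ->
  sphere_moment i (fun u => phi u - psi u) = sphere_moment i phi - sphere_moment i psi.
Proof.
move=> cphi cpsi; rewrite /sphere_moment -RintegralB.
- by apply: eq_Rintegral => u _; rewrite mulrBr.
- exact: measurable_esphere.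
- exact/integrable_esphere/continuous_coordM.
- exact/integrable_esphere/continuous_coordM.
Qed.

Lemma sphere_momentD i phi psi : continuous phi -> continuous psi ->
  sphere_moment i (fun u => phi u + psi u) = sphere_moment i phi + sphere_moment i psi.
Proof.
move=> cphi cpsi; rewrite /sphere_moment -RintegralD.
- by apply: eq_Rintegral => u _; rewrite mulrDr.
- exact: measurable_esphere.
- exact/integrable_esphere/continuous_coordM.
- exact/integrable_esphere/continuous_coordM.
Qed.

Lemma sphere_momentZ i (c : R) phi : continuous phi ->
  sphere_moment i (fun u => c * phi u) = c * sphere_moment i phi.
Proof.
move=> cphi; rewrite /sphere_moment -RintegralZl.
- by apply: eq_Rintegral => u _; rewrite mulrCA.
- exact: measurable_esphere.
- exact/integrable_esphere/continuous_coordM.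
Qed.

Definition sphere_area : R := fine (sigma S).

Lemma sphere_area_ge0 : 0 <= sphere_area.
Proof. exact: fine_ge0. Qed.

Lemma sphere_moment_le i phi (r : R) : continuous phi -> (forall u, S u -> `|phi u| <= r) ->
  `|sphere_moment i phi| <= r * sphere_area.
Proof.
move=> cphi phir; apply: le_trans (le_normr_Rintegral _ _) _.
- exact: measurable_esphere.
- exact/integrable_esphere/continuous_coordM.
rewrite -Rintegral_cst; last exact: measurable_esphere.
have cn : continuous (fun u : 'rV[R]_n => `|u 0 i * phi u|).
  move=> x; exact: (@continuous_comp _ _ _ (fun u => u 0 i * phi u) Num.norm x (@continuous_coordM i phi cphi x) (@norm_continuous _ _ _)).
apply: le_Rintegral.
- exact: measurable_esphere.
- exact: integrable_esphere.
- by apply: integrable_esphere => x; exact: cst_continuous.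
- move=> u Su; rewrite normrM -[leRHS]mul1r.
  apply: ler_pM => //; last exact: phir.
  by rewrite -Su coord_le_enorm.
Qed.

Lemma eq_sphere_moment i phi psi : (forall u, S u -> phi u = psi u) ->
  sphere_moment i phi = sphere_moment i psi.
Proof. by move=> e; apply: eq_Rintegral => u /set_mem/e ->. Qed.

Definition sphere_gram : 'M[R]_n := \matrix_(i, j) sphere_moment i (fun u => u 0 j).

Let continuous_coord_rV i : continuous (fun u : 'rV[R]_n => u 0 i).
Proof. exact: coord_continuous. Qed.

Lemma sphere_moment_dot a i : sphere_moment i (fun u => dot u a) = (a *m sphere_gram^T) 0 i.
Proof.
rewrite mxE; have H (s : seq 'I_n) : sphere_moment i (fun u => \sum_(j <- s) u 0 j * a 0 j) =
    \sum_(j <- s) a 0 j * sphere_gram^T j i.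
  elim: s => [|j s IH].
    rewrite big_nil /sphere_moment (@eq_Rintegral _ _ _ _ _ (fun=> 0)); last first.
      by move=> u _; rewrite big_nil mulr0.
    rewrite Rintegral_cst ?mul0r//; exact: measurable_esphere.
  have cs : continuous (fun u : 'rV[R]_n => \sum_(j <- s) u 0 j * a 0 j).
    move=> x; apply: continuous_sum_at => k _.
    exact: (continuousM (@continuous_coord_rV k x) (@cst_continuous _ _ (a 0 k) x)).
  rewrite big_cons -IH !mxE -sphere_momentZ// -sphere_momentD//.
    by apply: eq_sphere_moment => u _; rewrite big_cons mulrC.
  by move=> x; exact: (continuousM (@cst_continuous _ _ (a 0 j) x) (@continuous_coord_rV j x)).
exact: H.
Qed.

(** If the integral were zero, <u, a> would vanish for almost every direction u. By the definition
    of the cone measure it is enough to find a set of positive volume in the ball whose directions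
    all satisfy <u, a> > 0; a small box around a multiple of a does it. *)
Lemma sphere_quad_gt0 a : a != 0 -> 0 < \int[sigma]_(u in S) (dot u a ^+ 2).
Proof.
move=> a0; have ca : continuous (fun u => dot u a ^+ 2).
  by move=> x; exact: (continuousM (@continuous_dot _ _ a x) (@continuous_dot _ _ a x)).
rewrite lt_neqAle Rintegral_ge0 ?andbT; last by move=> u _; exact: sqr_ge0.
apply/eqP => /esym I0.
have ia := integrable_esphere ca.
have mS := measurable_esphere.
have : (\int[sigma]_(u in S) `|(dot u a ^+ 2)%:E| = 0)%E.
  have -> : (\int[sigma]_(u in S) `|(dot u a ^+ 2)%:E| = \int[sigma]_(u in S) (dot u a ^+ 2)%:E)%E.
    by apply: eq_integral => u _; rewrite gee0_abs// lee_fin sqr_ge0.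
  by rewrite -[LHS]fineK ?(integrable_fin_num mS ia)// -/(Rintegral _ _ _) I0.
move=> /ae_eq_integral_abs -/(_ mS).
case; first by apply: measurable_int ia.
move=> N [mN N0 SN].
pose E := [set u | S u /\ dot u a != 0].
have aE : 0 < enorm a by rewrite enorm_gt0.
(* The centre [c] has norm 1/2 and the box stays within 1/4 of it: inside the ball, and on the
   positive side of [a]. *)
pose r : R := (Num.sqrt n%:R)^-1 / 4.
have r0 : 0 < r by rewrite divr_gt0 ?invr_gt0.
have snr : Num.sqrt n%:R * r = 4^-1 by rewrite /r mulrA divff ?gt_eqF// mul1r.
pose c : 'rV[R]_n := (2 * enorm a)^-1 *: a.
have ec : enorm c = 2^-1.
  rewrite /c enormZ gtr0_norm ?invr_gt0 ?mulr_gt0// invfM -mulrA mulVf ?gt_eqF//.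
  by rewrite mulr1.
have bE x : box c r x -> E (normalize x) /\ eball n x.
  move=> xb; have xB : eball n x.
    by apply: (box_eball (ltW r0) _ xb); rewrite ec snr; lra.
  have xa : 0 < dot x a.
    have h1 : dot c a = enorm a / 2.
      by rewrite /c dotZl -enorm_sqr; field; rewrite gt_eqF.
    have h2 : `|dot (x - c) a| <= 4^-1 * enorm a.
      apply: le_trans (ler_norm_dot _ _) _; rewrite ler_wpM2r ?enorm_ge0// -snr.
      apply: le_trans (enorm_le_norm _) _; rewrite ler_wpM2l ?sqrtr_ge0//.
      apply: norm_le_coord (ltW r0) _ => i.
      by rewrite [in leLHS]mxE [X in _ + X]mxE ltW// xb.
    have := ler_norm (- dot (x - c) a); rewrite normrN => h3.
    have : dot x a = dot (x - c) a + dot c a by rewrite -dotDl subrK.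
    by move: h1 h2 h3 aE; lra.
  have x0 : x != 0 by apply: contraTneq xa => ->; rewrite dot0l ltxx.
  have ex0 : 0 < enorm x by rewrite enorm_gt0.
  split => //; rewrite /normalize; split.
    by rewrite /esphere/= enormZ gtr0_norm ?invr_gt0// mulVf ?gt_eqF.
  by rewrite dotZl mulf_neq0 ?invr_eq0 ?gt_eqF.
have EN : E `<=` N.
  by move=> u [Su ua]; apply: SN => /= /(_ Su) [] /eqP; rewrite sqrf_eq0 (negbTE ua).
have : (0 < sigma N)%E; last by rewrite N0 ltxx.
rewrite /sphere_measure /mscale/= mule_gt0 ?lte_fin ?ltr0n//.
rewrite /cone_measure /pushforward /mrestr.
apply: (@lt_le_trans _ _ (rV_lebesgue n (box c r))).
  by rewrite rV_lebesgue_box// lte_fin exprn_gt0// pmulrn_lgt0.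
apply: le_measure; rewrite ?inE; first exact: measurable_box.
- apply: measurableI; last exact: measurable_eball.
  by rewrite -[X in measurable X]setTI; exact: measurable_normalize.
- by move=> x /bE[/EN].
Qed.

(** A vector a in the kernel makes the integral of <u, a>^2 vanish, so positivity gives a = 0. *)
Lemma sphere_gram_unit : sphere_gram^T \in unitmx.
Proof.
apply: unitmx_of_ker => a aG; apply/eqP; apply: contraT => /sphere_quad_gt0.
have cd : continuous (fun u : 'rV[R]_n => dot u a) by exact: continuous_dot.
suff -> : \int[sigma]_(u in S) (dot u a ^+ 2) = 0 by rewrite ltxx.
have H (s : seq 'I_n) : \int[sigma]_(u in S) ((\sum_(i <- s) u 0 i * a 0 i) * dot u a) = 0.
  have mS := measurable_esphere.
  elim: s => [|i s IH].
    rewrite (@eq_Rintegral _ _ _ _ _ (fun=> 0)) ?Rintegral_cst ?mul0r//.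
    by move=> u _; rewrite big_nil mul0r.
  have cs : continuous (fun u : 'rV[R]_n => (\sum_(j <- s) u 0 j * a 0 j) * dot u a).
    move=> x; apply: (@continuousM _ _ (fun u => \sum_(j <- s) u 0 j * a 0 j) _ x); last exact: cd.
    apply: continuous_sum_at => k _.
    exact: (continuousM (@continuous_coord_rV k x) (@cst_continuous _ _ (a 0 k) x)).
  have ci : continuous (fun u : 'rV[R]_n => u 0 i * (a 0 i * dot u a)).
    apply: continuous_coordM => x; exact: (continuousM (@cst_continuous _ _ (a 0 i) x) (cd x)).
  transitivity (sphere_moment i (fun u => a 0 i * dot u a) +
      \int[sigma]_(u in S) ((\sum_(i <- s) u 0 i * a 0 i) * dot u a)).
    rewrite /sphere_moment -RintegralD//; [|exact: integrable_esphere|exact: integrable_esphere].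
    by apply: eq_Rintegral => u _; rewrite big_cons mulrDl mulrA.
  by rewrite IH sphere_momentZ// sphere_moment_dot aG mxE mulr0 addr0.
rewrite -[RHS](H (index_enum _)); apply: eq_Rintegral => u _.
by rewrite expr2.
Qed.

Lemma continuous_support_fun (D : set 'rV[R]_n) : D !=set0 -> compact D -> continuous (support_fun D).
Proof.
move=> D0 cD; have [M M0 DM] := compact_enorm_bounded cD.
have H u v : support_fun D u - support_fun D v <= M * enorm (u - v).
  rewrite lerBlDr; apply: support_fun_le => // x Dx.
  rewrite -[u](subrK v) dotDr; apply: lerD; last exact: support_fun_ub.
  rewrite subrK; apply: le_trans (dot_CauchySchwarz _ _) _.
  by rewrite ler_wpM2r ?enorm_ge0// DM.
apply: (@cvg_norm_lipschitz R _ _ _ (M * Num.sqrt n%:R)) => u v.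
apply: (@le_trans _ _ (M * enorm (u - v))); last first.
  by rewrite -mulrA ler_wpM2l// enorm_le_norm.
by rewrite ler_norml lerNl opprB {1}enormB !H.
Qed.

Lemma steiner_point_eq0 (D : set 'rV[R]_n) : steiner_point D = 0 <->
  forall i, sphere_moment i (support_fun D) = 0.
Proof.
rewrite /steiner_point; split=> [/eqP|S0]; last first.
  by apply/rowP => i; rewrite !mxE; rewrite /sphere_moment in S0; rewrite S0 mulr0.
rewrite scaler_eq0 invr_eq0 gt_eqF ?rV_lebesgue_eball_gt0//= => /eqP/rowP S0 i.
by have := S0 i; rewrite !mxE.
Qed.

(* The translation vector that moves the Steiner point of the body with support
   function [phi] to the origin. *)
Definition recentre phi : 'rV[R]_n :=
  - (\row_i sphere_moment i phi *m invmx sphere_gram^T).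

Lemma sphere_moment_recentre phi i : continuous phi ->
  sphere_moment i (fun u => phi u + dot u (recentre phi)) = 0.
Proof.
move=> cphi; rewrite sphere_momentD//; last exact: continuous_dot.
rewrite sphere_moment_dot /recentre mulNmx mulmxKV ?sphere_gram_unit//.
by rewrite !mxE subrr.
Qed.

Lemma recentre_eq0 phi : (forall i, sphere_moment i phi = 0) -> recentre phi = 0.
Proof.
move=> p0; rewrite /recentre; have -> : \row_i sphere_moment i phi = 0 :> 'rV[R]_n.
  by apply/rowP => i; rewrite !mxE.
by rewrite mul0mx oppr0.
Qed.

Lemma recentre_lipschitz : exists2 C : R, 0 <= C & forall phi psi r, continuous phi -> continuous psi ->
  (forall u, S u -> `|phi u - psi u| <= r) -> enorm (recentre phi - recentre psi) <= C * r.
Proof.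
pose G := invmx sphere_gram^T.
pose M := \sum_(i < n) \sum_(j < n) `|G i j|.
have M0 : 0 <= M by apply: sumr_ge0 => i _; apply: sumr_ge0.
exists (Num.sqrt n%:R * (sphere_area * M)).
  by rewrite !mulr_ge0 ?sqrtr_ge0 ?sphere_area_ge0.
move=> phi psi r cphi cpsi phir.
have r0 : 0 <= r by have [u Su] := esphere_nonempty; apply: le_trans (phir u Su).
apply: le_trans (enorm_le_norm _) _; rewrite -mulrA ler_wpM2l ?sqrtr_ge0//.
apply: norm_le_coord; first by rewrite !mulr_ge0 ?sphere_area_ge0.
move=> j; rewrite /recentre opprK addrC -mulmxBl mxE.
apply: le_trans (ler_norm_sum _ _ _) _.
apply: (@le_trans _ _ (\sum_(i < n) r * sphere_area * `|G i j|)).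
  apply: ler_sum => i _; rewrite normrM ler_wpM2r// !mxE -sphere_momentB//.
  apply: sphere_moment_le; last by move=> u Su; rewrite distrC phir.
  by move=> x; apply: continuousB; [exact: cpsi|exact: cphi].
rewrite -mulr_sumr [leRHS]mulrC mulrA ler_wpM2l ?mulr_ge0 ?sphere_area_ge0//.
rewrite /M; apply: ler_sum => i _.
by rewrite (bigD1 j)//= lerDl sumr_ge0.
Qed.

End SphereIntegral.

(** * Trivial isotropy *)

Section Isotropy.
Context {R : realType} {m : nat}.
Notation n := m.+2.
Implicit Types (f h : 'rV[R]_n -> R) (u v w x b : 'rV[R]_n) (g : 'M[R]_n).

Lemma exists_orthogonal v : exists2 w, w != 0 & dot w v = 0.
Proof.
have [v0|v0] := eqVneq (v 0 0) 0.
  exists (delta_mx 0 0); last by rewrite dotC dot_delta.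
  by apply/eqP => /rowP/(_ 0)/eqP; rewrite !mxE !eqxx oner_eq0.
exists (v 0 1 *: delta_mx 0 0 - v 0 0 *: delta_mx 0 1).
  by apply: contra v0 => /eqP/rowP/(_ 1); rewrite !mxE/= mulr0 mulr1 sub0r => /eqP; rewrite oppr_eq0.
by rewrite dotBl !dotZl !(dotC _ v) !dot_delta mulrC subrr.
Qed.

(** The zero set is continued along the line from a point near [u] to [v]. Smoothness is available
    only off the origin, so the line has to avoid it. *)
Lemma regular_identity f u v : regular f -> u != 0 -> v != 0 ->
  (\forall x \near u, f x = 0) -> f v = 0.
Proof.
move=> [fs fa] u0 v0 /nbhs_ballP[e /= e0 fe].
have {}fe x : `|x - u| < e -> f x = 0.
  by move=> xe; apply: fe; rewrite -ball_normE/= distrC.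
have [w w0 wv] := exists_orthogonal v.
have w0' : 0 < `|w| by rewrite normr_gt0.
(* [u] is moved off the hyperplane orthogonal to [w], which contains [v], without leaving the ball
   where f vanishes. *)
have [a ae aw] : exists2 a, `|a - u| < e & dot a w != 0.
  have [uw|uw] := eqVneq (dot u w) 0; last by exists u => //; rewrite subrr normr0.
  exists (u + (e / 2 / `|w|) *: w).
    rewrite addrC addKr normrZ normrM normfV normr_id divfK ?gt_eqF//.
    by rewrite gtr0_norm ?divr_gt0// ltr_pdivrMr// ltr_pMr// ltr1n.
  rewrite dotDl uw add0r dotZl mulf_neq0 ?gt_eqF ?divr_gt0//.
  exact: dotxx_gt0.
pose b := v - a.
(* <a + s b, w> = (1 - s) <a, w> vanishes only for s = 1, where the point is [v]. *)
have line_n0 (s : R) : a + s *: b != 0.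
  apply/eqP => abs; have : dot (a + s *: b) w = 0 by rewrite abs dot0l.
  rewrite dotDl dotZl dotBl (dotC v) wv sub0r mulrN -mulNr -[X in X + _]mul1r -mulrDl => /eqP.
  rewrite mulf_eq0 (negbTE aw) orbF subr_eq0 => /eqP s1.
  by move: abs; rewrite -s1 scale1r /b addrC subrK => /eqP; rewrite (negbTE v0).
pose F (k : nat) : 'rV[R]_n -> R := iter k (fun (f : 'rV[R]_n -> R) x => 'D_b f x) f.
have Fs k l : Ckle l (nonzero n) (F k).
  elim: k l => [|k IH] l; first exact: (@fs l).
  exact: (@Ckle_deriveD R n l (nonzero n) (F k) b (@open_nonzero R n) (IH l.+1)).
pose d : R := (e - `|a - u|) / (1 + `|b|).
have b1 : 0 < 1 + `|b| by rewrite ltr_pwDl.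
have d0 : 0 < d by rewrite divr_gt0// subr_gt0.
have Fd (k : nat) (s : R) : is_derive s 1 (fun r : R => F k (a + r *: b)) (F k.+1 (a + s *: b)).
  have H : is_derive (a + s *: b) b (F k) (F k.+1 (a + s *: b)) :=
    @Ckle_is_derive R n 0 (nonzero n) (F k) (a + s *: b) b (@open_nonzero R n) (Fs k 1%N) (line_n0 s).
  exact: (proj1 (is_derive_line (F k) a b s _) H).
have := @algfun_identity R (fun k s => F k (a + s *: b)) 0 Fd d (fa a b) d0.
have Z s : 0 < s < d -> F 0 (a + s *: b) = 0.
  move=> /andP[s0 sd]; apply: fe; rewrite addrAC.
  apply: le_lt_trans (ler_normD _ _) _; rewrite -ltrBrDl normrZ gtr0_norm//.
  apply: (@le_lt_trans _ _ (s * (1 + `|b|))); first by rewrite (ler_wpM2l (ltW s0))// lerDr.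
  by rewrite -ltr_pdivlMr.
move=> /(_ Z 1 ltr01); rewrite scale1r /b addrC subrK.
exact.
Qed.

Lemma near_lt_at f (c : R) u : {for u, continuous f} -> f u < c -> \forall x \near u, f x < c.
Proof.
move=> fc fu; apply: (fc [set y | y < c]).
by apply: open_nbhs_nbhs; split => //; exact: open_lt.
Qed.

Lemma enorm_orthogonal g v : g *m g^T = 1%:M -> enorm (v *m g) = enorm v.
Proof. by move=> g1; rewrite /enorm dot_mulmx -mulmxA g1 mulmx1. Qed.

Lemma regular_mulmx h g : g *m g^T = 1%:M -> regular h -> regular (fun v => h (v *m g)).
Proof.
move=> g1 [hs ha]; split; last by move=> a b; have := ha (a *m g) (b *m g);
  rewrite (_ : (fun s : R => h (a *m g + s *: (b *m g))) = fun s : R => h ((a + s *: b) *m g))//;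
  apply/funext => s; rewrite mulmxDl scalemxAl.
move=> k; apply: (Ckle_comp (W := nonzero n)) => //; try exact: open_nonzero.
- by move=> x; rewrite /nonzero/= -!enorm_gt0 enorm_orthogonal.
- move=> j; rewrite (_ : (fun x => _) = fun x => dot x (col j g)^T).
    exact: (regular_dot (col j g)^T).1.
  apply/funext => x; rewrite mxE; apply: eq_bigr => i _.
  by rewrite !mxE.
Qed.

Lemma marking_isotropy (f : 'rV[R]_n -> R) (t : R) g :
  let q := marking (Num.sqrt n%:R + 2^-1) ell in
  regular f -> t != 0 -> g *m g^T = 1%:M ->
  (forall v, f (v *m g) + t * q (v *m g) = f v + t * q v) -> g = 1%:M.
Proof.
set c : R := Num.sqrt n%:R + 2^-1 => q fr t0 g1 fq.
have cell x : x != 0 -> {for x, continuous (@ell R n)}.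
  by move=> x0; exact: (@Ckle_continuous _ _ 0%N (nonzero n) _ x ((@regular_ell R n).1 0%N) x0).
have cgap x : x != 0 -> {for x, continuous (fun y => ell y - c * enorm y)}.
  move=> x0; apply: (@continuousB _ _ _ ell (fun y => c * enorm y) x (cell x x0)).
  exact: (continuousM (@cst_continuous _ _ c x) (@continuous_enorm R n x)).
have rg := regular_mulmx g1.
have cg : continuous (fun x : 'rV[R]_n => x *m g).
  move=> x; apply: continuous_rV_at => j.
  rewrite (_ : (fun x => _) = fun x => dot x (col j g)^T); first exact: continuous_dot.
  by apply/funext => y; rewrite mxE; apply: eq_bigr => i _; rewrite !mxE.
have q0 x : ell x - c * enorm x < 0 -> q x = 0.
  move=> xc; rewrite /q /marking theta_le0 ?mulr0// subr_le0.
  have [->|x0] := eqVneq x 0; first by rewrite enorm0 invr0 mulr0 addr_ge0 ?sqrtr_ge0.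
  by rewrite ler_pdivrMr ?enorm_gt0// -subr_le0 ltW.
have qg v : v != 0 -> q (v *m g) = q v.
  have [u0 u00 u0s] := exists_orthogonal (const_mx 1).
  have sumE x : \sum_(i < n) x 0 i = dot x (const_mx 1).
    by apply: eq_bigr => i _; rewrite mxE mulr1.
  (* [u0] and [- u0] both have coordinate sum 0, and their images under [g] have opposite sums, so
     one of the two works. Near it [q] and its transform both vanish. *)
  have [u [un0 us ugs]] : exists u, [/\ u != 0, dot u (const_mx 1) <= 0 & dot (u *m g) (const_mx 1) <= 0].
    have [h|h] := leP (dot (u0 *m g) (const_mx 1)) 0; first by exists u0; split; rewrite ?u0s.
    by exists (- u0); split; rewrite ?oppr_eq0// ?mulNmx dotNl ?u0s ?oppr0// oppr_le0 ltW.
  have gap x : x != 0 -> dot x (const_mx 1) <= 0 -> ell x - c * enorm x < 0.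
    move=> x0 xs; have := @ell_le R n x; rewrite sumE => /(_ xs) h.
    rewrite subr_lt0; apply: le_lt_trans h _; rewrite ltr_pM2r ?enorm_gt0//.
    by rewrite ltrDl invr_gt0.
  have ug0 : u *m g != 0 by rewrite -enorm_gt0 enorm_orthogonal// enorm_gt0.
  move=> v0; apply/eqP; rewrite -subr_eq0; apply/eqP.
  apply: (@regular_identity (fun v => q (v *m g) - q v) u v) => //.
    rewrite (_ : (fun v => _) = fun v => t^-1 * (f v - f (v *m g))).
      by apply: regularM; [exact: regular_cst|exact: (regularB fr (rg _ fr))].
    apply/funext => x; have := fq x => fqx.
    rewrite (_ : f x - f (x *m g) = t * (q (x *m g) - q x)); first by rewrite mulKf.
    by rewrite mulrBr; move: fqx; lra.
  have N1 : \forall x \near u, ell x - c * enorm x < 0.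
    exact: (near_lt_at (cgap u un0) (gap u un0 us)).
  have N2 : \forall x \near u, ell (x *m g) - c * enorm (x *m g) < 0.
    apply: (@near_lt_at (fun x => ell (x *m g) - c * enorm (x *m g))); last exact: gap.
    exact: (@continuous_comp _ _ _ (fun x => x *m g) (fun y => ell y - c * enorm y) u (cg u) (cgap _ ug0)).
  by near=> x; rewrite !q0 ?subrr//; near: x.
have ellg v : v != 0 -> ell (v *m g) = ell v.
  (* At this vector [ell] exceeds the threshold, so [theta] is evaluated where it is injective. *)
  pose u : 'rV[R]_n := delta_mx 0 ord_max.
  have e1 : enorm u = 1 by rewrite /enorm dot_delta mxE !eqxx sqrtr1.
  have u0 : u != 0 by rewrite -enorm_gt0 e1.
  move=> v0; apply/eqP; rewrite -subr_eq0; apply/eqP.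
  apply: (@regular_identity (fun v => ell (v *m g) - ell v) u v) => //.
    by apply: regularB; [exact: rg _ (@regular_ell R n)|exact: regular_ell].
  have N1 : \forall x \near u, - (ell x - c * enorm x) < 0.
    apply: (@near_lt_at (fun x => - (ell x - c * enorm x))); first exact: (continuousN (cgap u u0)).
    by rewrite oppr_lt0 e1 mulr1 ell_last// subr_gt0 /c ltrD2l invf_lt1// ltr1n.
  near=> x; have xc : 0 < ell x - c * enorm x by rewrite -oppr_lt0; near: x.
  have [->|x0] := eqVneq x 0; first by rewrite mul0mx subrr.
  have := qg x x0; rewrite /q /marking enorm_orthogonal// => /(mulfI (lt0r_neq0 _)).
  rewrite enorm_gt0 => /(_ x0) /theta_inj H.
  have {}H : ell (x *m g) / enorm x - c = ell x / enorm x - c.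
    by apply: H; rewrite subr_gt0 ltr_pdivlMr ?enorm_gt0// -subr_gt0.
  apply/eqP; rewrite subr_eq0; move/addIr: H => /(mulIf _) ->//.
  by rewrite invr_eq0 gt_eqF ?enorm_gt0.
apply: ell_isotropy => // v; have [->|v0] := eqVneq v 0; first by rewrite mul0mx.
exact: ellg.
Unshelve. all: by end_near. Qed.

Lemma support_fun_isotropy (D : set 'rV[R]_n) g v : isotropy D g ->
  support_fun D (v *m g) = support_fun D v.
Proof.
move=> [_ gD]; rewrite -[in RHS]gD /support_fun; congr sup.
apply/seteqP; split=> [_ [x Dx <-]|_ [_ [x Dx <-] <-]].
  by exists (x *m g^T); [exists x|rewrite dot_mulmx trmxK].
by exists x => //; rewrite [RHS]dot_mulmx trmxK.
Qed.

End Isotropy.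

(** * Smooth approximation of support functions *)

Section Approximation.
Context {R : realType} {n : nat}.
Implicit Types (D : set 'rV[R]_n) (p q x : 'rV[R]_n) (k : nat).

(** The integers up to 2 (k+1)^2, shifted by (k+1)^2 and divided by k + 1, give the grid of step 1 /
    (k+1) on the cube of half-width k + 1. The extra index [None] supplies the base point of
    [smooth_hull]. *)
Definition grid_index k := option {ffun 'I_n -> 'I_(k.+1 ^ 2).*2.+1}.

Definition grid_point k (z : grid_index k) : 'rV[R]_n :=
  if z is Some z then \row_i (((z i)%:R - k.+1%:R ^+ 2) / k.+1%:R) else 0.

Lemma grid_point_near k p : enorm p <= k.+1%:R ->
  exists z : grid_index k, enorm (grid_point z - p) <= Num.sqrt n%:R / k.+1%:R.
Proof.
move=> pk; pose K : R := k.+1%:R; have K0 : 0 < K by rewrite ltr0n.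
have pK i : `|p 0 i| <= K by apply: le_trans pk; exact: coord_le_enorm.
have b0 i : 0 <= (p 0 i + K) * K.
  by rewrite mulr_ge0 ?(ltW K0)//; have := pK i; rewrite ler_norml => /andP[]; lra.
pose c i : nat := Num.trunc ((p 0 i + K) * K).
have cE i := truncn_itv (b0 i).
have cK i : (c i < (k.+1 ^ 2).*2.+1)%N.
  rewrite ltnS -(ler_nat R); apply: (@le_trans _ _ ((p 0 i + K) * K)).
    by have /andP[] := cE i.
  rewrite -mul2n natrM natrX -/K expr2 mulrA ler_wpM2r ?(ltW K0)//.
  by have := pK i; rewrite ler_norml => /andP[]; lra.
exists (Some [ffun i => inord (c i)]).
apply: le_trans (enorm_le_norm _) _; rewrite ler_wpM2l ?sqrtr_ge0//.
apply: norm_le_coord => [|i]; first by rewrite invr_ge0 ltW.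
rewrite !mxE ffunE inordK// -/K; have /andP[h1 h2] := cE i.
rewrite -/(c i) -natr1 in h1 h2.
rewrite (_ : _ - _ = ((c i)%:R - (p 0 i + K) * K) / K); last first.
  by field; rewrite gt_eqF.
rewrite normrM [`|K^-1|]gtr0_norm ?invr_gt0// -[leRHS]mul1r ler_wpM2r ?invr_ge0 ?(ltW K0)//.
by rewrite ler_norml; apply/andP; split; lra.
Qed.

(** Small enough for the smoothings, one for each grid index, to add up to at most |x| / (k + 1). *)
Definition hull_error k : R := (k.+1%:R * (#|{: grid_index k}|).+1%:R)^-1.

Lemma hull_error_gt0 k : 0 < hull_error k.
Proof. by rewrite invr_gt0 mulr_gt0// ltr0n. Qed.

(* Depends on D only through finitely many projections, hence continuously. *)
Definition approx k D : 'rV[R]_n -> R := smooth_hull (hull_error k)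
  (proj D (@grid_point k None)) (map (proj D \o @grid_point k) (enum {: grid_index k})).

Lemma approx_le k D x : D !=set0 -> compact D -> convex D ->
  approx k D x <= support_fun D x + k.+1%:R^-1 * enorm x.
Proof.
move=> D0 cD vD.
have pD q : D (proj D q) by have [] := projP q D0 cD vD.
apply: le_trans (smooth_hull_le (b := support_fun D x) (hull_error_gt0 k) _) _.
  move=> y; rewrite inE => /predU1P[->|/mapP[z _ ->]]; rewrite dotC; apply: support_fun_ub => //; exact: pD.
rewrite lerD2l mulrA ler_wpM2r ?enorm_ge0//.
rewrite size_map -cardE /hull_error invfM mulrCA ger_pMr ?invr_gt0 ?ltr0n//.
by rewrite ler_pdivrMr ?ltr0n// mul1r ler_nat.
Qed.

(** A point p of D has a grid point q nearby, and the offset of q is no longer than q - p because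
    the offset of p is 0; hence the factor 2. *)
Lemma approx_ge k D x : D !=set0 -> compact D -> convex D -> (forall p, D p -> enorm p <= k.+1%:R) ->
  support_fun D x <= approx k D x + 2 * Num.sqrt n%:R / k.+1%:R * enorm x.
Proof.
move=> D0 cD vD Dk; apply: support_fun_le => // p Dp.
have [z zp] := grid_point_near (Dk p Dp).
set q := grid_point z in zp; set y := proj D q.
have pE : offset D p = 0 by apply/eqP; rewrite offset_eq0//; exact/asboolP.
have qy : enorm (q - y) <= enorm (q - p).
  by have := offset_lipschitz q p D0 cD vD; rewrite pE subr0.
rewrite -[p](subrK y) dotDl addrC; apply: lerD.
  rewrite dotC; apply: (smooth_hull_ge).
  by rewrite inE; apply/orP; right; apply/mapP; exists z => //; rewrite mem_enum.
apply: le_trans (dot_CauchySchwarz _ _) _; rewrite ler_wpM2r ?enorm_ge0//.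
apply: le_trans (enorm_triangle q _ _) _; rewrite enormB.
by rewrite -mulrA; move: (_ / _) zp qy => r; lra.
Qed.

Lemma approx_dist k D x (M : R) : D !=set0 -> compact D -> convex D ->
  (forall p, D p -> enorm p <= M) -> M <= k.+1%:R ->
  `|approx k D x - support_fun D x| <= (2 * Num.sqrt n%:R + 1) / k.+1%:R * enorm x.
Proof.
move=> D0 cD vD DM Mk; have := approx_le k x D0 cD vD.
have -> : (2 * Num.sqrt n%:R + 1) / k.+1%:R * enorm x = 2 * (Num.sqrt n%:R * (k.+1%:R^-1 * enorm x)) + k.+1%:R^-1 * enorm x by ring.
have := @approx_ge k D x D0 cD vD (fun p Dp => le_trans (DM p Dp) Mk).
have -> : 2 * Num.sqrt n%:R / k.+1%:R * enorm x = 2 * (Num.sqrt n%:R * (k.+1%:R^-1 * enorm x)) by ring.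
have e0 := enorm_ge0 x.
have k0 : 0 <= k.+1%:R^-1 * enorm x :> R by rewrite mulr_ge0// invr_ge0.
have s0 : 0 <= Num.sqrt n%:R * (k.+1%:R^-1 * enorm x) by rewrite mulr_ge0 ?sqrtr_ge0.
rewrite ler_distl; move: k0 s0; move: (_^-1 * enorm x) => r k0; move: (_ * r) => r' s0.
by move=> h1 h2; apply/andP; split; lra.
Qed.

Lemma approx_continuous k D (e : R) : D !=set0 -> compact D -> convex D -> 0 < e ->
  exists2 d, 0 < d & forall D', D' !=set0 -> compact D' -> convex D' -> hausdorff_dist D D' < d ->
    forall x, `|approx k D x - approx k D' x| <= e * enorm x.
Proof.
move=> D0 cD vD e0.
pose B := \sum_(z : grid_index k) enorm (proj D (grid_point z) - grid_point z).
have B0 : 0 <= B by apply: sumr_ge0 => z _; exact: enorm_ge0.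
have Bz (z : grid_index k) : enorm (grid_point z - proj D (grid_point z)) <= B.
  rewrite enormB /B (bigD1 z)//= lerDl; apply: sumr_ge0 => ? _; exact: enorm_ge0.
have B1 : 0 < 2 * B + 1 by rewrite ltr_wpDl// mulr_ge0.
(* [B] bounds the distance from each grid point to D. For s <= 1 the bound s (2 B + s) of
   [proj_hausdorff] is at most s (2 B + 1), hence at most e^2. *)
pose d : R := Num.min 1 (e ^+ 2 / (2 * B + 1)).
exists d; first by rewrite lt_min ltr01 divr_gt0// exprn_gt0.
move=> D' D'0 cD' vD' /(hausdorff_dist_lt D0 D'0 cD cD')[s DD' sd] x.
have [s0 _ _] := DD'.
have [s1 se] : s <= 1 /\ s <= e ^+ 2 / (2 * B + 1).
  by move: sd; rewrite lt_min => /andP[/ltW ? /ltW ?].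
apply: (@smooth_hull_lip _ _ _ _ (proj D \o @grid_point k) (proj D' \o @grid_point k)) => z /=.
rewrite -dotBr mulrC; apply: le_trans (ler_norm_dot _ _) _; rewrite ler_wpM2l ?enorm_ge0//.
rewrite -(@ler_pXn2r _ 2) ?nnegrE ?enorm_ge0 ?(ltW e0)//.
apply: le_trans (proj_hausdorff (projP _ D0 cD vD) (projP _ D'0 cD' vD') DD') _.
move: se; rewrite ler_pdivlMr// => se; apply: le_trans se; rewrite ler_wpM2l//.
by apply: lerD => //; rewrite ler_wpM2l.
Qed.

Lemma sublinear_approx k D : sublinear (approx k D).
Proof. exact: sublinear_smooth_hull. Qed.

Lemma regular_approx k D : regular (approx k D).
Proof. exact: (regular_smooth_hull (hull_error_gt0 k)). Qed.

End Approximation.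

(** * A piecewise linear partition of unity *)

Section Hats.
Context {R : realType}.
Implicit Types (s u v : R) (k N : nat).

Definition clip u : R := if u <= 0 then 0 else if u <= 1 then u else 1.

Lemma clip_le u v : u <= v -> 0 <= clip v - clip u <= v - u.
Proof.
move=> uv; rewrite /clip; case: (leP u 0) => u0; case: (leP v 0) => v0;
  case: (leP u 1) => u1; case: (leP v 1) => v1; apply/andP; split; lra.
Qed.

Lemma clip_lipschitz u v : `|clip u - clip v| <= `|u - v|.
Proof.
wlog uv : u v / v <= u => [H|].
  by have [vu|/ltW uv] := leP v u; [exact: H|rewrite distrC [leRHS]distrC H].
by have /andP[h1 h2] := clip_le uv; rewrite !ger0_norm// subr_ge0.
Qed.

(** The tent on [k - 1, k + 1] with peak 1 at k, written as a difference so that the sum over k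
    telescopes. *)
Definition hat k s : R := clip (s + 1 - k%:R) - clip (s - k%:R).

Lemma hat_ge0 k s : 0 <= hat k s.
Proof. by rewrite /hat; have /andP[] := @clip_le (s - k%:R) (s + 1 - k%:R) ltac:(lra). Qed.

Lemma hat_eq0 k s : s + 1 <= k%:R -> hat k s = 0.
Proof. by move=> sk; rewrite /hat /clip !ifT ?subrr//; lra. Qed.

Lemma hat_eq0_gt k s : k.+1%:R <= s -> hat k s = 0.
Proof.
rewrite -natr1 => sk; rewrite /hat /clip.
by case: (leP (s + 1 - k%:R) 0) => h1; case: (leP (s + 1 - k%:R) 1) => h2;
  case: (leP (s - k%:R) 0) => h3; case: (leP (s - k%:R) 1) => h4; lra.
Qed.

Lemma sum_hat N s : 0 <= s -> s + 1 <= N%:R -> \sum_(k < N) hat k s = 1.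
Proof.
move=> s0 sN; have H M : \sum_(k < M) hat k s = clip (s + 1) - clip (s + 1 - M%:R).
  elim: M => [|M IH]; first by rewrite big_ord0 subr0 subrr.
  rewrite big_ord_recr/= IH /hat -natr1 (_ : s + 1 - (M%:R + 1) = s - M%:R); last by ring.
  by rewrite addrA subrK.
rewrite H {2}/clip ifT ?subr_le0// subr0 /clip.
by case: (leP (s + 1) 0) => h1; case: (leP (s + 1) 1) => h2; lra.
Qed.

Lemma continuous_hat k : continuous (hat k).
Proof.
apply: (@cvg_norm_lipschitz R _ _ _ 2) => u v.
have -> : hat k u - hat k v = (clip (u + 1 - k%:R) - clip (v + 1 - k%:R)) -
    (clip (u - k%:R) - clip (v - k%:R)) by rewrite /hat; ring.
apply: le_trans (ler_normB _ _) _; rewrite mulrDl mul1r.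
have h1 := clip_lipschitz (u + 1 - k%:R) (v + 1 - k%:R).
have h2 := clip_lipschitz (u - k%:R) (v - k%:R).
rewrite (_ : u + 1 - k%:R - (v + 1 - k%:R) = u - v) in h1; last by ring.
rewrite (_ : u - k%:R - (v - k%:R) = u - v) in h2; last by ring.
exact: lerD.
Qed.

End Hats.

(** * The homotopy *)

Section Homotopy.
Context {R : realType} {m : nat}.
Notation n := m.+2.
Notation S := (esphere n : set 'rV[R]_n).
Implicit Types (D : set 'rV[R]_n) (u v x : 'rV[R]_n) (p : Ks R n * R) (t : R).

Lemma sublinear_continuous (h : 'rV[R]_n -> R) : sublinear h ->
  (forall k, Ckle k (nonzero n) h) -> continuous h.
Proof.
move=> hsub hs; rewrite (_ : h = support_fun (body h)).
  by apply: continuous_support_fun; [exact: body_nonempty|exact: compact_body].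
by apply/funext => v; rewrite support_fun_body.
Qed.

Lemma bounded_on_esphere (phi : 'rV[R]_n -> R) : continuous phi ->
  exists2 K, 0 <= K & forall u, S u -> `|phi u| <= K.
Proof.
move=> cphi; have cn : continuous (fun x => `|phi x|).
  by move=> x; apply: continuous_comp; [exact: cphi|exact: norm_continuous].
have [c _ cmax] := EVT_max_rV esphere_nonempty compact_esphere (continuous_subspaceT cn).
by exists `|phi c| => // u Su; apply: cmax; exact: mem_set.
Qed.

Lemma support_fun_sphere_dist A B (r : R) v : A !=set0 -> B !=set0 -> compact A -> compact B ->
  (forall u, S u -> `|support_fun A u - support_fun B u| <= r) ->
  `|support_fun A v - support_fun B v| <= r * enorm v.
Proof.
move=> A0 B0 cA cB AB; have [->|v0] := eqVneq v 0.
  have z D : D !=set0 -> compact D -> support_fun D 0 = 0.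
    by move=> D0 cD; rewrite -(scale0r (0 : 'rV[R]_n)) support_funZ// mul0r.
  by rewrite !z// subrr normr0 enorm0 mulr0.
have ev : 0 < enorm v by rewrite enorm_gt0.
have vE : v = enorm v *: ((enorm v)^-1 *: v) by rewrite scalerA divff ?gt_eqF// scale1r.
rewrite {1 2}vE !(@support_funZ _ _ _ _ (enorm v)) ?enorm_ge0//.
rewrite -mulrBr normrM gtr0_norm// mulrC ler_wpM2r ?enorm_ge0//; apply: AB.
by rewrite /esphere/= enormZ gtr0_norm ?invr_gt0// mulVf ?gt_eqF.
Qed.

Definition marker x : R := (1 + (Num.sqrt n%:R + 2^-1)) * enorm x +
  marking (Num.sqrt n%:R + 2^-1) ell x.

Lemma sublinear_marker : sublinear marker.
Proof.
apply: sublinear_marking; last exact: sublinear_ell.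
by rewrite addr_ge0 ?sqrtr_ge0.
Qed.

Lemma Ckle_marker k : Ckle k (nonzero n) marker.
Proof.
apply: CkleD; first exact: open_nonzero.
- apply: CkleM; [exact: open_nonzero|exact: Ckle_cst|exact: (@regular_enorm R n).1].
- by apply: Ckle_marking; exact: (@regular_ell R n).1.
Qed.

(** The parameter is s = 1 / t, so at most two neighbouring levels contribute. A level k contributes
    only if k < s + 1, and trunc s + 2 terms reach all of these. *)
Definition mixture D t x : R :=
  \sum_(k < (Num.trunc t^-1).+2) hat k t^-1 * approx k D x.

Lemma sublinear_mixture D t : sublinear (mixture D t).
Proof.
apply: sublinear_sum => k _; apply: sublinearZ; [exact: hat_ge0|exact: sublinear_approx].
Qed.

Lemma regular_mixture D t : regular (mixture D t).
Proof.
by apply: regular_sum => k _; apply: regularM; [exact: regular_cst|exact: regular_approx].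
Qed.

(** The number of terms of [mixture] jumps with t; a longer sum, constant on a neighbourhood, has
    the same value. *)
Lemma sum_hat_widen (s : R) N N' (F : nat -> R) : s + 1 <= N%:R -> (N <= N')%N ->
  \sum_(k < N') hat k s * F k = \sum_(k < N) hat k s * F k.
Proof.
move=> sN /subnKC <-; elim: (N' - N)%N => [|j IH]; first by rewrite addn0.
rewrite addnS big_ord_recr/= IH hat_eq0 ?mul0r ?addr0//.
by apply: le_trans sN _; rewrite ler_nat leq_addr.
Qed.

Lemma truncn2_gt (s : R) : s + 1 <= (Num.trunc s).+2%:R.
Proof. by rewrite -natr1 lerD2r ltW// truncnS_gt. Qed.

Lemma mixture_dist D t u (M : R) : 0 < t -> D !=set0 -> compact D -> convex D ->
  (forall x, D x -> enorm x <= M) -> M <= t^-1 -> S u ->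
  `|mixture D t u - support_fun D u| <= (2 * Num.sqrt n%:R + 1) * t.
Proof.
move=> t0 D0 cD vD DM Mt Su; have s0 : 0 < t^-1 by rewrite invr_gt0.
have c0 : 0 <= 2 * Num.sqrt n%:R + 1 :> R by rewrite addr_ge0 ?mulr_ge0 ?sqrtr_ge0.
have s1 := sum_hat (ltW s0) (truncn2_gt t^-1).
rewrite -[support_fun D u]mul1r -[in X in _ - X]s1 mulr_suml -sumrB.
rewrite [leRHS](_ : _ = \sum_(k < (Num.trunc t^-1).+2) hat k t^-1 * ((2 * Num.sqrt n%:R + 1) * t)); last first.
  by rewrite -mulr_suml s1 mul1r.
apply: le_trans (ler_norm_sum _ _ _) _; apply: ler_sum => k _.
rewrite -mulrBr normrM ger0_norm ?hat_ge0//.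
(* A contributing level has k + 1 > 1 / t: its grid covers D and its error is at most a multiple of
   t. *)
have [ks|ks] := leP k.+1%:R t^-1; first by rewrite hat_eq0_gt// !mul0r.
rewrite ler_wpM2l ?hat_ge0//.
apply: le_trans (approx_dist _ D0 cD vD DM (le_trans Mt (ltW ks))) _.
rewrite Su mulr1 ler_wpM2l// invf_ple ?posrE ?ltr0n//.
exact: ltW.
Qed.

Definition core D t x : R := mixture D t x + t * marker x.

Definition unbalanced D t : 'rV[R]_n -> R := thicken (core D t) t.

(** The translation is put into the core, so that the final body is still of the form [thicken] and
    the results on smoothness and curvature apply to it. *)
Definition balanced_core D t x : R := core D t x + dot x (recentre (unbalanced D t)).

Lemma sublinear_core D t : 0 < t -> sublinear (core D t).
Proof.
move=> t0; apply: sublinearD; first exact: sublinear_mixture.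
by apply: sublinearZ; [exact: ltW|exact: sublinear_marker].
Qed.

Lemma Ckle_core D t k : Ckle k (nonzero n) (core D t).
Proof.
apply: CkleD; [exact: open_nonzero|exact: (regular_mixture D t).1|].
by apply: CkleM; [exact: open_nonzero|exact: Ckle_cst|exact: Ckle_marker].
Qed.

Lemma continuous_unbalanced D t : 0 < t -> continuous (unbalanced D t).
Proof.
move=> t0; apply: sublinear_continuous; first exact: (sublinear_thicken (sublinear_core D t0) t0).
move=> k; apply: CkleD; [exact: open_nonzero|exact: Ckle_core|].
apply: CkleM; [exact: open_nonzero|exact: Ckle_cst|exact: (@regular_enorm R n).1].
Qed.

Lemma sublinear_balanced_core D t : 0 < t -> sublinear (balanced_core D t).
Proof. by move=> t0; apply: sublinearD; [exact: sublinear_core|exact: sublinear_dot]. Qed.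

Lemma Ckle_balanced_core D t k : Ckle k (nonzero n) (balanced_core D t).
Proof.
by apply: CkleD; [exact: open_nonzero|exact: Ckle_core|exact: (regular_dot _).1].
Qed.

Definition smoothing D t : set 'rV[R]_n := body (thicken (balanced_core D t) t).

Lemma support_fun_smoothing D t v : 0 < t ->
  support_fun (smoothing D t) v = unbalanced D t v + dot v (recentre (unbalanced D t)).
Proof.
move=> t0; rewrite support_fun_body//; last 2 first.
- exact: (sublinear_thicken (sublinear_balanced_core D t0) t0).
- move=> k; apply: CkleD; [exact: open_nonzero|exact: Ckle_balanced_core|].
  apply: CkleM; [exact: open_nonzero|exact: Ckle_cst|exact: (@regular_enorm R n).1].
by rewrite /thicken /balanced_core /unbalanced /thicken addrAC.
Qed.

Lemma convex_body_smoothing D t : 0 < t -> convex_body (smoothing D t).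
Proof.
move=> t0; exact: (convex_body_thicken (sublinear_balanced_core D t0) (Ckle_balanced_core D t) t0).
Qed.

Lemma compact_smoothing D t : compact (smoothing D t).
Proof. exact: compact_body. Qed.

Lemma convex_smoothing D t : convex (smoothing D t).
Proof. exact: convex_body_of. Qed.

Lemma smoothing_nonempty D t : 0 < t -> smoothing D t !=set0.
Proof.
by move=> t0; have [_ _ [x xD]] := convex_body_smoothing D t0; exists x; exact: interior_subset.
Qed.

Lemma steiner_point_smoothing D t : 0 < t -> steiner_point (smoothing D t) = 0.
Proof.
move=> t0; apply/steiner_point_eq0 => i.
rewrite -(sphere_moment_recentre i (@continuous_unbalanced D t t0)).
by apply: eq_sphere_moment => u _; exact: support_fun_smoothing.
Qed.

Lemma isotropy_smoothing D t : 0 < t -> isotropy (smoothing D t) = [set 1%:M].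
Proof.
move=> t0; apply/seteqP; split=> [g gC|_ ->]; last first.
  split; first by rewrite /orthogonal_group/= trmx1 mulmx1.
  apply/seteqP; split=> [_ [x Dx <-]|x Dx]; first by rewrite trmx1 mulmx1.
  by exists x => //; rewrite trmx1 mulmx1.
have [g1 _] := gC.
(* All summands except the one with [theta], including the multiples of |x| from the marker and the
   thickening. *)
pose f x := mixture D t x + t * (1 + (Num.sqrt n%:R + 2^-1)) * enorm x + t * enorm x +
  dot x (recentre (unbalanced D t)).
have E v : support_fun (smoothing D t) v = f v + t * marking (Num.sqrt n%:R + 2^-1) ell v.
  by rewrite support_fun_smoothing// /f /unbalanced /thicken /core /marker; ring.
apply: (@marking_isotropy R m f t g) => //; last first.
- by move=> v; rewrite -!E (support_fun_isotropy _ gC).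
- by rewrite gt_eqF.
- have rZ (c : R) : regular (fun x : 'rV[R]_n => c * enorm x).
    by apply: regularM; [exact: regular_cst|exact: regular_enorm].
  exact: (regularD (regularD (regularD (regular_mixture D t) (rZ _)) (rZ t)) (regular_dot _)).
Qed.

(** The support function before recentring. For t <= 0 the body is already centred, so the same
    translation formula holds there, and continuity of the homotopy reduces to that of profiles. *)
Definition profile p : 'rV[R]_n -> R :=
  if 0 < p.2 then unbalanced p.1 p.2 else support_fun p.1.

Lemma continuous_profile p : continuous (profile p).
Proof.
rewrite /profile; case: ifP => [/continuous_unbalanced|_]; first exact.
by apply: continuous_support_fun; [exact: Ks_nonempty|exact: Ks_compact].
Qed.

Definition smoothing_Ks p : Ks R n :=
  match pselect (0 < p.2) with
  | left t0 => MkKs (smoothing_nonempty p.1 t0) (@compact_smoothing p.1 p.2)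
      (@convex_smoothing p.1 p.2) (steiner_point_smoothing p.1 t0)
  | right _ => p.1
  end.

Lemma smoothing_KsE p : 0 < p.2 -> smoothing_Ks p = smoothing p.1 p.2 :> set _.
Proof. by rewrite /smoothing_Ks; case: pselect. Qed.

Lemma smoothing_Ks_le0 p : p.2 <= 0 -> smoothing_Ks p = p.1.
Proof. by rewrite /smoothing_Ks; case: pselect => // t0; rewrite leNgt t0. Qed.

Lemma support_fun_smoothing_Ks p v :
  support_fun (smoothing_Ks p) v = profile p v + dot v (recentre (profile p)).
Proof.
have [t0|t0] := ltP 0 p.2.
  by rewrite smoothing_KsE// support_fun_smoothing// /profile t0.
rewrite smoothing_Ks_le0// /profile ltNge t0/= recentre_eq0 ?dot0r ?addr0//.
exact/steiner_point_eq0/Ks_steiner.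
Qed.

Lemma Bp_free_smoothing p : 0 < p.2 -> Bp_free R n (smoothing_Ks p).
Proof.
move=> t0; rewrite /Bp_free/= smoothing_KsE// isotropy_smoothing//; split => //.
rewrite /Bp/= smoothing_KsE//.
have hsub := sublinear_balanced_core p.1 t0.
have hs := Ckle_balanced_core p.1 p.2.
split; last exact: (positively_curved_thicken hsub hs t0).
by split; [exact: convex_body_smoothing|exact: (submanifold_thicken hsub hs t0)].
Qed.

Lemma near_dist p (d : R) : 0 < d -> \forall q \near p, hausdorff_dist p.1 (q : Ks R n * R).1 < d.
Proof. by move=> d0; exact: (cvg_fst (nbhsx_ballx p.1 d d0)). Qed.

Lemma near_time p (d : R) : 0 < d -> \forall q \near p, `|p.2 - q.2| < d.
Proof. by move=> d0; exact: (cvg_snd (nbhsx_ballx p.2 d d0)). Qed.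

Definition sphere_cvg (F : Ks R n * R -> 'rV[R]_n -> R) p := forall e : R, 0 < e ->
  \forall q \near p, forall u, S u -> `|F q u - F p u| <= e.

Lemma sphere_cvgM (w : Ks R n * R -> R) F p : {for p, continuous w} -> sphere_cvg F p ->
  (exists2 K, 0 <= K & forall u, S u -> `|F p u| <= K) -> sphere_cvg (fun q u => w q * F q u) p.
Proof.
move=> cw cF [K K0 FK] e e0.
have d0 : 0 < Num.min 1 (e / 2 / (K + 1)) by rewrite lt_min ltr01 !divr_gt0// ltr_wpDl.
have N1 : \forall q \near p, `|w q - w p| < Num.min 1 (e / 2 / (K + 1)).
  have : \forall q \near p, ball (w p) (Num.min 1 (e / 2 / (K + 1))) (w q) := cw _ (nbhsx_ballx (w p) _ d0).
  by apply: filterS => q; rewrite -ball_normE/= distrC.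
have d1 : 0 < e / 2 / (`|w p| + 1) by rewrite !divr_gt0// ltr_wpDl.
have N2 := cF _ d1.
near=> q; move=> u Su.
have h1 : `|w q - w p| < Num.min 1 (e / 2 / (K + 1)) by near: q.
have h2 : `|F q u - F p u| <= e / 2 / (`|w p| + 1) by move: u Su; near: q.
move: h1; rewrite lt_min => /andP[h3 h4].
rewrite (_ : _ - _ = w q * (F q u - F p u) + (w q - w p) * F p u); last by ring.
apply: le_trans (ler_normD _ _) _; rewrite [leRHS]splitr !normrM; apply: lerD.
  apply: (@le_trans _ _ ((`|w p| + 1) * (e / 2 / (`|w p| + 1)))).
    apply: ler_pM => //; rewrite -[w q](subrK (w p)) addrC.
    by apply: le_trans (ler_normD _ _) _; rewrite lerD2l ltW.
  by rewrite mulrC divfK// gt_eqF// ltr_wpDl.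
apply: (@le_trans _ _ (e / 2 / (K + 1) * (K + 1))).
  apply: ler_pM => //; first exact: ltW.
  by apply: le_trans (FK u Su) _; rewrite lerDl.
by rewrite divfK// gt_eqF// ltr_wpDl.
Unshelve. all: by end_near. Qed.

Lemma sphere_cvgD F G p : sphere_cvg F p -> sphere_cvg G p ->
  sphere_cvg (fun q u => F q u + G q u) p.
Proof.
move=> cF cG e e0; have e20 : 0 < e / 2 by rewrite divr_gt0.
have N1 := cF _ e20; have N2 := cG _ e20.
near=> q; move=> u Su; rewrite opprD addrACA [leRHS]splitr.
apply: le_trans (ler_normD _ _) _; apply: lerD; move: u Su; near: q; [exact: N1|exact: N2].
Unshelve. all: by end_near. Qed.

Lemma sphere_cvg_cst (phi : 'rV[R]_n -> R) p : sphere_cvg (fun=> phi) p.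
Proof. by move=> e e0; near=> q => u _; rewrite subrr normr0 ltW. Unshelve. all: by end_near. Qed.

Lemma sphere_cvg_sum N (F : nat -> Ks R n * R -> 'rV[R]_n -> R) p :
  (forall k, sphere_cvg (F k) p) -> sphere_cvg (fun q u => \sum_(k < N) F k q u) p.
Proof.
move=> cF; elim: N => [|N IH].
  rewrite (_ : (fun q => _) = fun _ _ => 0); first exact: sphere_cvg_cst.
  by apply/funext => q; apply/funext => u; rewrite big_ord0.
rewrite (_ : (fun q => _) = fun q u => \sum_(k < N) F k q u + F N q u).
  exact: sphere_cvgD.
by apply/funext => q; apply/funext => u; rewrite big_ord_recr.
Qed.

Lemma sphere_cvg_approx k p : sphere_cvg (fun q => approx k q.1) p.
Proof.
move=> e e0.
have [d d0 H] := approx_continuous k (@Ks_nonempty _ _ p.1) (@Ks_compact _ _ p.1) (@Ks_convex _ _ p.1) e0.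
apply: filterS (near_dist p d0) => q pq u Su.
have := H q.1 (@Ks_nonempty _ _ q.1) (@Ks_compact _ _ q.1) (@Ks_convex _ _ q.1) pq u.
by rewrite Su mulr1 distrC.
Qed.

Lemma sphere_cvg_unbalanced p : 0 < p.2 -> sphere_cvg (fun q => unbalanced q.1 q.2) p.
Proof.
move=> t0; pose N := (Num.trunc (2 / p.2)).+2.
pose G (q : Ks R n * R) u := \sum_(k < N) hat k q.2^-1 * approx k q.1 u + q.2 * (marker u + enorm u).
have GE (q : Ks R n * R) : p.2 / 2 < q.2 -> unbalanced q.1 q.2 = G q.
  move=> pq; apply/funext => u; rewrite /unbalanced /thicken /core /G (mulrDr q.2 (marker u)) addrA.
  congr (_ + _ + _); rewrite /mixture; symmetry.
  apply: (@sum_hat_widen _ _ _ (fun k => approx k q.1 u)); first exact: truncn2_gt.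
  rewrite /N !ltnS; apply: le_truncn; rewrite -[leLHS]mul1r ler_pdivrMr; last first.
    by apply: lt_trans pq; rewrite divr_gt0.
  by rewrite mulrAC ler_pdivlMr// mul1r; move: pq; lra.
have csnd : {for p, continuous (fun q : Ks R n * R => q.2)} by exact: cvg_snd.
have cG : sphere_cvg G p.
  apply: sphere_cvgD.
    apply: (@sphere_cvg_sum N (fun k (q : Ks R n * R) u => hat k q.2^-1 * approx k q.1 u)) => k.
    apply: (@sphere_cvgM (fun q : Ks R n * R => hat k q.2^-1) (fun q : Ks R n * R => approx k q.1)).
    - have cinv : {for p, continuous (fun q : Ks R n * R => q.2^-1)}.
        by apply: cvgV => //; rewrite gt_eqF.
      exact: (@continuous_comp _ _ _ (fun q : Ks R n * R => q.2^-1) (hat k) p cinv (@continuous_hat R k _)).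
    - exact: sphere_cvg_approx.
    - apply: bounded_on_esphere; apply: sublinear_continuous; first exact: sublinear_approx.
      exact: (regular_approx k p.1).1.
  apply: sphere_cvgM => //; first exact: sphere_cvg_cst.
  apply: bounded_on_esphere => x.
  apply: (@continuousD _ _ _ marker (@enorm R n) x); last exact: continuous_enorm.
  by apply: sublinear_continuous; [exact: sublinear_marker|exact: Ckle_marker].
move=> e e0; have p20 : 0 < p.2 / 2 by rewrite divr_gt0.
have N1 := near_time p p20; have N2 := cG e e0.
near=> q; have h1 : `|p.2 - q.2| < p.2 / 2 by near: q.
have {}h1 : p.2 / 2 < q.2 by move: h1; rewrite ltr_norml => /andP[]; lra.
by rewrite (GE q h1) (GE p)//; [near: q|lra].
Unshelve. all: by end_near. Qed.

(** For t > 0 this is the continuity of a finite sum. At t = 0 the error of the mixture is of order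
    t only for bodies of radius at most 1 / t; near p this holds because bodies at Hausdorff
    distance below 1 have radius at most M + 1. *)
Lemma profile_near p (e : R) : 0 <= p.2 -> 0 < e ->
  \forall q \near p, 0 <= q.2 -> forall u, S u -> `|profile q u - profile p u| <= e.
Proof.
rewrite le_eqVlt => /orP[/eqP/esym t0|t0] e0; last first.
  have N1 := near_time p t0; have N2 := sphere_cvg_unbalanced t0 e0.
  near=> q; move=> _ u Su.
  have h1 : `|p.2 - q.2| < p.2 by near: q.
  have h2 : 0 < q.2 by move: h1; rewrite ltr_norml => /andP[]; lra.
  by rewrite /profile t0 h2; move: u Su; near: q.
have [M M0 pM] := compact_enorm_bounded (@Ks_compact _ _ p.1).
have [K K0 mK] := bounded_on_esphere (sublinear_continuous sublinear_marker Ckle_marker).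
(* The factors of t in the total error: 2 sqrt n + 1 from the mixture, K from the marker, 1 from the
   thickening. *)
pose c : R := 2 * Num.sqrt n%:R + 1 + K + 1.
have c0 : 0 < c by rewrite ltr_wpDl// !addr_ge0 ?mulr_ge0 ?sqrtr_ge0.
have e20 : 0 < e / 2 by rewrite divr_gt0.
have M1 : 0 < M + 1 by rewrite ltr_wpDl.
have N1 := near_dist p ltr01; have N2 := near_dist p e20.
have N3 := near_time p (divr_gt0 e20 c0).
have N4 : \forall q \near p, `|p.2 - q.2| < (M + 1)^-1 by apply: near_time; rewrite invr_gt0.
near=> q; move=> q0 u Su; rewrite {2}/profile t0 ltxx.
have pq : `|support_fun q.1 u - support_fun p.1 u| <= e / 2.
  have pqe : hausdorff_dist p.1 q.1 < e / 2 by near: q.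
  have := @support_fun_dist_le R n p.1 q.1 (e / 2) u (@Ks_nonempty _ _ p.1) (@Ks_nonempty _ _ q.1)
    (@Ks_compact _ _ p.1) (@Ks_compact _ _ q.1) pqe.
  by rewrite Su mulr1 distrC.
have [qt|qt] := ltP 0 q.2; last first.
  by rewrite /profile ltNge qt/=; apply: le_trans pq _; rewrite ler_pdivrMr// ler_pMr// ler1n.
have h3 : `|p.2 - q.2| < e / 2 / c by near: q.
have h4 : `|p.2 - q.2| < (M + 1)^-1 by near: q.
rewrite t0 sub0r normrN gtr0_norm// in h3 h4.
have qM x : (q.1 : set _) x -> enorm x <= M + 1.
  move=> qx; have : hausdorff_dist p.1 q.1 < 1 by near: q.
  move=> /(hausdorff_dist_lt (@Ks_nonempty _ _ p.1) (@Ks_nonempty _ _ q.1) (@Ks_compact _ _ p.1) (@Ks_compact _ _ q.1)).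
  move=> [s [_ _ /(_ x qx)[y py xy]] s1].
  rewrite -[x](subrK y) addrC; apply: le_trans (enormD _ _) _; apply: lerD; first exact: pM.
  by rewrite enormB; apply: le_trans xy (ltW s1).
have mt : M + 1 <= q.2^-1 by rewrite -[M + 1]invrK lef_pV2 ?posrE ?invr_gt0// ltW.
have h5 := mixture_dist qt (@Ks_nonempty _ _ q.1) (@Ks_compact _ _ q.1) (@Ks_convex _ _ q.1) qM mt Su.
rewrite /profile qt /unbalanced /thicken /core Su mulr1.
rewrite (_ : _ - _ = (mixture q.1 q.2 u - support_fun q.1 u) + q.2 * (marker u + 1) +
  (support_fun q.1 u - support_fun p.1 u)); last by ring.
rewrite [leRHS]splitr; apply: le_trans (ler_normD _ _) _; apply: lerD => //.
apply: le_trans (ler_normD _ _) _.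
have h6 : `|q.2 * (marker u + 1)| <= q.2 * (K + 1).
  rewrite normrM gtr0_norm// (ler_wpM2l (ltW qt))//.
  by apply: le_trans (ler_normD _ _) _; rewrite normr1 lerD2r mK.
move: h3; rewrite ltr_pdivlMr// /c; move: h5 h6; rewrite /c; nra.
Unshelve. all: by end_near. Qed.

Lemma continuous_smoothing_Ks :
  {within [set: Ks R n] `*` `[0, 1]%classic, continuous smoothing_Ks}.
Proof.
apply/subspace_continuousP => p [_ p01]; apply/cvg_ballP => e e0.
have p0 : 0 <= p.2 by move: p01; rewrite /= in_itv/= => /andP[].
have [C C0 HC] := @recentre_lipschitz R m.+1.
have C1 : 0 < 1 + C by rewrite ltr_pwDl.
(* Profiles within r have translations within C r, so the support functions differ on the sphere by
   at most (1 + C) r = e / 2. *)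
pose r : R := e / 2 / (1 + C).
have r0 : 0 < r by rewrite !divr_gt0.
apply: filterS (profile_near p0 r0) => q pq [_ q01].
have q0 : 0 <= q.2 by move: q01; rewrite /= in_itv/= => /andP[].
have {}pq u : S u -> `|profile p u - profile q u| <= r by rewrite distrC; exact: pq.
apply: (@le_lt_trans _ _ (e / 2)); last by rewrite ltr_pdivrMr// ltr_pMr// ltr1n.
apply: hausdorff_dist_support; do ?[exact: Ks_nonempty|exact: Ks_compact|exact: Ks_convex].
  by rewrite ltW// divr_gt0.
move=> v; apply: support_fun_sphere_dist; do ?[exact: Ks_nonempty|exact: Ks_compact].
move=> u Su; rewrite !support_fun_smoothing_Ks opprD addrACA -dotBr.
apply: le_trans (ler_normD _ _) _.
rewrite (_ : e / 2 = r + C * r); last by rewrite /r; field; rewrite gt_eqF.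
apply: lerD; first exact: pq.
apply: le_trans (ler_norm_dot _ _) _; rewrite Su mul1r.
by apply: HC => //; exact: continuous_profile.
Qed.

End Homotopy.

Theorem lemma8p2 (R : realType) (n : nat) (hn : (2 <= n)%N) (X : set (Ks R n))
    (hX : Bp_free R n `<=` X) : homotopy_dense R X.
Proof.
case: n hn X hX => [|[|m]]// _ X hX.
exists smoothing_Ks; split; first exact: continuous_smoothing_Ks.
- by move=> D; rewrite smoothing_Ks_le0.
- by move=> D t /andP[t0 _]; apply: hX; exact: Bp_free_smoothing.
Qed.
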